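(* Assume the weight functions $\hat w^{(n)}$ are estimated on a data set $\mathbf A$ independent of $(\mathbf X^{(n)},\mathbf Y^{(n)},\mathbf Z^{(n)})$, that $\hat f,\hat g$ are estimated on an auxiliary data set independent of both $(\mathbf X^{(n)},\mathbf Y^{(n)},\mathbf Z^{(n)})$ and $\mathbf A$, and that there exists $C>0$ with $|\hat w^{(n)}(z)|\le C$ for all $n$ and $z$. For $P\in\mathcal E_0$ let $\bar\rho_{P,n}=\mathbb E_P[\epsilon_P\xi_P\hat w^{(n)}(Z)\mid\mathbf A]$ and $\bar\sigma_n^2=\bar\sigma_{P,n}^2=\operatorname{Var}_P(\epsilon_P\xi_P\hat w^{(n)}(Z)\mid\mathbf A)$. 1. Let $P\in\mathcal E_0$. Assume $A_fA_g=o_P(n^{-1})$, $B_f=o_P(1)$, $B_g=o_P(1)$, that there exists $\eta>0$ with $\mathbb E_P[|\epsilon_P\xi_P|^{2+\eta}]<\infty$, and that $P$-almost surely there exists $c>0$ with $\inf_n\bar\sigma_n^2\ge c$. Then $\sup_{t\in\mathbb R}\big|\mathbb P_P\big(T^{(n)}-\sqrt n\,\bar\rho_{P,n}/\tau_D^{(n)}\le t\big)-\Phi(t)\big|\to0$. 2. Let $\mathcal P\subset\mathcal E_0$. Assume $A_fA_g=o_{\mathcal P}(n^{-1})$, $B_f=o_{\mathcal P}(1)$, $B_g=o_{\mathcal P}(1)$, that there exists $\eta>0$ with $\sup_{P\in\mathcal P}\mathbb E_P[|\epsilon_P\xi_P|^{2+\eta}]<\infty$, and that there exists $c>0$ such that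 for all $P\in\mathcal P$, $P$-almost surely $\inf_n\bar\sigma_n^2\ge c$. Then $\sup_{P\in\mathcal P}\sup_{t\in\mathbb R}\big|\mathbb P_P\big(T^{(n)}-\sqrt n\,\bar\rho_{P,n}/\tau_D^{(n)}\le t\big)-\Phi(t)\big|\to0$.
   Context: Let $X,Y$ be real-valued random variables and $Z$ a random vector in $\mathbb R^{d_Z}$. $\mathcal E_0$ is the set of distributions of $(X,Y,Z)$ absolutely continuous with respect to Lebesgue measure. For $P\in\mathcal E_0$: $f_P(z)=\mathbb E_P[X\mid Z=z]$, $g_P(z)=\mathbb E_P[Y\mid Z=z]$, $\epsilon_P=X-f_P(Z)$, $\xi_P=Y-g_P(Z)$, $u_P(z)=\mathbb E_P[\epsilon_P^2\mid Z=z]$, $v_P(z)=\mathbb E_P[\xi_P^2\mid Z=z]$. Data $(x_i,y_i,z_i)$, $i=1,\dots,n$, i.i.d. copies of $(X,Y,Z)$ form $(\mathbf X^{(n)},\mathbf Y^{(n)},\mathbf Z^{(n)})$; $\hat f,\hat g$ are estimates of $f_P,g_P$. $A_f=\frac1n\sum_i(f_P(z_i)-\hat f(z_i))^2$, $A_g=\frac1n\sum_i(g_P(z_i)-\hat g(z_i))^2$, $B_f=\frac1n\sum_i(f_P(z_i)-\hat f(z_i))^2v_P(z_i)$, $B_g=\frac1n\sum_i(g_P(z_i)-\hat g(z_i))^2u_P(z_i)$. With $R_i^{(n)}=(x_i-\hat f(z_i))(y_i-\hat g(z_i))\hat w^{(n)}(z_i)$: $\tau_N^{(n)}=\frac1{\sqrt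 n}\sum_iR_i^{(n)}$, $\tau_D^{(n)}=\big(\frac1n\sum_i(R_i^{(n)})^2-(\frac1n\sum_rR_r^{(n)})^2\big)^{1/2}$, $T^{(n)}=\tau_N^{(n)}/\tau_D^{(n)}$. $\Phi$ is the standard normal distribution function. For a family $\mathcal P$, $V_n=o_{\mathcal P}(W_n)$ means $\sup_{P\in\mathcal P}\mathbb P_P(|V_n/W_n|>\delta)\to0$ for all $\delta>0$; $o_P$ is the case $\mathcal P=\{P\}$. *)

(* Defs.v *)
From HB Require Import structures.
From mathcomp Require Import all_boot all_order all_algebra.
From mathcomp Require Import all_classical all_reals all_analysis.
From mathcomp Require Import measurable_realfun.
Set Implicit Arguments. Unset Strict Implicit. Unset Printing Implicit Defensive.
Import Order.TTheory GRing.Theory Num.Theory.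
Local Open Scope classical_set_scope.
Local Open Scope ring_scope.

(* R^{d_Z} is dZ.-tuple R with the product (coordinate) sigma-algebra.      *)
Definition Zsp (R : realType) (dZ : nat) := (dZ.-tuple R)%type.
Definition pt (R : realType) (dZ : nat) := (R * R * dZ.-tuple R)%type.

Section Obs.
Context {R : realType} {dZ : nat}.
Definition xX (p : pt R dZ) : R := p.1.1.
Definition yY (p : pt R dZ) : R := p.1.2.
Definition zZ (p : pt R dZ) : dZ.-tuple R := p.2.

Definition box_ok (lo hi : pt R dZ) : Prop :=
  [/\ lo.1.1 <= hi.1.1, lo.1.2 <= hi.1.2 & forall i, tnth lo.2 i <= tnth hi.2 i].
Definition in_box (lo hi : pt R dZ) (x : pt R dZ) : Prop :=
  [/\ lo.1.1 <= x.1.1 <= hi.1.1, lo.1.2 <= x.1.2 <= hi.1.2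
    & forall i, tnth lo.2 i <= tnth x.2 i <= tnth hi.2 i].
Definition box_vol (lo hi : pt R dZ) : R :=
  (hi.1.1 - lo.1.1) * (hi.1.2 - lo.1.2) * \prod_(i < dZ) (tnth hi.2 i - tnth lo.2 i).

Definition lebesgue_null (N : set (pt R dZ)) : Prop :=
  forall e : R, 0 < e -> exists lo hi : nat -> pt R dZ,
    [/\ forall k, box_ok (lo k) (hi k),
        N `<=` \bigcup_k [set x | in_box (lo k) (hi k) x]
      & forall m, \sum_(k < m) box_vol (lo k) (hi k) <= e].

Definition in_E0 (P : probability (pt R dZ) R) : Prop :=
  forall N, measurable N -> lebesgue_null N -> P N = 0%E.

Definition cexp_version (P : probability (pt R dZ) R) (h : pt R dZ -> R)
    (f : dZ.-tuple R -> R) : Prop :=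
  [/\ measurable_fun setT f,
      P.-integrable setT (EFin \o h),
      P.-integrable setT (EFin \o (f \o zZ))
    & forall B : set (dZ.-tuple R), measurable B ->
        (\int[P]_(p in zZ @^-1` B) (h p)%:E =
         \int[P]_(p in zZ @^-1` B) (f (zZ p))%:E)%E].

Definition cexp_version_nneg (P : probability (pt R dZ) R) (h : pt R dZ -> \bar R)
    (u : dZ.-tuple R -> \bar R) : Prop :=
  [/\ measurable_fun setT u, forall z, (0 <= u z)%E
    & forall B : set (dZ.-tuple R), measurable B ->
        (\int[P]_(p in zZ @^-1` B) h p =
         \int[P]_(p in zZ @^-1` B) u (zZ p))%E].

Definition epsP (f : dZ.-tuple R -> R) (p : pt R dZ) : R := xX p - f (zZ p).
Definition xiP (g : dZ.-tuple R -> R) (p : pt R dZ) : R := yY p - g (zZ p).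

(* rho_bar_{P,n} and sigma_bar^2_{P,n}, as functions of the realisation a of the
   independent data set A (conditioning on A = a) *)
Definition rho_bar {TA : Type} (P : probability (pt R dZ) R) (f g : dZ.-tuple R -> R)
    (wn : TA -> dZ.-tuple R -> R) (a : TA) : R :=
  Rintegral P setT (fun p => epsP f p * xiP g p * wn a (zZ p)).
Definition sigma2_bar {TA : Type} (P : probability (pt R dZ) R) (f g : dZ.-tuple R -> R)
    (wn : TA -> dZ.-tuple R -> R) (a : TA) : R :=
  Rintegral P setT (fun p => (epsP f p * xiP g p * wn a (zZ p) - rho_bar P f g wn a) ^+ 2).
End Obs.

Definition gen_events {dO : measure_display} {Omega : measurableType dO}
    {d' : measure_display} {T' : measurableType d'} (X : Omega -> T') : set (set Omega) :=
  [set X @^-1` B | B in measurable].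

Definition mutually_indep {dO : measure_display} {Omega : measurableType dO}
    {R : realType} {I : eqType} (Q : probability Omega R) (G : I -> set (set Omega)) : Prop :=
  forall (J : seq I) (E : I -> set Omega), uniq J -> (forall i, i \in J -> G i (E i)) ->
    Q (\big[setI/setT]_(i <- J) E i) = (\prod_(i <- J) Q (E i))%E.

Definition sampling_model {dO dA dB : measure_display} {Omega : measurableType dO}
    {TA : measurableType dA} {TB : measurableType dB} {R : realType} {dZ : nat}
    (Q : probability Omega R) (P : probability (pt R dZ) R)
    (D : nat -> Omega -> pt R dZ) (A : Omega -> TA) (Aux : Omega -> TB) : Prop :=
  [/\ forall i, measurable_fun setT (D i),
      measurable_fun setT A,
      measurable_fun setT Aux,
      forall i B, measurable B -> Q (D i @^-1` B) = P B
    & mutually_indep Q (fun k : nat + bool => match k with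
                          | inl i => gen_events (D i)
                          | inr true => gen_events A
                          | inr false => gen_events Aux end)].

Section Stat.
Context {R : realType}.
Definition tau_N (n : nat) (Rs : nat -> R) : R :=
  (Num.sqrt n%:R)^-1 * \sum_(i < n) Rs i.
Definition tau_D (n : nat) (Rs : nat -> R) : R :=
  Num.sqrt (n%:R^-1 * \sum_(i < n) Rs i ^+ 2 - (n%:R^-1 * \sum_(r < n) Rs r) ^+ 2).
Definition T_stat (n : nat) (Rs : nat -> R) : R := tau_N n Rs / tau_D n Rs.
End Stat.

Definition R_res {R : realType} {dZ : nat} (fh gh wh : dZ.-tuple R -> R) (p : pt R dZ) : R :=
  (xX p - fh (zZ p)) * (yY p - gh (zZ p)) * wh (zZ p).

Definition A_err {R : realType} {dZ : nat} (n : nat) (f fh : dZ.-tuple R -> R)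
    (zs : nat -> dZ.-tuple R) : R :=
  n%:R^-1 * \sum_(i < n) (f (zs i) - fh (zs i)) ^+ 2.
Definition B_err {R : realType} {dZ : nat} (n : nat) (f fh : dZ.-tuple R -> R)
    (v : dZ.-tuple R -> \bar R) (zs : nat -> dZ.-tuple R) : \bar R :=
  ((n%:R^-1)%:E * \sum_(i < n) ((f (zs i) - fh (zs i)) ^+ 2)%:E * v (zs i))%E.

Definition little_oP {dO : measure_display} {Omega : measurableType dO} {R : realType}
    {PT : Type} (Pfam : set PT) (Q : PT -> probability Omega R)
    (V : PT -> nat -> Omega -> R) (W : nat -> R) : Prop :=
  forall delta : R, 0 < delta -> forall e : R, 0 < e -> exists N : nat,
    forall n, (N <= n)%N -> forall P, Pfam P ->
      (Q P [set w | (delta < `|V P n w / W n|)%R] <= e%:E)%E.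

Definition little_oP1_ext {dO : measure_display} {Omega : measurableType dO} {R : realType}
    {PT : Type} (Pfam : set PT) (Q : PT -> probability Omega R)
    (V : PT -> nat -> Omega -> \bar R) : Prop :=
  forall delta : R, 0 < delta -> forall e : R, 0 < e -> exists N : nat,
    forall n, (N <= n)%N -> forall P, Pfam P ->
      (Q P [set w | delta%:E < `|V P n w|] <= e%:E)%E.

Definition Phi {R : realType} (t : R) : \bar R := normal_prob 0 1 `]-oo, t]%classic.

(* Main.v *)
(** Write R_i = sigma (Y_i + q_i) + rho, where Y_i is the standardization of
epsilon_i xi_i w(Z_i) given A, and q_i collects the three terms of R_i / sigma
that contain an estimation error. Then T - sqrt n rho / tau_D is
(W + E) / sqrt V with W = n^(-1/2) sum Y_i, E = n^(-1/2) sum q_i, and V the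
empirical variance of the Y_i + q_i.

The product term of q is bounded by n A_f A_g through Cauchy-Schwarz. For the
two cross terms, the summands are cut off as soon as the running sum that
defines B_f (or B_g) exceeds kappa; this is decided by the past and the current
Z_k, so the truncated sums are martingales with second moment at most
C^2 kappa, and Chebyshev's inequality applies. A truncated law of large
numbers gives V -> 1.

The central limit theorem for W is Lindeberg's replacement argument without
auxiliary Gaussian variables: E Phi((t - S_k) / sqrt s_k), where
s_k = s + (n - k) / n, changes little with k, because
Phi((t - x) / sqrt s) solves the heat equation in (s, x). Conditioning is
always integration over the independent current observation ("freezing" the
past), and all error bounds are explicit, so they are uniform in P. *)

Require Import Defs.
From HB Require Import structures.
From mathcomp Require Import all_boot all_order all_algebra.
From mathcomp Require Import all_classical all_reals all_analysis.
From mathcomp Require Import measurable_realfun.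
From mathcomp Require Import ring lra.
Import Order.TTheory GRing.Theory Num.Theory.
Import numFieldNormedType.Exports.
Local Open Scope classical_set_scope.
Local Open Scope ring_scope.

(** * The normal distribution function *)

(** [B_f] and [B_g] are small only in probability and may have infinite expectation, so a cross term
    has no usable second moment before the cut-off; letting the cut-off see the current [Z_k] is
    legitimate because the residuals have mean zero given [Z]. Likewise [Y_i ^ 2] is only known to
    have moments of order [1 + eta / 2], which excludes a direct Chebyshev bound for the empirical
    variance.

    The variance given [A] is random. The estimates are made on the event that [A] lies in [G],
    where [sigma2_bar] is at least a deterministic [c]; there all truncation constants depend on
    [C], [M], [eta] and [c] alone. Both variance assumptions take one form: for every [e] some [c]
    makes the complement of that event have probability at most [e], for all [n] and [P]. Part 1 is
    then the uniform statement for a singleton family.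

    Division by [sqrt V] moves the threshold [t] by an amount proportional to [|t|], so the
    Lipschitz bound of [Phi] would not be uniform in [t]. Dilations of the argument are therefore
    treated apart, through the boundedness of [y * gpdf y]; the same device yields the variance side
    of the replacement step. *)

Section taylor.
Context {R : realType}.
Implicit Types f df ddf dddf : R -> R.

(** The bound on [|c - x|] allows iteration: the Taylor estimates apply the lemma again to the
    derivative at [c]. *)
Lemma mean_value f df (x y : R) : (forall z : R, is_derive z 1 f (df z)) ->
  exists2 c, `|c - x| <= `|y - x| & f y - f x = df c * (y - x).
Proof.
move=> dF.
have cf : continuous f.
  by move=> z; apply: differentiable_continuous; apply/derivable1_diffP; case: (dF z).
have [xy|yx|<-] := ltgtP x y.
- have [c] := MVT xy (fun z _ => dF z) (continuous_subspaceT cf).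
  by rewrite in_itv/= => /andP[xc cy] ->; exists c => //; rewrite !gtr0_norm; lra.
- have [c] := MVT yx (fun z _ => dF z) (continuous_subspaceT cf).
  rewrite in_itv/= => /andP[xc cy] e; exists c; first by rewrite !ltr0_norm; lra.
  by rewrite -opprB e; ring.
- by exists x => //; rewrite !subrr mulr0.
Qed.

Lemma lipschitz_bound f df (K x h : R) : (forall z : R, is_derive z 1 f (df z)) ->
  (forall z, `|df z| <= K) -> `|f (x + h) - f x| <= K * `|h|.
Proof.
move=> dF bF; have [c _ ->] := mean_value f df x (x + h) dF.
by rewrite addrC addKr normrM ler_wpM2r.
Qed.

(** The remainder is [(df c - df x) * h] for an intermediate point [c], and [df] is [K]-Lipschitz.
    The factor 1/2 is lost, which only affects constants. *)
Lemma taylor2 f df ddf (K x h : R) : (forall z : R, is_derive z 1 f (df z)) ->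
  (forall z : R, is_derive z 1 df (ddf z)) -> (forall z, `|ddf z| <= K) ->
  `|f (x + h) - f x - h * df x| <= K * h ^+ 2.
Proof.
move=> dF ddF bF; have [c] := mean_value f df x (x + h) dF.
rewrite (addrC x h) addrK => ch ->.
rewrite (mulrC h) -mulrBl normrM -(real_normK (num_real h)) expr2 mulrA.
rewrite ler_wpM2r//.
have := lipschitz_bound df ddf K x (c - x) ddF bF; rewrite (addrC x (c - x)) subrK => /le_trans; apply.
by rewrite ler_wpM2l// (le_trans _ (bF x)).
Qed.

Lemma taylor3 f df ddf dddf (K x h : R) : (forall z : R, is_derive z 1 f (df z)) ->
  (forall z : R, is_derive z 1 df (ddf z)) -> (forall z : R, is_derive z 1 ddf (dddf z)) ->
  (forall z, `|dddf z| <= K) ->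
  `|f (x + h) - f x - h * df x - h ^+ 2 / 2 * ddf x| <= K * `|h| ^+ 3.
Proof.
move=> dF ddF dddF bF.
have K0 : 0 <= K by rewrite (le_trans _ (bF x)).
(* The remainder as a function of the increment [u]: its derivative [dg] is the remainder of [df]
   that [taylor2] controls, and it vanishes at 0. *)
pose g (u : R) := f (x + u) - f x - u * df x - u ^+ 2 / 2 * ddf x.
pose dg (u : R) := df (x + u) - df x - u * ddf x.
have dG (u : R) : is_derive u 1 g (dg u).
  have d1 : is_derive u 1 (fun v => f (x + v)) (df (x + u) * (0 + 1)).
    exact: (is_derive1_comp (dF _) (is_deriveD (is_derive_cst x u 1) (is_derive_id u (1 : R)))).
  have d2 := is_deriveM (is_derive_id u (1 : R)) (is_derive_cst (df x) u 1).
  have d3 := is_deriveM (is_deriveM (is_deriveX 2 (is_derive_id u (1 : R)))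
    (is_derive_cst (2^-1 : R) u 1)) (is_derive_cst (ddf x) u 1).
  have d := is_deriveB (is_deriveB (is_deriveB d1 (is_derive_cst (f x) u 1)) d2) d3.
  apply: (@is_derive_eq _ _ _ _ _ _ _ _ d).
  by rewrite /GRing.scale/= /dg; field.
have [c] := mean_value g dg 0 h dG; rewrite !subr0 => ch.
have -> : g 0 = 0 by rewrite /g addr0; ring.
rewrite subr0 /g => ->; rewrite normrM exprSr mulrA ler_wpM2r//.
apply: (le_trans (taylor2 df ddf dddf K x c ddF dddF bF)).
by rewrite ler_wpM2l// -(real_normK (num_real c)) lerXn2r ?nnegrE.
Qed.

End taylor.

Section gauss.
Context {R : realType}.
Implicit Types x y t h : R.

Definition gpdf x : R := normal_pdf 0 1 x.
Definition gcdf t : R := fine (Phi t).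

Lemma gpdfE x : gpdf x = normal_peak 1 * expR (- (x ^+ 2 / 2)).
Proof.
rewrite /gpdf normal_pdfE ?oner_neq0// /normal_fun subr0 expr1n.
by rewrite mulNr.
Qed.

Lemma gpdf_ge0 x : 0 <= gpdf x.
Proof. exact: normal_pdf_ge0. Qed.

Lemma normal_peak1_le1 : normal_peak 1 <= 1 :> R.
Proof.
have pi2 : (2 : R) <= pi by exact: pi_ge2.
rewrite /normal_peak invf_le1 ?expr1n ?mul1r; last first.
  by rewrite sqrtr_gt0 mulrn_wgt0// pi_gt0.
by rewrite -{1}(sqrtr1 R) ler_wsqrtr// -mulr_natr; lra.
Qed.

(** With [u = x ^ 2 / 4] the exponential is the square of [expR (- u)], and [1 + u <= expR u]. The
    squared factor has degree 4 in [x], so the bounds up to degree 3 below reduce to polynomial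
    inequalities, with the crude constant 8. *)
Lemma gpdf_decay x : gpdf x * (1 + x ^+ 2 / 4) ^+ 2 <= 1.
Proof.
rewrite gpdfE (_ : x ^+ 2 / 2 = x ^+ 2 / 4 + x ^+ 2 / 4); last by field.
have e1 : 1 + x ^+ 2 / 4 <= expR (x ^+ 2 / 4) by exact: expR_ge1Dx.
have p0 : (0 : R) <= normal_peak 1 := normal_peak_ge0 1.
rewrite opprD expRD expRN.
move: e1; move: (x ^+ 2 / 4) (divr_ge0 (sqr_ge0 x) (ler0n R 4)) => u u0 e1.
have eu := expR_gt0 u.
have h0 : 0 <= (expR u)^-1 * (1 + u).
  by apply: mulr_ge0; [rewrite invr_ge0 ltW | lra].
have h1 : (expR u)^-1 * (1 + u) <= 1 by rewrite mulrC ler_pdivrMr// mul1r.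
rewrite -mulrA -expr2 -exprMn -[leRHS]mul1r; apply: ler_pM => //.
- by rewrite sqr_ge0.
- exact: normal_peak1_le1.
- by rewrite expr_le1.
Qed.

Lemma normX3_gpdf x : `|x| ^+ 3 * gpdf x <= 8.
Proof.
have := gpdf_decay x; have := gpdf_ge0 x.
rewrite -(real_normK (num_real x)); move: `|x| (normr_ge0 x) => a a0.
move: (gpdf x) => g g0 ?.
have : a ^+ 3 <= 8 * (1 + a ^+ 2 / 4) ^+ 2 by nra.
by move=> /(ler_wpM2r g0) ?; lra.
Qed.

Lemma normX1_gpdf x : `|x| * gpdf x <= 8.
Proof.
have := gpdf_decay x; have := gpdf_ge0 x.
rewrite -(real_normK (num_real x)); move: `|x| (normr_ge0 x) => a a0.
move: (gpdf x) => g g0 ?.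
have : a <= 8 * (1 + a ^+ 2 / 4) ^+ 2 by nra.
by move=> /(ler_wpM2r g0) ?; lra.
Qed.

Lemma X2_gpdf x : x ^+ 2 * gpdf x <= 8.
Proof.
have := gpdf_decay x; have := gpdf_ge0 x.
move: (gpdf x) => g g0 ?.
have : x ^+ 2 <= 8 * (1 + x ^+ 2 / 4) ^+ 2 by have := sqr_ge0 x; nra.
by move=> /(ler_wpM2r g0) ?; lra.
Qed.

Lemma gpdf_le1 x : gpdf x <= 1.
Proof.
have := gpdf_decay x; have := gpdf_ge0 x.
move: (gpdf x) => g g0 ?.
have : 1 <= (1 + x ^+ 2 / 4) ^+ 2 by have := sqr_ge0 x; nra.
by move=> /(ler_wpM2r g0) ?; lra.
Qed.

Lemma is_derive_gpdf x : is_derive x 1 gpdf (- (x * gpdf x)).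
Proof.
have -> : gpdf = (fun x => normal_peak 1 * expR (- (x ^+ 2 / 2))).
  by apply/funext => y; rewrite gpdfE.
have d2 : is_derive x 1 (fun v : R => - (v ^+ 2 / 2)) (- x).
  have d := is_deriveN (is_deriveM (is_deriveX 2 (is_derive_id x (1 : R)))
    (is_derive_cst (2^-1 : R) x 1)).
  apply: (@is_derive_eq _ _ _ _ _ _ _ _ d).
  by rewrite /GRing.scale/=; field.
have d := is_deriveZ (normal_peak 1 : R) (is_derive1_comp (is_derive_expR _) d2).
apply: (@is_derive_eq _ _ _ _ _ _ _ _ d).
by rewrite /GRing.scale/=; ring.
Qed.

Lemma is_derive_xgpdf x :
  is_derive x 1 (fun x => - (x * gpdf x)) ((x ^+ 2 - 1) * gpdf x).
Proof.
have d := is_deriveN (is_deriveM (is_derive_id x (1 : R)) (is_derive_gpdf x)).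
apply: (@is_derive_eq _ _ _ _ _ _ _ _ d).
by rewrite /GRing.scale/=; ring.
Qed.

Lemma PhiE t : Phi t = (gcdf t)%:E.
Proof. by rewrite /gcdf fineK// /Phi fin_num_measure. Qed.

Lemma is_derive_gcdf t : is_derive t 1 gcdf (gpdf t).
Proof.
have tt1 : t < t + 1 by rewrite ltrDl.
have ig : lebesgue_measure.-integrable [set` Interval -oo%O (BRight (t + 1))] (EFin \o @gpdf).
  apply: (integrableS _ _ (subsetT _)) => //; exact: integrable_normal_pdf.
have cg : {for t, continuous gpdf}.
  exact: (@continuous_normal_pdf R 0 1 (oner_neq0 R) t).
have [d e] := @continuous_FTC1 R gpdf -oo%O t (t + 1) tt1 ig (ltNyr _) cg.
apply: DeriveDef; first exact: d.
by rewrite -derive1E -e.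
Qed.

Lemma gcdf_ge0 t : 0 <= gcdf t.
Proof. by rewrite -lee_fin -PhiE; exact: measure_ge0. Qed.

Lemma gcdf_le1 t : gcdf t <= 1.
Proof. by rewrite -lee_fin -PhiE; exact: probability_le1. Qed.

Lemma gcdf_mono : {homo gcdf : x y / x <= y}.
Proof.
move=> x y xy; rewrite -lee_fin -!PhiE; apply: le_measure; rewrite ?inE//.
exact: subset_itvl.
Qed.

(** The identity, viewed under the standard normal law, is a random variable with [cdf] equal to
    [gcdf]; the limits of a [cdf] at both infinities then give the tails. *)
Let idTR : measurableTypeR R -> R := idfun.

#[local] HB.instance Definition _ :=
  @isMeasurableFun.Build _ _ _ _ idTR (@measurable_id _ _ setT).

Lemma gcdf_tails (e : R) : 0 < e ->
  exists2 K, 0 < K & gcdf (- K) <= e /\ 1 - e <= gcdf K.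
Proof.
move=> e0.
pose X : {RV (normal_prob 0 1 : probability _ R) >-> R} := idTR.
have cX r : cdf X r = (gcdf r)%:E by rewrite -PhiE.
have c1 : gcdf r @[r --> +oo] --> (1 : R).
  have := cvg_cdfy1 X; rewrite (_ : cdf X = EFin \o gcdf); last exact/funext.
  by move/fine_cvgP => [_].
have c0 : gcdf r @[r --> -oo] --> (0 : R).
  have := cvg_cdfNy0 X; rewrite (_ : cdf X = EFin \o gcdf); last exact/funext.
  by move/fine_cvgP => [_].
have /cvgrPdist_le /(_ _ e0) [M [_ hM]] := c1.
have /cvgrPdist_le /(_ _ e0) [N [_ hN]] := c0.
pose K := Num.max 1 (Num.max (M + 1) (1 - N)).
have KM : M < K by rewrite /K !lt_max; apply/orP; right; apply/orP; left; lra.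
have KN : - K < N by rewrite ltrNl /K !lt_max; apply/orP; right; apply/orP; right; lra.
exists K; first by rewrite lt_max ltr01.
have := hM _ KM; have := hN _ KN; rewrite /= sub0r normrN !ler_norml; lra.
Qed.

Lemma gcdf_shift x h : `|gcdf (x + h) - gcdf x| <= `|h|.
Proof.
rewrite -[leRHS]mul1r; apply: lipschitz_bound is_derive_gcdf _ => z.
by rewrite ger0_norm ?gpdf_ge0// gpdf_le1.
Qed.

Lemma gcdf_taylor2 x h : `|gcdf (x + h) - gcdf x - h * gpdf x| <= 8 * h ^+ 2.
Proof.
apply: taylor2 is_derive_gcdf is_derive_gpdf _ => z.
by rewrite normrN normrM (ger0_norm (gpdf_ge0 _)) normX1_gpdf.
Qed.

Lemma gcdf_taylor3 x h :
  `|gcdf (x + h) - gcdf x - h * gpdf x - h ^+ 2 / 2 * - (x * gpdf x)|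
   <= 9 * `|h| ^+ 3.
Proof.
apply: taylor3 is_derive_gcdf is_derive_gpdf is_derive_xgpdf _ => z.
rewrite normrM (ger0_norm (gpdf_ge0 _)).
apply: le_trans (_ : (z ^+ 2 + 1) * gpdf z <= _).
  by rewrite ler_wpM2r ?gpdf_ge0// ler_norml; have := sqr_ge0 z; lra.
by have := X2_gpdf z; have := gpdf_le1 z; lra.
Qed.

(* The interpolation between the quadratic and the cubic remainder that turns the
   Lindeberg condition into a bound for the replacement error. *)
Lemma gcdf_taylor_lindeberg x h (k : R) : 0 <= k ->
  `|gcdf (x + h) - gcdf x - h * gpdf x - h ^+ 2 / 2 * - (x * gpdf x)|
   <= 12 * (k * h ^+ 2 + if k < `|h| then h ^+ 2 else 0).
Proof.
move=> k0; case: ltP => kh.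
- have T := gcdf_taylor2 x h.
  have : `|h ^+ 2 / 2 * - (x * gpdf x)| <= 4 * h ^+ 2.
    have h20 : 0 <= h ^+ 2 / 2 by rewrite divr_ge0 ?sqr_ge0.
    rewrite mulrN normrN normrM (ger0_norm h20) normrM (ger0_norm (gpdf_ge0 _)).
    by have := ler_wpM2l (sqr_ge0 h) (normX1_gpdf x); lra.
  move=> U; apply: (le_trans (ler_normB _ _)).
  have := mulr_ge0 k0 (sqr_ge0 h); lra.
- apply: (le_trans (gcdf_taylor3 x h)); rewrite addr0.
  rewrite exprSr (real_normK (num_real h)).
  have := ler_wpM2l (sqr_ge0 h) kh; have := mulr_ge0 k0 (sqr_ge0 h); lra.
Qed.

(** Dilations are parametrised by [expR (- t)], because the derivative of [gcdf (y * expR (- t))] in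
    [t] is then [- (z * gpdf z)] at [z = y * expR (- t)], which is bounded uniformly in [y].
    Division by [sqrt (1 + q)] is the case [t = ln (1 + q) / 2]. *)
Let expN_derive y t :
  is_derive t 1 (fun t : R => y * expR (- t)) (- (y * expR (- t))).
Proof.
have d := is_deriveZ y (is_derive1_comp (is_derive_expR (- t))
  (is_deriveN (is_derive_id t (1 : R)))).
apply: (@is_derive_eq _ _ _ _ _ _ _ _ d).
by rewrite /GRing.scale/=; ring.
Qed.

Let scaled_derive y t : is_derive t 1 (fun t => gcdf (y * expR (- t)))
  (- (y * expR (- t) * gpdf (y * expR (- t)))).
Proof.
have d := @is_derive1_comp R gcdf (fun t => y * expR (- t)) t _ _
  (is_derive_gcdf _) (expN_derive y t).
by apply: (@is_derive_eq _ _ _ _ _ _ _ _ d); ring.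
Qed.

Let scaled_derive2 y t :
  is_derive t 1 (fun t => - (y * expR (- t) * gpdf (y * expR (- t))))
  (- (((y * expR (- t)) ^+ 2 - 1) * gpdf (y * expR (- t)) * (y * expR (- t)))).
Proof.
have d := @is_derive1_comp R _ (fun t => y * expR (- t)) t _ _
  (is_derive_xgpdf _) (expN_derive y t).
by apply: (@is_derive_eq _ _ _ _ _ _ _ _ d); ring.
Qed.

Lemma gcdf_scale1 y t : `|gcdf (y * expR (- t)) - gcdf y| <= 8 * `|t|.
Proof.
have := @lipschitz_bound R _ _ 8 0 t (scaled_derive y).
rewrite add0r oppr0 expR0 mulr1; apply => z.
by rewrite normrN normrM (ger0_norm (gpdf_ge0 _)) normX1_gpdf.
Qed.

(** This is the variance side of the heat equation: for [t] close to [q / 2] the linear term is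
    [q / 2] times the second derivative [- (y * gpdf y)] of [gcdf], the same as the quadratic Taylor
    term of an increment of variance [q]. The constant 16 is 8 + 8, from the bounds on
    [|z| ^ 3 * gpdf z] and [|z| * gpdf z]. *)
Lemma gcdf_scale2 y t :
  `|gcdf (y * expR (- t)) - gcdf y + t * (y * gpdf y)| <= 16 * t ^+ 2.
Proof.
have := @taylor2 R _ _ _ 16 0 t (scaled_derive y) (scaled_derive2 y).
rewrite add0r oppr0 expR0 mulr1 mulrN opprK; apply => z.
move: (y * expR (- z)) => u.
rewrite normrN !normrM (ger0_norm (gpdf_ge0 _)).
have : `|u ^+ 2 - 1| <= `|u| ^+ 2 + 1.
  by rewrite ler_norml (real_normK (num_real u)); have := sqr_ge0 u; lra.
move=> /(ler_wpM2r (mulr_ge0 (gpdf_ge0 u) (normr_ge0 u))).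
by have := normX3_gpdf u; have := normX1_gpdf u; rewrite exprS expr2; lra.
Qed.

End gauss.

(** * Freezing the past *)

(** Independence on rectangles identifies the law of [(O, X)] with the product of the law of [O] and
    [P], by uniqueness of product measures; Tonelli's theorem then integrates [X] out. *)
Lemma freezing {d d0 d'} {Omega : measurableType d} {T0 : measurableType d0}
    {T' : measurableType d'} {R : realType} (Q : probability Omega R)
    (P : probability T' R) (O : Omega -> T0) (X : Omega -> T')
    (H : T0 * T' -> \bar R) :
  measurable_fun setT O -> measurable_fun setT X ->
  (forall E B, measurable E -> measurable B ->
    Q (O @^-1` E `&` X @^-1` B) = (Q (O @^-1` E) * P B)%E) ->
  measurable_fun setT H -> (forall x, 0 <= H x)%E ->
  (\int[Q]_om H (O om, X om) = \int[Q]_om \int[P]_p H (O om, p))%E.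
Proof.
move=> mO mX ind mH H0.
pose OX om := (O om, X om).
have mOX : measurable_fun setT OX by exact/measurable_fun_pair.
pose mO' := isMeasurableFun.Build _ _ _ _ _ mO.
pose O' : {mfun Omega >-> T0} := HB.pack O mO'.
pose m1 : probability T0 R := distribution Q O'.
pose mOX' := isMeasurableFun.Build _ _ _ _ _ mOX.
pose OX' : {mfun Omega >-> (T0 * T')%type} := HB.pack OX mOX'.
pose m' : probability (T0 * T')%type R := distribution Q OX'.
have e S : measurable S -> (m1 \x P)%E S = m' S.
  apply: product_measure_unique => E B mE mB.
  by rewrite -ind.
transitivity (\int[m']_x H x)%E.
  by rewrite ge0_integral_pushforward.
transitivity (\int[m1 \x P]_x H x)%E.
  by apply: eq_measure_integral => S mS _; exact/esym/e.
rewrite fubini_tonelli1//= ge0_integral_pushforward//.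
- exact: measurable_fun_fubini_tonelli_F.
- by move=> x _; exact: integral_ge0.
Qed.

Section past.
Context {dO dA dB : measure_display} {Omega : measurableType dO}
  {TA : measurableType dA} {TB : measurableType dB} {R : realType} {dZ : nat}.
Variables (D : nat -> Omega -> pt R dZ) (A : Omega -> TA) (Aux : Omega -> TB).

Definition past_rect (k : nat) : set (set Omega) :=
  [set E | exists (Ba : set TA) (Bb : set TB) (B : nat -> set (pt R dZ)),
    [/\ measurable Ba, measurable Bb, (forall j, measurable (B j)) &
     E = A @^-1` Ba `&` (Aux @^-1` Bb `&` \big[setI/setT]_(j < k) D j @^-1` B j)]].

(** The same carrier [Omega] with a coarser sigma-algebra, so that depending on the past is plain
    measurability of a function on this type. The auxiliary sample belongs to every [past k], hence
    the estimates of the regressions are frozen from the start. The rectangles are kept as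
    generators because they form a pi-system. *)
Definition past (k : nat) := g_sigma_algebraType (past_rect k).

Lemma past_rect_setI k : setI_closed (past_rect k).
Proof.
move=> _ _ [Ba [Bb [B [mBa mBb mB ->]]]] [Ba' [Bb' [B' [mBa' mBb' mB' ->]]]].
exists (Ba `&` Ba'), (Bb `&` Bb'), (fun j => B j `&` B' j); split.
- exact: measurableI.
- exact: measurableI.
- by move=> j; exact: measurableI.
- by rewrite !preimage_setI big_split/= setIACA; congr (_ `&` _); rewrite setIACA.
Qed.

Lemma measurable_past_A k : measurable_fun setT (A : past k -> TA).
Proof.
move=> _ Y mY; rewrite setTI; apply: sub_sigma_algebra.
exists Y, setT, (fun=> setT); split => //.
by rewrite preimage_setT setTI big1 ?setIT.
Qed.

Lemma measurable_past_Aux k : measurable_fun setT (Aux : past k -> TB).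
Proof.
move=> _ Y mY; rewrite setTI; apply: sub_sigma_algebra.
exists setT, Y, (fun=> setT); split => //.
by rewrite preimage_setT setTI big1 ?setIT.
Qed.

Lemma measurable_past_D k j : (j < k)%N -> measurable_fun setT (D j : past k -> pt R dZ).
Proof.
move=> jk _ Y mY; rewrite setTI; apply: sub_sigma_algebra.
exists setT, setT, (fun i => if i == j then Y else setT); split => //.
  by move=> i; case: ifP.
rewrite !preimage_setT !setTI (bigD1 (Ordinal jk))//= eqxx big1 ?setIT// => i ij.
by rewrite ifN.
Qed.

Lemma past_rect_mono j k : (j <= k)%N -> past_rect j `<=` past_rect k.
Proof.
move=> jk _ [Ba [Bb [B [mBa mBb mB ->]]]].
exists Ba, Bb, (fun i => if (i < j)%N then B i else setT); split => //.
  by move=> i; case: ifP.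
congr (_ `&` (_ `&` _)); rewrite (big_ord_widen _ (fun i => D i @^-1` B i) jk).
by rewrite big_mkcond/=; apply: eq_bigr => i _; case: ifP.
Qed.

Lemma measurable_past_mono j k : (j <= k)%N -> measurable_fun setT (id : past k -> past j).
Proof.
move=> jk _ Y mY; rewrite setTI; move: Y mY; apply: sub_sigma_algebra2; exact: past_rect_mono.
Qed.

End past.
Arguments past {dO dA dB Omega TA TB R dZ}.

Section sampling.
Context {dO dA dB : measure_display} {Omega : measurableType dO}
  {TA : measurableType dA} {TB : measurableType dB} {R : realType} {dZ : nat}.
Variables (D : nat -> Omega -> pt R dZ) (A : Omega -> TA) (Aux : Omega -> TB).
Variables (Q : probability Omega R) (P : probability (pt R dZ) R).
Hypothesis model : sampling_model Q P D A Aux.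

Let mD i : measurable_fun setT (D i). Proof. by case: model. Qed.
Let mA : measurable_fun setT A. Proof. by case: model. Qed.
Let mAux : measurable_fun setT Aux. Proof. by case: model. Qed.

Lemma past_rect_measurable k : past_rect D A Aux k `<=` measurable.
Proof.
move=> _ [Ba [Bb [B [mBa mBb mB ->]]]]; apply: measurableI.
  by rewrite -[X in measurable X]setTI; exact: mA.
apply: measurableI; first by rewrite -[X in measurable X]setTI; exact: mAux.
apply: bigsetI_measurable => j _.
by rewrite -[X in measurable X]setTI; exact: mD.
Qed.

Lemma measurable_past k : measurable_fun setT (id : Omega -> past D A Aux k).
Proof.
move=> _ Y mY; rewrite setTI; move: Y mY; apply: smallest_sub.
  exact: sigma_algebra_measurable.
exact: past_rect_measurable.
Qed.

Lemma past_rect_indep k E B : past_rect D A Aux k E -> measurable B ->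
  Q (E `&` D k @^-1` B) = (Q E * P B)%E.
Proof.
case: model => _ _ _ law ind.
move=> [Ba [Bb [C [mBa mBb mC ->]]]] mB.
(* The value [B] for indices not below [k] matters only at [i = k]. Mutual independence is used
   twice, for [J] and for [inl k :: J], and the two product formulas are compared. *)
pose F (i : nat + bool) : set Omega := match i with
  | inl i => D i @^-1` (if (i < k)%N then C i else B)
  | inr true => A @^-1` Ba
  | inr false => Aux @^-1` Bb end.
pose J := [:: inr true, inr false & [seq inl i | i <- iota 0 k]] : seq (nat + bool).
have uJ : uniq (inl k :: J).
  rewrite /= !inE/= map_inj_uniq ?iota_uniq ?andbT; last by move=> i j [].
  rewrite mem_map; last by move=> i j [].
  rewrite mem_iota/= add0n ltnn/=.
  by apply/andP; split; apply/negP => /mapP[].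
have GF i : i \in inl k :: J -> (match i with
    | inl i => gen_events (D i) | inr true => gen_events A
    | inr false => gen_events Aux end) (F i).
  move: i => [i|[]] _ /=.
  - by exists (if (i < k)%N then C i else B) => //; case: ifP.
  - by exists Ba.
  - by exists Bb.
have e : \big[setI/setT]_(i <- J) F i =
    A @^-1` Ba `&` (Aux @^-1` Bb `&` \big[setI/setT]_(j < k) D j @^-1` C j).
  rewrite /J 2!big_cons/= big_map; congr (_ `&` (_ `&` _)).
  rewrite (_ : iota 0 k = index_iota 0 k) ?big_mkord; last by rewrite /index_iota subn0.
  by apply: eq_bigr => i _ /=; rewrite ltn_ord.
have := ind (inl k :: J) F uJ GF.
clearbody J; have /= /andP[_ uJ'] := uJ.
have GF' i (iJ : i \in J) := GF i (@mem_behead _ (inl k :: J) i iJ).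
have := ind J F uJ' GF'.
rewrite !big_cons e => -> ; rewrite setIC muleC /= ltnn => ->.
by rewrite law.
Qed.

(** For fixed [B] both sides are finite measures in [E], a restriction and a multiple of [Q]; they
    agree on the pi-system of rectangles, hence on the sigma-algebra it generates. *)
Lemma past_indep k E B : measurable (E : set (past D A Aux k)) -> measurable B ->
  Q (E `&` D k @^-1` B) = (Q E * P B)%E.
Proof.
move=> mE mB.
have mDB : measurable (D k @^-1` B) by rewrite -[X in measurable X]setTI; exact: mD.
pose r : {nonneg R} := NngNum (fine_ge0 (measure_ge0 P B)).
have rE : (r%:num)%:E = P B by rewrite /= fineK// fin_num_measure.
have sE F : mscale r Q F = (Q F * P B)%E by rewrite /mscale rE muleC.
rewrite -sE.
have -> : Q (E `&` D k @^-1` B) = mrestr Q mDB E by [].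
apply: (g_sigma_algebra_measure_unique (past_rect D A Aux k) (@past_rect_measurable k)
  (fun=> setT)) => //.
- move=> _; exists setT, setT, (fun=> setT); split => //.
  by rewrite !preimage_setT !setTI big1.
- by rewrite bigcup_const.
- exact: past_rect_setI.
- by move=> F GF; exact: (etrans (past_rect_indep k F B GF mB) (esym (sE F))).
- move=> _; by rewrite /= /mrestr setTI (le_lt_trans (probability_le1 _ mDB))// ltry.
Qed.

(** [freezing] with [O] the identity from [Omega] to the coarser space: [H] may depend on the past
    in any measurable way, without naming coordinates. *)
Lemma past_freezing k (H : past D A Aux k * pt R dZ -> \bar R) :
  measurable_fun setT H -> (forall x, 0 <= H x)%E ->
  (\int[Q]_om H (om, D k om) = \int[Q]_om \int[P]_p H (om, p))%E.
Proof.
move=> mH H0; apply: (@freezing _ _ _ _ (past D A Aux k) _ R Q P id (D k)) => //.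
  exact: measurable_past.
by move=> E B mE mB; exact: past_indep.
Qed.

End sampling.

(** * Moments and conditional expectations *)

Section integration.
Context {d : measure_display} {T : measurableType d} {R : realType}.
Variable P : probability T R.
Implicit Types f g h : T -> R.

Lemma integrable_of_sqr f : measurable_fun setT f ->
  (\int[P]_x (f x ^+ 2)%:E < +oo)%E -> P.-integrable setT (fun x => (f x ^+ 2)%:E).
Proof.
move=> mf fi; apply/integrableP; split.
  by apply/measurable_EFinP; exact: measurable_funX.
by under eq_integral do rewrite /= ger0_norm ?sqr_ge0//.
Qed.

Lemma integrable_of_sqr1 f : measurable_fun setT f ->
  (\int[P]_x (f x ^+ 2)%:E < +oo)%E -> P.-integrable setT (EFin \o f).
Proof.
move=> mf fi.
have i2 : P.-integrable setT (fun x => (f x ^+ 2)%:E + (cst 1 x)%:E)%E.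
  apply: integrableD => //; first exact: integrable_of_sqr.
  exact: finite_measure_integrable_cst.
apply: (le_integrable measurableT _ _ i2); first exact/measurable_EFinP.
move=> x _ /=; rewrite lee_fin.
rewrite (ger0_norm (addr_ge0 (sqr_ge0 _) ler01)) -(real_normK (num_real (f x))).
by have := sqr_ge0 (`|f x| - 1); have := normr_ge0 (f x); nra.
Qed.

(** Pythagoras for one martingale step: [m] is the sum frozen so far, and the cross term [2 * m * f]
    integrates to 0. *)
Lemma integral_sqr_shift f (m : R) : measurable_fun setT f ->
  (\int[P]_x (f x ^+ 2)%:E < +oo)%E -> (\int[P]_x (f x)%:E = 0)%E ->
  (\int[P]_x ((m + f x) ^+ 2)%:E = (m ^+ 2)%:E + \int[P]_x (f x ^+ 2)%:E)%E.
Proof.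
move=> mf fi f0.
have i1 := integrable_of_sqr1 _ mf fi.
have i2 := integrable_of_sqr _ mf fi.
have i3 : P.-integrable setT (EFin \o (fun x => m *+ 2 * f x)).
  exact: (integrableZl measurableT (m *+ 2) i1).
have i4 : P.-integrable setT (EFin \o (fun=> m ^+ 2)).
  exact: finite_measure_integrable_cst.
transitivity (\int[P]_x (((m ^+ 2)%:E + (m *+ 2 * f x)%:E) + (f x ^+ 2)%:E))%E.
  by apply: eq_integral => x _; rewrite -!EFinD; congr EFin; ring.
rewrite integralD//; last exact: integrableD.
rewrite integralD// integral_cst// [X in (_ * X)%E]probability_setT mule1.
rewrite [X in (_ + X + _)%E](_ : _ = 0)%E ?adde0//.
under eq_integral do rewrite EFinM.
by rewrite integralZl// f0 mule0.
Qed.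

Lemma markov_ge0 (f : T -> \bar R) (a : R) : measurable_fun setT f ->
  (forall x, 0 <= f x)%E -> 0 < a ->
  (a%:E * P [set x | a%:E <= f x] <= \int[P]_x f x)%E.
Proof.
move=> mf f0 a0; have := le_integral_abse P measurableT mf a0.
rewrite setTI; under eq_integral do rewrite gee0_abs//.
rewrite (_ : [set x | _] = [set x | (a%:E <= f x)%E])//.
by apply/seteqP; split=> x /=; rewrite gee0_abs.
Qed.

Lemma markov_le (f : T -> \bar R) (a B : R) : measurable_fun setT f ->
  (forall x, 0 <= f x)%E -> 0 < a -> (\int[P]_x f x <= B%:E)%E ->
  (P [set x | a%:E <= f x] <= (B / a)%:E)%E.
Proof.
move=> mf f0 a0 fB; have := le_trans (markov_ge0 f a mf f0 a0) fB.
have mE : measurable [set x | (a%:E <= f x)%E].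
  by rewrite -[X in measurable X]setTI; exact: emeasurable_fun_c_infty.
have : P [set x | (a%:E <= f x)%E] \is a fin_num by exact: fin_num_measure.
case: (P _) => [q| |]// _.
by rewrite -EFinM !lee_fin ler_pdivlMr// mulrC.
Qed.

Lemma measure_subU2 (E F G : set T) : measurable E -> measurable F -> measurable G ->
  E `<=` F `|` G -> (P E <= P F + P G)%E.
Proof.
move=> mE mF mG EFG; apply: (@le_trans _ _ (P (F `|` G))).
  by apply: le_measure; rewrite ?inE//; exact: measurableU.
exact: measureU2.
Qed.

End integration.

(** * Multiplying a conditional expectation by a function of the conditioning variable *)

Section factor.
Context {d d' : measure_display} {T : measurableType d} {T' : measurableType d'}
  {R : realType}.
Variables (P : probability T R) (phi : T -> T').
Hypothesis mphi : measurable_fun setT phi.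

Let mpre B : measurable B -> measurable (phi @^-1` B).
Proof. by move=> mB; rewrite -[X in measurable X]setTI; exact: mphi. Qed.

Import HBNNSimple.

Let nnsfun_case (h : T -> \bar R) (s : {nnsfun T' >-> R}) :
  measurable_fun setT h -> (forall x, 0 <= h x)%E ->
  (\int[P]_x ((s (phi x))%:E * h x) =
   \sum_(r \in range s) r%:E * \int[P]_(x in phi @^-1` (s @^-1` [set r])) h x)%E.
Proof.
move=> mh h0.
have ms r : measurable (phi @^-1` (s @^-1` [set r])) by apply: mpre; exact: measurable_sfunP.
have mi r : measurable_fun setT (fun x => (\1_(s @^-1` [set r]) (phi x))%:E * h x)%E.
  apply: emeasurable_funM => //; apply/measurable_EFinP/measurableT_comp => //.
transitivity (\int[P]_x (\sum_(r \in range s)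
   (r%:E * ((\1_(s @^-1` [set r]) (phi x))%:E * h x))))%E.
  apply: eq_integral => x _; rewrite fimfunE -fsumEFin// ge0_mule_fsuml.
    by apply: eq_fsbigr => r _; rewrite EFinM muleA.
  by move=> r; rewrite EFinM; exact: nnfun_muleindic_ge0.
rewrite ge0_integral_fsum//.
- apply: eq_fsbigr => r /[!inE] -[y _ <-].
  rewrite ge0_integralZl//; last 2 first.
  + by move=> x _; rewrite mule_ge0.
  + by rewrite lee_fin.
  congr (_ * _)%E; rewrite [RHS]integral_mkcond; apply: eq_integral => x _.
  rewrite patchE indicE; case: ifPn => xs; last first.
    by rewrite (_ : _ \in _ = false) ?mul0e//; apply/negbTE; move: xs; rewrite !notin_setE.
  by rewrite (_ : _ \in _ = true) ?mul1e//; move: xs; rewrite !inE.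
- by move=> r; apply: measurable_funeM.
- move=> r x _; rewrite muleA mule_ge0//; exact: nnfun_muleindic_ge0.
Qed.

(** For simple functions below [H] the two integrals agree. Monotone convergence recovers [H] on the
    left, while on the right the domination by [H] is enough, so this argument gives an inequality;
    exchanging the roles gives the converse. [h2] is extended-valued because versions of conditional
    variances may be infinite. *)
Lemma le_integral_factor (h1 : T -> R) (h2 : T -> \bar R) (H : T' -> R) :
  measurable_fun setT h1 -> measurable_fun setT h2 -> measurable_fun setT H ->
  (forall x, 0 <= h1 x) -> (forall x, 0 <= h2 x)%E -> (forall y, 0 <= H y) ->
  (forall B, measurable B ->
    \int[P]_(x in phi @^-1` B) (h1 x)%:E = \int[P]_(x in phi @^-1` B) h2 x)%E ->
  (\int[P]_x (H (phi x) * h1 x)%:E <= \int[P]_x ((H (phi x))%:E * h2 x))%E.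
Proof.
move=> mh1 mh2 mH h10 h20 H0 e.
have mHE : measurable_fun setT (EFin \o H) by exact/measurable_EFinP.
pose s := nnsfun_approx measurableT mHE.
have ms n : measurable_fun setT (fun x => (s n (phi x))%:E).
  by apply/measurable_EFinP; apply: measurableT_comp.
have sd x : {homo (fun n => ((s n (phi x))%:E * (h1 x)%:E)%E) : n m / (n <= m)%N >-> (n <= m)%E}.
  move=> n m nm; rewrite -!EFinM lee_fin ler_wpM2r//.
  by have /lefP := nd_nnsfun_approx measurableT mHE nm; apply.
have mc := @cvg_monotone_convergence _ _ _ P _ measurableT
  (fun n x => ((s n (phi x))%:E * (h1 x)%:E)%E).
have {}mc := mc _ _ (fun x _ => sd x).
rewrite [leLHS](_ : _ = limn (fun n => \int[P]_x ((s n (phi x))%:E * (h1 x)%:E)))%E.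
  apply: lime_le.
    apply: ereal_nondecreasing_is_cvgn => n m nm; apply: ge0_le_integral => //.
    - by move=> x _; rewrite mule_ge0// lee_fin.
    - by apply: emeasurable_funM => //; exact/measurable_EFinP.
    - by apply: emeasurable_funM => //; exact/measurable_EFinP.
    - by move=> x _; exact: sd.
  apply: nearW => n; rewrite nnsfun_case//; last exact/measurable_EFinP.
  under eq_fsbigr do rewrite e//.
  rewrite -nnsfun_case//; apply: ge0_le_integral => //.
  - by move=> x _; rewrite mule_ge0// lee_fin.
  - exact: emeasurable_funM.
  - apply: emeasurable_funM => //.
    by apply/measurable_EFinP; apply: measurableT_comp.
  - move=> x _; rewrite lee_wpmul2r// /s nnsfun_approxE.
    by apply: (@le_approx _ _ _ setT (EFin \o H)) => // y _; rewrite lee_fin.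
apply/esym/cvg_lim => //; apply: cvg_trans; first apply: mc.
- by move=> n; apply: emeasurable_funM => //; exact/measurable_EFinP.
- by move=> n x _; rewrite mule_ge0// lee_fin.
rewrite (_ : (fun x0 => limn _) = fun x => (H (phi x) * h1 x)%:E)//.
apply/funext => x; apply/cvg_lim => //; rewrite EFinM; apply: cvgeZr => //.
exact: (@cvg_nnsfun_approx _ _ _ _ measurableT (EFin \o H) mHE (fun y _ => H0 y) (phi x) I).
Qed.

Let pos (f : T -> R) x := Num.max (f x) 0.
Let neg (f : T -> R) x := Num.max (- f x) 0.

Let mpos (f : T -> R) : measurable_fun setT f -> measurable_fun setT (pos f).
Proof. by move=> mf; exact: measurable_maxr. Qed.

Let mneg (f : T -> R) : measurable_fun setT f -> measurable_fun setT (neg f).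
Proof. by move=> mf; apply: measurable_maxr => //; exact: measurable_funN. Qed.

Let integral_posneg (f : T -> R) (D : set T) :
  (\int[P]_(x in D) (f x)%:E =
   \int[P]_(x in D) (pos f x)%:E - \int[P]_(x in D) (neg f x)%:E)%E.
Proof.
rewrite integralE; congr (_ - _)%E; apply: eq_integral => x _.
  by rewrite funeposE /pos EFin_max.
by rewrite funenegE /neg EFin_max.
Qed.

Let integral_pos_fin (f : T -> R) (D : set T) : measurable D ->
  P.-integrable setT (EFin \o f) -> (\int[P]_(x in D) (pos f x)%:E)%E \is a fin_num.
Proof.
move=> mD fi; have fiD := integrableS measurableT mD (@subsetT _ _) fi.
have := integrable_funepos mD fiD.
rewrite (_ : _^\+%E = EFin \o pos f); last first.
  by apply/funext => x; rewrite funeposE /pos /= EFin_max.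
by move=> i; exact: integrable_fin_num.
Qed.

Let integral_pos_eq_neg (f : T -> R) (D : set T) : measurable D ->
  P.-integrable setT (EFin \o f) -> (\int[P]_(x in D) (f x)%:E = 0)%E ->
  (\int[P]_(x in D) (pos f x)%:E = \int[P]_(x in D) (neg f x)%:E)%E.
Proof.
move=> mD fi; rewrite integral_posneg; move: (integral_pos_fin _ _ mD fi).
case: (\int[P]_(x in D) (pos f x)%:E)%E => [r| |]//= _.
by case: (\int[P]_(x in D) (neg f x)%:E)%E => [s| |]//= [] /subr0_eq ->.
Qed.

Let maxrM (a b : R) : Num.max (a * b) 0 =
  Num.max a 0 * Num.max b 0 + Num.max (- a) 0 * Num.max (- b) 0.
Proof.
have [a0|a0] := leP 0 a; have [b0|b0] := leP 0 b.
- rewrite (max_l (mulr_ge0 a0 b0)) (max_r (_ : - a <= 0)) ?oppr_le0//.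
  by rewrite mul0r addr0.
- rewrite (max_r (mulr_ge0_le0 a0 (ltW b0))) (max_r (_ : - a <= 0)) ?oppr_le0//.
  by rewrite mul0r mulr0 addr0.
- rewrite (max_r (mulr_le0_ge0 (ltW a0) b0)) (max_r (_ : - b <= 0)) ?oppr_le0//.
  by rewrite mul0r mulr0 addr0.
- rewrite (max_l (mulr_le0 (ltW a0) (ltW b0))) mul0r add0r.
  by rewrite !max_l ?oppr_ge0 ?ltW// mulrNN.
Qed.

(** The parts [pos h] and [neg h] have equal integrals over every preimage under [phi], hence equal
    integrals against any nonnegative function of [phi]. Splitting [H] as well, the positive and the
    negative part of the product have the same integral; integrability of the product makes that
    common value finite, so that the difference is 0. *)
Lemma integral_mul_mean0 (h : T -> R) (H : T' -> R) :
  measurable_fun setT h -> measurable_fun setT H ->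
  P.-integrable setT (EFin \o h) ->
  (forall B, measurable B -> \int[P]_(x in phi @^-1` B) (h x)%:E = 0)%E ->
  P.-integrable setT (EFin \o (fun x => H (phi x) * h x)) ->
  (\int[P]_x (H (phi x) * h x)%:E = 0)%E.
Proof.
move=> mh mH ih h0 iHh.
have e B : measurable B ->
    (\int[P]_(x in phi @^-1` B) (pos h x)%:E = \int[P]_(x in phi @^-1` B) (neg h x)%:E)%E.
  by move=> mB; apply: integral_pos_eq_neg => //; [exact: mpre|exact: h0].
have eH (G : T' -> R) : measurable_fun setT G -> (forall y, 0 <= G y) ->
    (\int[P]_x (G (phi x) * pos h x)%:E = \int[P]_x (G (phi x) * neg h x)%:E)%E.
  move=> mG G0; apply/eqP; rewrite eq_le; apply/andP; split.
    apply: (@le_integral_factor _ (EFin \o neg h)) => //.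
    - exact: mpos.
    - by apply/measurable_EFinP; exact: mneg.
    - by move=> x; rewrite le_max lexx orbT.
    - by move=> x; rewrite lee_fin le_max lexx orbT.
  apply: (@le_integral_factor _ (EFin \o pos h)) => //.
  - exact: mneg.
  - by apply/measurable_EFinP; exact: mpos.
  - by move=> x; rewrite le_max lexx orbT.
  - by move=> x; rewrite lee_fin le_max lexx orbT.
  - by move=> B mB; rewrite e.
pose Hp y := Num.max (H y) 0; pose Hn y := Num.max (- H y) 0.
have mHp : measurable_fun setT Hp by exact: measurable_maxr.
have mHn : measurable_fun setT Hn by apply: measurable_maxr => //; exact: measurable_funN.
have Hp0 y : 0 <= Hp y by rewrite le_max lexx orbT.
have Hn0 y : 0 <= Hn y by rewrite le_max lexx orbT.
have hp0 x : 0 <= pos h x by rewrite le_max lexx orbT.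
have hn0 x : 0 <= neg h x by rewrite le_max lexx orbT.
have mc (G : T' -> R) g : measurable_fun setT G -> measurable_fun setT g ->
    measurable_fun setT (fun x => (G (phi x) * g x)%:E).
  move=> mG mg; apply/measurable_EFinP/measurable_funM => //.
  exact: (measurableT_comp mG).
have mph := mpos _ mh; have mnh := mneg _ mh.
rewrite (integral_posneg (fun x => H (phi x) * h x)).
rewrite [X in (X - _)%E](_ : _ =
    \int[P]_x ((Hp (phi x) * pos h x)%:E + (Hn (phi x) * neg h x)%:E))%E; last first.
  by apply: eq_integral => x _; rewrite -EFinD -maxrM.
rewrite [X in (_ - X)%E](_ : _ =
    \int[P]_x ((Hp (phi x) * neg h x)%:E + (Hn (phi x) * pos h x)%:E))%E; last first.
  apply: eq_integral => x _; rewrite -EFinD /neg -mulrN maxrM opprK.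
  by rewrite (_ : Hp (phi x) = Num.max (H (phi x)) 0).
have fin : (\int[P]_x (pos (fun x => H (phi x) * h x)%R x)%:E)%E \is a fin_num.
  exact: integral_pos_fin.
move: fin; rewrite [X in X \is a _](_ : _ =
    \int[P]_x ((Hp (phi x) * pos h x)%:E + (Hn (phi x) * neg h x)%:E))%E; last first.
  by apply: eq_integral => x _; rewrite -EFinD -maxrM.
have mulE0 u v : 0 <= u -> 0 <= v -> (0 <= (u * v)%:E :> \bar R)%E.
  by move=> u0 v0; rewrite lee_fin mulr_ge0.
rewrite !ge0_integralD//; try by [apply: mc|move=> x _; apply: mulE0].
by rewrite !eH// => /subee.
Qed.

End factor.

Lemma is_derive_measurable {R : realType} (f df : R -> R) :
  (forall x : R, is_derive x (1 : R) f (df x)) -> measurable_fun setT f.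
Proof.
move=> df1; apply: continuous_measurable_fun => z.
by apply: differentiable_continuous; apply/derivable1_diffP; case: (df1 z).
Qed.

Lemma measurable_gcdf {R : realType} : measurable_fun setT (@gcdf R).
Proof. exact: is_derive_measurable is_derive_gcdf. Qed.

Lemma half_ln1D_bounds {R : realType} (q : R) : 0 <= q ->
  0 <= ln (1 + q) / 2 <= q / 2 /\ `|ln (1 + q) / 2 - q / 2| <= q ^+ 2 / 2.
Proof.
move=> q0; have q1 : 0 < 1 + q by lra.
have u : ln (1 + q) <= q by apply: le_ln1Dx; lra.
have l0 : 0 <= ln (1 + q) by apply: ln_ge0; lra.
have l : q - q ^+ 2 <= ln (1 + q).
  (* The lower bound on the logarithm is the upper bound [ln (1 + x) <= x] taken at the reciprocal
     of [1 + q]. *)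
  have : ln (1 + q)^-1 <= (1 + q)^-1 - 1.
    rewrite (_ : (1 + q)^-1 = 1 + ((1 + q)^-1 - 1)); last by ring.
    rewrite [X in _ <= X - 1]addrC addrK; apply: le_ln1Dx.
    by have := invr_gt0 (1 + q); rewrite q1; lra.
  rewrite lnV ?posrE// => h.
  have e : (1 + q)^-1 * (1 + q) = 1 by rewrite mulVf// gt_eqF.
  have i0 : 0 <= (1 + q)^-1 by rewrite invr_ge0 ltW.
  nra.
by split; [apply/andP; split; lra | rewrite ler_norml; lra].
Qed.

(** A centred increment of variance [q] acts on the mean of [gcdf] almost like division of the
    argument by [sqrt (1 + q)], which is the effect of a Gaussian increment of the same variance:
    both expansions begin with [gcdf y - q / 2 * (y * gpdf y)]. The tail integral [b] comes from the
    quadratic remainder, used where the increment exceeds [k]. *)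
Lemma lindeberg_step {d} {T : measurableType d} {R : realType}
    (P : probability T R) (h : T -> R) (y k q b : R) :
  measurable_fun setT h -> 0 <= k -> 0 <= q ->
  (\int[P]_p (h p)%:E = 0)%E -> (\int[P]_p (h p ^+ 2)%:E = q%:E)%E ->
  (\int[P]_p (if k < `|h p| then h p ^+ 2 else 0)%:E <= b%:E)%E ->
  exists2 I : R, (\int[P]_p (gcdf (y + h p))%:E = I%:E)%E &
    `|I - gcdf (y * expR (- (ln (1 + q) / 2)))| <= 12 * (k * q + b) + 8 * q ^+ 2.
Proof.
move=> mh k0 q0 h0 h2 hb.
pose c := - (y * gpdf y).
have h2oo : (\int[P]_p (h p ^+ 2)%:E < +oo)%E by rewrite h2 ltry.
have i1 := integrable_of_sqr1 P h mh h2oo.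
have i2 := integrable_of_sqr P h mh h2oo.
have mG : measurable_fun setT (fun p => gcdf (y + h p)).
  by apply: (measurableT_comp measurable_gcdf); exact: measurable_funD.
have iG : P.-integrable setT (EFin \o (fun p => gcdf (y + h p))).
  apply: (@le_integrable _ _ _ P _ measurableT _ (EFin \o cst 1)).
  - exact/measurable_EFinP.
  - by move=> p _ /=; rewrite lee_fin normr1 ger0_norm ?gcdf_ge0 ?gcdf_le1.
  - exact: finite_measure_integrable_cst.
have ih : P.-integrable setT (EFin \o (fun p => gpdf y * h p)).
  exact: (integrableZl measurableT (gpdf y) i1).
have ih2 : P.-integrable setT (EFin \o (fun p => c / 2 * h p ^+ 2)).
  exact: (integrableZl measurableT (c / 2) i2).
have ic : P.-integrable setT (EFin \o (fun=> gcdf y)).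
  exact: finite_measure_integrable_cst.
pose T2 p := gcdf y + gpdf y * h p + c / 2 * h p ^+ 2.
have iT0 : P.-integrable setT (EFin \o (fun p => gcdf y + gpdf y * h p)).
  exact: (integrableD measurableT ic ih).
have iT : P.-integrable setT (EFin \o T2).
  exact: (integrableD measurableT iT0 ih2).
have vT : (\int[P]_p (T2 p)%:E = (gcdf y + c / 2 * q)%:E)%E.
  rewrite /T2; under eq_integral do rewrite EFinD.
  rewrite integralD//; under eq_integral do rewrite EFinD.
  rewrite integralD// integral_cst// [X in (_ * X)%E]probability_setT mule1.
  under eq_integral do rewrite EFinM.
  rewrite integralZl// h0 mule0 adde0; under eq_integral do rewrite EFinM.
  by rewrite integralZl// h2.
have finI : (\int[P]_p (gcdf (y + h p))%:E)%E \is a fin_num by exact: integrable_fin_num.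
exists (fine (\int[P]_p (gcdf (y + h p))%:E)); first by rewrite fineK.
have rem : (`|\int[P]_p (gcdf (y + h p))%:E - (gcdf y + c / 2 * q)%:E|
    <= (12 * (k * q + b))%:E)%E.
  rewrite -vT -integralB_EFin//.
  apply: (le_trans (le_abse_integral _ measurableT _)).
    by apply: emeasurable_funB; apply/measurable_EFinP => //; case/integrableP: iT => /measurable_EFinP.
  have mtail : measurable_fun setT (fun p => if k < `|h p| then h p ^+ 2 else 0).
    apply: measurable_fun_ifT => //; last exact: measurable_funX.
    by apply: measurable_fun_ltr => //; exact: measurableT_comp.
  have mk : measurable_fun setT (fun p => k * h p ^+ 2).
    by apply: measurable_funM => //; exact: measurable_funX.
  have tail0 p : 0 <= (if k < `|h p| then h p ^+ 2 else 0) by case: ifP; rewrite ?sqr_ge0.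
  have k0' p : (0 <= (k * h p ^+ 2)%:E)%E by rewrite lee_fin mulr_ge0// sqr_ge0.
  have tail0E p : (0 <= (if k < `|h p| then h p ^+ 2 else 0)%:E)%E by rewrite lee_fin.
  have mkE : measurable_fun setT (fun p => (k * h p ^+ 2)%:E) by exact/measurable_EFinP.
  have mtE : measurable_fun setT (fun p => (if k < `|h p| then h p ^+ 2 else 0)%:E).
    exact/measurable_EFinP.
  have msum := emeasurable_funD mkE mtE.
  apply: (@le_trans _ _ (\int[P]_p (12%:E * ((k * h p ^+ 2)%:E + (if k < `|h p| then h p ^+ 2 else 0)%:E)))%E).
    apply: ge0_le_integral => //.
    - apply: measurableT_comp => //.
      by apply: emeasurable_funB; apply/measurable_EFinP => //; case/integrableP: iT => /measurable_EFinP.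
    - exact: measurable_funeM.
    - move=> p _; rewrite -EFinB -EFinD -EFinM lee_fin.
      have := gcdf_taylor_lindeberg y (h p) k k0.
      rewrite (_ : _ - _ = gcdf (y + h p) - T2 p)//.
      by rewrite /T2 /c; field.
  rewrite ge0_integralZl//; last by move=> p _; rewrite adde_ge0.
  rewrite [leRHS]EFinM lee_pmul2l// ge0_integralD//.
  rewrite EFinD leeD//; under eq_integral do rewrite EFinM.
  rewrite ge0_integralZl// ?h2//; last by move=> p _; rewrite lee_fin sqr_ge0.
  by apply/measurable_EFinP; exact: measurable_funX.
move: rem; rewrite -(fineK finI) -EFinB lee_fin /=.
move: (fine _) => I.
have [/andP[t0 t1] t2] := half_ln1D_bounds q q0.
have sc := gcdf_scale2 y (ln (1 + q) / 2).
move: (ln (1 + q) / 2) t0 t1 t2 sc => t t0 t1 t2 sc rem.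
have yp : `|y * gpdf y| <= 8 by rewrite normrM (ger0_norm (gpdf_ge0 _)) normX1_gpdf.
have tq : `|(t - q / 2) * (y * gpdf y)| <= q ^+ 2 / 2 * 8.
  by rewrite normrM; apply: ler_pM.
(* The term [8 * q ^+ 2] of the bound is this [4 * q ^+ 2], from the dilation remainder, plus the
   [4 * q ^+ 2] of [tq], from replacing [t] by [q / 2]. *)
have t16 : 16 * t ^+ 2 <= 4 * q ^+ 2 by nra.
move: rem sc tq; rewrite /c; move: (y * gpdf y) yp => w _.
rewrite !ler_norml => /andP[r1 r2] /andP[s1 s2] /andP[u1 u2].
by apply/andP; split; nra.
Qed.

(** * Martingale sums and the central limit theorem *)

Section adapted.
Context {dO dA dB : measure_display} {Omega : measurableType dO}
  {TA : measurableType dA} {TB : measurableType dB} {R : realType} {dZ : nat}.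
Variables (D : nat -> Omega -> pt R dZ) (A : Omega -> TA) (Aux : Omega -> TB).
Variables (Q : probability Omega R) (P : probability (pt R dZ) R).
Hypothesis model : sampling_model Q P D A Aux.
Variable h : nat -> Omega -> pt R dZ -> R.
Hypothesis mh : forall k,
  measurable_fun setT (fun x : past D A Aux k * pt R dZ => h k x.1 x.2).

Let mD i : measurable_fun setT (D i). Proof. by case: model. Qed.

Lemma past_measurable_fun {d'} {T' : measurableType d'} k (f : Omega -> T') :
  measurable_fun setT (f : past D A Aux k -> T') -> measurable_fun setT f.
Proof. by move=> mf; apply: (measurableT_comp mf (measurable_past D A Aux Q P model k)). Qed.

Lemma measurable_adapted j k : (j < k)%N ->
  measurable_fun setT (fun om : past D A Aux k => h j om (D j om)).
Proof.
move=> jk; apply: (measurableT_comp (mh j) (_ : measurable_fun setT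
  (fun om : past D A Aux k => ((om : past D A Aux j), D j om)))).
by apply: measurable_fun_pair; [apply: measurable_past_mono; exact: ltnW|exact: measurable_past_D].
Qed.

Lemma measurable_adapted_sum k :
  measurable_fun setT (fun om : past D A Aux k => \sum_(j < k) h j om (D j om)).
Proof. by apply: measurable_sum => j; exact: measurable_adapted. Qed.

Lemma measurable_increment k : measurable_fun setT (fun om => h k om (D k om)).
Proof. by apply: (@past_measurable_fun _ _ k.+1); exact: measurable_adapted. Qed.

Hypothesis h2 : forall k om, (\int[P]_p (h k om p ^+ 2)%:E < +oo)%E.
Hypothesis h0 : forall k om, (\int[P]_p (h k om p)%:E = 0)%E.

Lemma second_moment_sum n :
  (\int[Q]_om ((\sum_(k < n) h k om (D k om)) ^+ 2)%:E =
   \sum_(k < n) \int[Q]_om (h k om (D k om) ^+ 2)%:E)%E.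
Proof.
elim: n => [|n IH].
  rewrite big_ord0; under eq_integral do rewrite big_ord0 expr0n/=.
  exact: integral0.
rewrite big_ord_recr/= -IH.
pose M om := \sum_(k < n) h k om (D k om).
have mM : measurable_fun setT (M : past D A Aux n -> R) := measurable_adapted_sum n.
have mx1 : measurable_fun setT (fun x : past D A Aux n * pt R dZ => M x.1).
  exact: (measurableT_comp mM measurable_fst).
have mh2 : measurable_fun setT (fun x : past D A Aux n * pt R dZ => (h n x.1 x.2 ^+ 2)%:E).
  by apply/measurable_EFinP; exact: measurable_funX.
transitivity (\int[Q]_om \int[P]_p ((M om + h n om p) ^+ 2)%:E)%E.
  rewrite -(past_freezing D A Aux Q P model n (fun x => ((M x.1 + h n x.1 x.2) ^+ 2)%:E)).
  - by apply: eq_integral => om _; rewrite big_ord_recr.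
  - by apply/measurable_EFinP; apply: measurable_funX; exact: measurable_funD.
  - by move=> x; rewrite lee_fin sqr_ge0.
have mhn om : measurable_fun setT (h n om) := measurable_fun_pair2 (om : past D A Aux n) (mh n).
under eq_integral do rewrite integral_sqr_shift//.
rewrite ge0_integralD//.
- rewrite (past_freezing D A Aux Q P model n (fun x => (h n x.1 x.2 ^+ 2)%:E))//.
  by move=> x; rewrite lee_fin sqr_ge0.
- by move=> om _; rewrite lee_fin sqr_ge0.
- by apply/measurable_EFinP; apply: measurable_funX; exact: (past_measurable_fun n).
- by move=> om _; apply: integral_ge0 => p _; rewrite lee_fin sqr_ge0.
- apply: (past_measurable_fun n).
  apply: (measurable_fun_fubini_tonelli_F (m2 := P) (fun x : past D A Aux n * pt R dZ => (h n x.1 x.2 ^+ 2)%:E)) => //.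
  by move=> x; rewrite lee_fin sqr_ge0.
Qed.

End adapted.

Lemma expRN_half_ln {R : realType} (u : R) : 0 < u ->
  expR (- (ln u / 2)) = (Num.sqrt u)^-1.
Proof.
move=> u0; rewrite expRN; congr _^-1.
rewrite -{2}(lnK u0) (_ : ln u = ln u / 2 + ln u / 2); last by field.
by rewrite expRD -expr2 sqrtr_sqr ger0_norm ?expR_ge0// -splitr.
Qed.

Lemma telescope_lee {R : realType} (u : nat -> \bar R) (e : R) (n : nat) :
  (forall j, (j < n)%N -> (u j.+1 <= u j + e%:E)%E /\ (u j <= u j.+1 + e%:E)%E) ->
  forall j, (j <= n)%N ->
  (u j <= u 0%N + (j%:R * e)%:E)%E /\ (u 0%N <= u j + (j%:R * e)%:E)%E.
Proof.
move=> h; elim=> [_|j IH jn]; first by rewrite mul0r !adde0.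
have [h1 h2] := IH (ltnW jn); have [g1 g2] := h j jn.
rewrite -natr1 mulrDl mul1r EFinD; split.
  by apply: (le_trans g1); rewrite addeA leeD2r.
by apply: (le_trans h2); rewrite (addeC (_ * _)%:E) addeA leeD2r.
Qed.

(** * Lindeberg replacement for the smoothed distribution function *)

Section clt.
Context {dO dA dB : measure_display} {Omega : measurableType dO}
  {TA : measurableType dA} {TB : measurableType dB} {R : realType} {dZ : nat}.
Variables (D : nat -> Omega -> pt R dZ) (A : Omega -> TA) (Aux : Omega -> TB).
Variables (Q : probability Omega R) (P : probability (pt R dZ) R).
Hypothesis model : sampling_model Q P D A Aux.
Variables (G : set TA) (Y : TA -> pt R dZ -> R).
Hypothesis mG : measurable G.
Hypothesis mY : measurable_fun setT (fun x : TA * pt R dZ => Y x.1 x.2).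
Hypothesis Y1 : forall a, G a -> (\int[P]_p (Y a p)%:E = 0)%E.
Hypothesis Y2 : forall a, G a -> (\int[P]_p (Y a p ^+ 2)%:E = 1)%E.

Variables (n : nat) (s k b t : R).
Hypotheses (n0 : (0 < n)%N) (s0 : 0 < s) (k0 : 0 <= k) (b0 : 0 <= b).
(** The increment of the smoothed argument is [Y] divided by [sqrt (v * n)] with [s <= v], so an
    increment larger than [k] forces [|Y|] above this threshold. *)
Hypothesis Yb : forall a, G a ->
  (\int[P]_p (if (k * Num.sqrt (s * n%:R) < `|Y a p|)%R then Y a p ^+ 2 else 0)%:E <= b%:E)%E.

Let sn := (Num.sqrt n%:R)^-1 : R.
Let S j om := \sum_(i < j) sn * Y (A om) (D i om).
(** The variance still to be supplied at stage [j]: the smoothing [s] plus [1 / n] for each summand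
    not yet added. It never falls below [s], and this makes [err] independent of [j]. *)
Let v j : R := s + (n - j)%:R / n%:R.
Let psi j om := \1_G (A om) * gcdf ((t - S j om) / Num.sqrt (v j)).
Let err := 12 * ((k + b) / (s * n%:R)) + 8 / (s * n%:R) ^+ 2.

Let n0R : 0 < n%:R :> R. Proof. by rewrite ltr0n. Qed.
Let mD i : measurable_fun setT (D i). Proof. by case: model. Qed.

Let v_ge j : s <= v j.
Proof. by rewrite lerDl divr_ge0. Qed.

Let vS j : (j < n)%N -> v j = v j.+1 + n%:R^-1.
Proof.
move=> jn; rewrite /v -addrA; congr (_ + _).
by rewrite -(subnSK jn) -natr1 mulrDl mul1r.
Qed.

Let mS j : measurable_fun setT (S j : past D A Aux j -> R).
Proof.
apply: measurable_sum => i; apply: measurable_funM => //.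
apply: (measurableT_comp mY (_ : measurable_fun setT (fun om : past D A Aux j => (A om, D i om)))).
by apply: measurable_fun_pair; [exact: measurable_past_A|exact: measurable_past_D].
Qed.

Let step_kernel j (x : past D A Aux j * pt R dZ) : R :=
  \1_G (A x.1) * gcdf ((t - (S j x.1 + sn * Y (A x.1) x.2)) / Num.sqrt (v j.+1)).

Let mstep_kernel j : measurable_fun setT (step_kernel j).
Proof.
have mA1 : measurable_fun setT (fun x : past D A Aux j * pt R dZ => A x.1).
  exact: (measurableT_comp (measurable_past_A D A Aux j) measurable_fst).
apply: measurable_funM.
  by apply: (measurableT_comp _ mA1); exact: measurable_indic.
apply: (measurableT_comp measurable_gcdf); apply: measurable_funM => //.
apply: measurable_funB => //; apply: measurable_funD.
  exact: (measurableT_comp (mS j) measurable_fst).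
apply: measurable_funM => //.
apply: (measurableT_comp mY (_ : measurable_fun setT (fun x : past D A Aux j * pt R dZ => (A x.1, x.2)))).
by apply: measurable_fun_pair.
Qed.

Let step_kernel_ge0 j x : 0 <= step_kernel j x.
Proof. by rewrite mulr_ge0 ?gcdf_ge0. Qed.

Let psiS j : (\int[Q]_om (psi j.+1 om)%:E = \int[Q]_om \int[P]_p (step_kernel j (om, p))%:E)%E.
Proof.
rewrite -(past_freezing D A Aux Q P model j (EFin \o step_kernel j)).
- by apply: eq_integral => om _; rewrite /psi /S big_ord_recr.
- exact/measurable_EFinP.
- by move=> x; rewrite lee_fin.
Qed.

(** [lindeberg_step] with [q = 1 / (n * v j.+1)]: since [v j.+1 * (1 + q) = v j], the dilation turns
    the denominator [sqrt (v j.+1)] into [sqrt (v j)]. Outside [G] both quantities are 0. The error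
    is made uniform by [s <= v j.+1]. *)
Let step_close j om : (j < n)%N ->
  exists2 I : R, (\int[P]_p (step_kernel j (om, p))%:E = I%:E)%E & `|I - psi j om| <= err.
Proof.
move=> jn; rewrite /step_kernel /psi /=.
have snn : 0 < s * n%:R by rewrite mulr_gt0.
have err0 : 0 <= err.
  by rewrite /err addr_ge0// ?mulr_ge0// ?invr_ge0 ?mulr_ge0 ?addr_ge0 ?sqr_ge0 ?(ltW n0R) ?(ltW s0).
rewrite indicE; have [aG|aG] := boolP (A om \in G); last first.
  exists 0; last by rewrite mul0r subrr normr0.
  by under eq_integral do rewrite mul0r; rewrite integral0.
rewrite inE in aG.
have mYa : measurable_fun setT (Y (A om)) := measurable_fun_pair2 (A om) mY.
have Yi2 : (\int[P]_p (Y (A om) p ^+ 2)%:E < +oo)%E by rewrite Y2// ltry.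
have iY := integrable_of_sqr1 P _ mYa Yi2.
have iY2 := integrable_of_sqr P _ mYa Yi2.
set v1 := v j.+1; have v1s : s <= v1 := v_ge _.
have v10 : 0 < v1 by exact: lt_le_trans v1s.
pose c := - (sn / Num.sqrt v1).
have c2 : c ^+ 2 = (v1 * n%:R)^-1.
  by rewrite sqrrN expr_div_n /sn exprVn !sqr_sqrtr ?(ltW v10)// -invfM mulrC.
have q0 : 0 <= (v1 * n%:R)^-1 by rewrite invr_ge0 mulr_ge0 ?(ltW v10).
have qs : (v1 * n%:R)^-1 <= (s * n%:R)^-1.
  by rewrite lef_pV2 ?posrE ?mulr_gt0// ler_pM2r.
have cn : `|c| = (Num.sqrt (v1 * n%:R))^-1.
  by rewrite normrN ger0_norm ?divr_ge0 ?invr_ge0 ?sqrtr_ge0// /sn -invfM mulrC -sqrtrM ?(ltW v10).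
have [|||E e le] := lindeberg_step P (fun p => c * Y (A om) p)
    ((t - S j om) / Num.sqrt v1) k (v1 * n%:R)^-1 (b / (s * n%:R))
    (measurable_funM (measurable_cst c) mYa) k0 q0.
- under eq_integral do rewrite EFinM; rewrite integralZl// Y1// mule0//.
- under eq_integral do rewrite exprMn c2 EFinM.
  by rewrite integralZl// Y2// mule1.
- pose tl p := if k * Num.sqrt (s * n%:R) < `|Y (A om) p| then Y (A om) p ^+ 2 else 0.
  have mabs := measurableT_comp (@normr_measurable R setT) mYa.
  have mtl : measurable_fun setT (EFin \o tl).
    apply/measurable_EFinP/measurable_fun_ifT => //; last exact: measurable_funX.
    exact: measurable_fun_ltr.
  have tl0 p : (0 <= (tl p)%:E)%E by rewrite lee_fin /tl; case: ifP; rewrite ?sqr_ge0.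
  apply: (@le_trans _ _ (\int[P]_p ((s * n%:R)^-1%:E * (tl p)%:E))%E).
    apply: ge0_le_integral => //.
    - by move=> p _; rewrite lee_fin; case: ifP; rewrite ?sqr_ge0.
    - apply/measurable_EFinP/measurable_fun_ifT => //.
      + apply: measurable_fun_ltr => //; apply: measurableT_comp => //.
        exact: measurable_funM.
      + by apply: measurable_funX; exact: measurable_funM.
    - exact: measurable_funeM.
    - move=> p _; rewrite -EFinM lee_fin normrM cn; case: ifPn => [h|_]; last first.
        rewrite mulr_ge0 ?invr_ge0 ?(ltW snn)//; exact: tl0.
      rewrite /tl ifT ?exprMn ?c2 ?ler_wpM2r ?sqr_ge0//.
      apply: le_lt_trans (_ : k * Num.sqrt (v1 * n%:R) < _).
        by rewrite ler_wpM2l// ler_wsqrtr// ler_wpM2r// ltW.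
      by rewrite -ltr_pdivlMr ?sqrtr_gt0 ?mulr_gt0// mulrC.
  rewrite ge0_integralZl//; last by rewrite lee_fin invr_ge0 ltW.
  rewrite (mulrC b) EFinM lee_wpmul2l//; last exact: Yb.
  by rewrite lee_fin invr_ge0 ltW.
- exists E.
    rewrite -e; apply: eq_integral => p _; rewrite mul1r; congr (gcdf _)%:E.
    by rewrite /c; field; rewrite gt_eqF ?sqrtr_gt0.
  have q1 : 0 < 1 + (v1 * n%:R)^-1.
    by apply: (lt_le_trans ltr01); rewrite lerDl.
  rewrite mul1r; move: le; rewrite expRN_half_ln//.
  rewrite -mulrA -invfM -sqrtrM ?(ltW v10)// mulrDr mulr1 invfM mulrA divff ?gt_eqF// mul1r.
  rewrite -vS// => /le_trans; apply; rewrite /err; apply: lerD.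
  + by rewrite ler_wpM2l// mulrDl lerD2r// -invfM ler_wpM2l.
  + by rewrite ler_wpM2l// -invfM -exprVn lerXn2r// nnegrE invr_ge0 ltW.
Qed.

Let mpsi j : measurable_fun setT (EFin \o psi j).
Proof.
apply/measurable_EFinP.
refine (past_measurable_fun D A Aux Q P model j (psi j) _).
apply: measurable_funM.
  by apply: (measurableT_comp _ (measurable_past_A D A Aux j)); exact: measurable_indic.
apply: (measurableT_comp measurable_gcdf); apply: measurable_funM => //.
by apply: measurable_funB => //; exact: mS.
Qed.

Let psi_ge0 j om : (0 <= (psi j om)%:E)%E.
Proof. by rewrite lee_fin mulr_ge0 ?gcdf_ge0. Qed.

Let mstep_int j : measurable_fun setT (fun om : Omega => \int[P]_p (step_kernel j (om, p))%:E)%E.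
Proof.
refine (past_measurable_fun D A Aux Q P model j
  (fun om => \int[P]_p (step_kernel j (om, p))%:E)%E _).
apply: (measurable_fun_fubini_tonelli_F (m2 := P) (EFin \o step_kernel j)).
  exact/measurable_EFinP.
by move=> x; rewrite lee_fin.
Qed.

Let err_ge0 : 0 <= err.
Proof.
by rewrite /err addr_ge0// ?mulr_ge0// ?invr_ge0 ?mulr_ge0 ?addr_ge0 ?sqr_ge0 ?(ltW n0R) ?(ltW s0).
Qed.

Let integral_err (f : Omega -> \bar R) : measurable_fun setT f -> (forall om, 0 <= f om)%E ->
  (\int[Q]_om (f om + err%:E) = \int[Q]_om f om + err%:E)%E.
Proof.
move=> mf f0; rewrite ge0_integralD//.
by rewrite integral_cst// [X in (_ * X)%E]probability_setT mule1.
Qed.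

Let psi_step j : (j < n)%N ->
  (\int[Q]_om (psi j.+1 om)%:E <= \int[Q]_om (psi j om)%:E + err%:E)%E /\
  (\int[Q]_om (psi j om)%:E <= \int[Q]_om (psi j.+1 om)%:E + err%:E)%E.
Proof.
move=> jn; rewrite (psiS j).
have J0 om : (0 <= \int[P]_p (step_kernel j (om, p))%:E)%E.
  by apply: integral_ge0 => p _; rewrite lee_fin.
have mJe := emeasurable_funD (mstep_int j) (measurable_cst (err%:E : \bar R)).
have mpe := emeasurable_funD (mpsi j) (measurable_cst (err%:E : \bar R)).
rewrite -(integral_err _ (mpsi j) (psi_ge0 j)) -(integral_err _ (mstep_int j) J0).
have close om : exists2 E : R, (\int[P]_p (step_kernel j (om, p))%:E = E%:E)%E &
  `|E - psi j om| <= err by exact: step_close.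
split.
- apply: (ge0_le_integral Q measurableT _ (mstep_int j) mpe) => // om _.
  by have [E e h] := close om; rewrite /= e -EFinD lee_fin; move: h; rewrite ler_norml; lra.
- apply: (ge0_le_integral Q measurableT (fun om _ => psi_ge0 j om) (mpsi j) mJe) => om _.
  suff : ((psi j om)%:E <= \int[P]_p (step_kernel j (om, p))%:E + err%:E)%E by [].
  by have [E e h] := close om; rewrite e -EFinD lee_fin; move: h; rewrite ler_norml; lra.
Qed.

Let psi_telescope : forall j, (j <= n)%N ->
  (\int[Q]_om (psi j om)%:E <= \int[Q]_om (psi 0 om)%:E + (j%:R * err)%:E)%E /\
  (\int[Q]_om (psi 0 om)%:E <= \int[Q]_om (psi j om)%:E + (j%:R * err)%:E)%E.
Proof.
exact: (telescope_lee (fun j => \int[Q]_om (psi j om)%:E)%E err n psi_step).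
Qed.

Let W om := \sum_(i < n) sn * Y (A om) (D i om).
Let bnd := 12 * (k + b) / s + 8 / (n%:R * s ^+ 2).

Let n_err : n%:R * err = bnd.
Proof. by rewrite /err /bnd; field; rewrite ?gt_eqF. Qed.

Let psi0 : (\int[Q]_om (psi 0 om)%:E = (gcdf (t / Num.sqrt (1 + s)))%:E * Q (A @^-1` G))%E.
Proof.
have mA : measurable_fun setT A by case: model.
have mAG : measurable (A @^-1` G) by rewrite -[X in measurable X]setTI; exact: mA.
under eq_integral => om _.
  rewrite /psi /S big_ord0 subr0 /v subn0 divff ?gt_eqF// (addrC s) mulrC EFinM.
  rewrite (_ : \1_G (A om) = \1_(A @^-1` G) om); last first.
    by rewrite !indicE; congr (nat_of_bool _)%:R; apply/idP/idP; rewrite !inE.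
  over.
have mi : measurable_fun setT (fun om => (\1_(A @^-1` G) om : R)%:E).
  by apply/measurable_EFinP; exact: measurable_indic.
have g0 : (0 <= (gcdf (t / Num.sqrt (1 + s)))%:E)%E by rewrite lee_fin gcdf_ge0.
rewrite (ge0_integralZl Q measurableT mi (fun om _ => _) g0)//.
by rewrite integral_indic// setIT.
Qed.

(** For a standard normal [N] independent of everything, the integral is the probability of
    [W + sqrt s * N <= t] with [A] in [G], compared with the normal law of variance [1 + s]. The
    error [bnd] is [n] times the error of one replacement. *)
Lemma clt_smooth :
  (\int[Q]_om (\1_G (A om) * gcdf ((t - W om) / Num.sqrt s))%:E <=
     (gcdf (t / Num.sqrt (1 + s)))%:E * Q (A @^-1` G) + bnd%:E)%E /\
  ((gcdf (t / Num.sqrt (1 + s)))%:E * Q (A @^-1` G) <=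
   \int[Q]_om (\1_G (A om) * gcdf ((t - W om) / Num.sqrt s))%:E + bnd%:E)%E.
Proof.
rewrite -psi0 -n_err; have [h1 h2] := psi_telescope n (leqnn n).
have E : (\int[Q]_om (psi n om)%:E =
    \int[Q]_om (\1_G (A om) * gcdf ((t - W om) / Num.sqrt s))%:E)%E.
  by apply: eq_integral => om _; rewrite /psi /v subnn mul0r addr0.
exact: conj (eq_ind _ (fun x => (x <= _)%E) h1 _ E) (eq_ind _ (fun x => (_ <= x + _)%E) h2 _ E).
Qed.

End clt.

(** * From the smoothed to the plain distribution function *)

Section clt_cdf.
Context {dO dA dB : measure_display} {Omega : measurableType dO}
  {TA : measurableType dA} {TB : measurableType dB} {R : realType} {dZ : nat}.
Variables (D : nat -> Omega -> pt R dZ) (A : Omega -> TA) (Aux : Omega -> TB).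
Variables (Q : probability Omega R) (P : probability (pt R dZ) R).
Hypothesis model : sampling_model Q P D A Aux.
Variables (G : set TA) (Y : TA -> pt R dZ -> R).
Hypothesis mG : measurable G.
Hypothesis mY : measurable_fun setT (fun x : TA * pt R dZ => Y x.1 x.2).
Hypothesis Y1 : forall a, G a -> (\int[P]_p (Y a p)%:E = 0)%E.
Hypothesis Y2 : forall a, G a -> (\int[P]_p (Y a p ^+ 2)%:E = 1)%E.
Variables (n : nat) (s k b K e : R).
Hypotheses (n0 : (0 < n)%N) (s0 : 0 < s) (k0 : 0 <= k) (b0 : 0 <= b).
Hypothesis Yb : forall a, G a ->
  (\int[P]_p (if (k * Num.sqrt (s * n%:R) < `|Y a p|)%R then Y a p ^+ 2 else 0)%:E <= b%:E)%E.
Hypotheses (K0 : 0 < K) (e0 : 0 <= e) (Kl : gcdf (- K) <= e) (Ku : 1 - e <= gcdf K).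

Let W om : R := \sum_(i < n) (Num.sqrt n%:R)^-1 * Y (A om) (D i om).
(** In order: the shift of [t] by the smoothing window, the dilation by [sqrt (1 + s)], the two
    parts of the replacement error, and the normal tail beyond [K]. *)
Let bnd := K * Num.sqrt s + 4 * s + 12 * (k + b) / s + 8 / (n%:R * s ^+ 2) + e.

Let scale (x : R) : `|gcdf (x / Num.sqrt (1 + s)) - gcdf x| <= 4 * s.
Proof.
have s1 : 0 < 1 + s by apply: ltr_pwDl => //; exact: ltW.
have [/andP[l0 l1] _] := half_ln1D_bounds s (ltW s0).
rewrite -expRN_half_ln//; apply: (le_trans (gcdf_scale1 _ _)).
by rewrite ger0_norm//; lra.
Qed.

Let rs0 : 0 < Num.sqrt s. Proof. by rewrite sqrtr_gt0. Qed.

Let Ks0 : 0 <= K * Num.sqrt s. Proof. by rewrite mulr_ge0// ltW. Qed.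

Let mW : measurable_fun setT W.
Proof.
have [mD mA _ _ _] := model.
apply: measurable_sum => i; apply: measurable_funM => //.
by apply: (measurableT_comp mY (measurable_fun_pair mA (mD i))).
Qed.

Let mAG : measurable (A @^-1` G).
Proof.
have [_ mA _ _ _] := model.
by rewrite -[X in measurable X]setTI; exact: mA.
Qed.

Let mWle t : measurable [set om | (W om <= t)%R].
Proof.
rewrite (_ : [set om | _] = W @^-1` `]-oo, t]); last first.
  by apply/seteqP; split=> om /=; rewrite in_itv.
by rewrite -[X in measurable X]setTI; exact: mW.
Qed.

Let mker t : measurable_fun setT (fun om => (\1_G (A om) * gcdf ((t - W om) / Num.sqrt s))%:E).
Proof.
have [_ mA _ _ _] := model.
apply/measurable_EFinP/measurable_funM.
  by apply: (measurableT_comp _ mA); exact: measurable_indic.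
apply: (measurableT_comp measurable_gcdf); apply: measurable_funM => //.
exact: measurable_funB.
Qed.

Let ker_ge0 t om : (0 <= (\1_G (A om) * gcdf ((t - W om) / Num.sqrt s))%:E)%E.
Proof. by rewrite lee_fin mulr_ge0 ?gcdf_ge0. Qed.

Let mind t : measurable_fun setT
  (fun om => (\1_(A @^-1` G `&` [set om | (W om <= t)%R]) om : R)%:E).
Proof.
by apply/measurable_EFinP; apply: measurable_indic; exact: (measurableI _ _ mAG (mWle t)).
Qed.

(** Moving the threshold to [t + K * sqrt s] makes the argument of [gcdf] at least [K] wherever
    [W <= t], so the smooth kernel plus [e] dominates the indicator. *)
Lemma clt_cdf_ub (t : R) :
  (Q (A @^-1` G `&` [set om | (W om <= t)%R]) <= (gcdf t + bnd)%:E)%E.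
Proof.
have [h _] := clt_smooth D A Aux Q P model G Y mG mY Y1 Y2 n s k b
  (t + K * Num.sqrt s) n0 s0 k0 b0 Yb.
rewrite -/W in h.
have mE := measurableI _ _ mAG (mWle t).
rewrite -[X in Q X]setIT -integral_indic//.
apply: (@le_trans _ _ (\int[Q]_om ((\1_G (A om) *
   gcdf ((t + K * Num.sqrt s - W om) / Num.sqrt s))%:E + e%:E))%E).
  have mke : measurable_fun setT (fun om => (\1_G (A om) *
      gcdf ((t + K * Num.sqrt s - W om) / Num.sqrt s))%:E + e%:E)%E := emeasurable_funD (mker (t + K * Num.sqrt s)) (measurable_cst (e%:E : \bar R)).
  apply: (ge0_le_integral Q measurableT _ (mind t) mke) => om _ //.
  - rewrite -EFinD lee_fin !indicE in_setI.
    rewrite [_ \in A @^-1` G](_ : _ = (A om \in G)); last by apply/idP/idP; rewrite !inE.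
    case: (A om \in G) => /=; last by rewrite mul0r add0r.
    have [|_] := boolP (om \in [set om | (W om <= t)%R]); last by rewrite mul1r addr_ge0// gcdf_ge0.
    rewrite inE/= => Wt; rewrite mul1r -lerBlDr (le_trans Ku)//; apply: gcdf_mono.
    by rewrite ler_pdivlMr//; lra.
rewrite ge0_integralD// integral_cst// [X in (_ + _ * X)%E]probability_setT mule1.
apply: (le_trans (leeD2r _ h)).
have q1 : (Q (A @^-1` G) <= 1)%E by exact: probability_le1.
apply: (@le_trans _ _ ((gcdf ((t + K * Num.sqrt s) / Num.sqrt (1 + s)))%:E * 1 +
  (12 * (k + b) / s + 8 / (n%:R * s ^+ 2))%:E + e%:E)%E).
  by rewrite !leeD2r// lee_wpmul2l// lee_fin gcdf_ge0.
rewrite mule1 -!EFinD lee_fin /bnd.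
have := scale (t + K * Num.sqrt s); have := gcdf_shift t (K * Num.sqrt s).
rewrite (ger0_norm Ks0) !ler_norml; lra.
Qed.

Lemma clt_cdf_lb (t : R) :
  ((gcdf t)%:E <= Q (A @^-1` G `&` [set om | (W om <= t)%R]) + Q (~` (A @^-1` G)) + bnd%:E)%E.
Proof.
have [_ h] := clt_smooth D A Aux Q P model G Y mG mY Y1 Y2 n s k b
  (t - K * Num.sqrt s) n0 s0 k0 b0 Yb.
rewrite -/W in h.
have mE := measurableI _ _ mAG (mWle t).
have h' : (\int[Q]_om (\1_G (A om) * gcdf ((t - K * Num.sqrt s - W om) / Num.sqrt s))%:E <=
    Q (A @^-1` G `&` [set om | (W om <= t)%R]) + e%:E)%E.
  rewrite -[X in (Q X + _)%E]setIT -integral_indic//.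
  rewrite -[X in (_ <= _ + X)%E]mule1 -(probability_setT Q) -integral_cst// -ge0_integralD//.
  have mie : measurable_fun setT (fun om =>
      (\1_(A @^-1` G `&` [set om | (W om <= t)%R]) om : R)%:E + e%:E)%E := emeasurable_funD (mind t) (measurable_cst (e%:E : \bar R)).
  apply: (ge0_le_integral Q measurableT _ (mker _) mie) => om _ //.
  - rewrite -EFinD lee_fin !indicE in_setI.
    rewrite [_ \in A @^-1` G](_ : _ = (A om \in G)); last by apply/idP/idP; rewrite !inE.
    case: (A om \in G) => /=; last by rewrite mul0r add0r.
    rewrite mul1r; have [_|] := boolP (om \in [set om | (W om <= t)%R]).
      by apply: (le_trans (gcdf_le1 _)); rewrite lerDl.
    rewrite notin_setE/= => /negP; rewrite -ltNge add0r => Wt.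
    apply: le_trans Kl; apply: gcdf_mono.
    by rewrite ler_pdivrMr//; lra.
have := leeD2r (12 * (k + b) / s + 8 / (n%:R * s ^+ 2))%:E h'.
move/(le_trans h).
have -> : Q (~` (A @^-1` G)) = (1 - Q (A @^-1` G))%E by rewrite probability_setC.
have : Q (A @^-1` G) \is a fin_num by exact: fin_num_measure.
have : (Q (A @^-1` G) <= 1)%E by exact: probability_le1.
case: (Q (A @^-1` G)) => [qG| |]//; rewrite lee_fin => qG1 _.
have : Q (A @^-1` G `&` [set om | (W om <= t)%R]) \is a fin_num by exact: fin_num_measure.
case: (Q (A @^-1` G `&` [set om | (W om <= t)%R])) => [qE| |]// _.
rewrite -!EFinM -EFinN -!EFinD !lee_fin /bnd.
have := scale (t - K * Num.sqrt s); have := gcdf_shift t (- (K * Num.sqrt s)).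
have := gcdf_le1 ((t - K * Num.sqrt s) / Num.sqrt (1 + s)).
rewrite normrN (ger0_norm Ks0) !ler_norml.
move: (gcdf (_ / _)) => x; nra.
Qed.

End clt_cdf.

(** * Cross terms *)

(** At the last retained index the full running sum is at most [K], and it dominates all that was
    retained before. The bound holds pathwise and does not grow with [n]. *)
Lemma sum_truncated_le {R : realType} (b : nat -> \bar R) (K : \bar R) (n : nat) :
  (forall i, 0 <= b i)%E -> (0 <= K)%E ->
  (\sum_(i < n) (if \sum_(j < i.+1) b j <= K then b i else 0) <= K)%E.
Proof.
move=> b0 K0; elim: n => [|n IH]; first by rewrite big_ord0.
rewrite big_ord_recr/=; case: ifPn => h; last by rewrite adde0.
apply: le_trans h; rewrite big_ord_recr/= leeD2r//; apply: lee_sum => i _.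
by case: ifP.
Qed.

Section cross.
Context {dO dA dB : measure_display} {Omega : measurableType dO}
  {TA : measurableType dA} {TB : measurableType dB} {R : realType} {dZ : nat}.
Variables (D : nat -> Omega -> pt R dZ) (A : Omega -> TA) (Aux : Omega -> TB).
Variables (Q : probability Omega R) (P : probability (pt R dZ) R).
Hypothesis model : sampling_model Q P D A Aux.
Variables (r : pt R dZ -> R) (v : dZ.-tuple R -> \bar R).
Hypothesis mr : measurable_fun setT r.
Hypothesis ir : P.-integrable setT (EFin \o r).
Hypothesis r0 : forall B : set (dZ.-tuple R), measurable B ->
  (\int[P]_(p in zZ @^-1` B) (r p)%:E = 0)%E.
Hypothesis v2 : cexp_version_nneg P (fun p => (r p ^+ 2)%:E) v.
Variables (df : TB -> dZ.-tuple R -> R) (w : TA -> dZ.-tuple R -> R) (C : R).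
Hypothesis mdf : measurable_fun setT (fun x : TB * dZ.-tuple R => df x.1 x.2).
Hypothesis mw : measurable_fun setT (fun x : TA * dZ.-tuple R => w x.1 x.2).
Hypothesis wC : forall a z, `|w a z| <= C.
Variables (n : nat) (kap : R).
Hypotheses (n0 : (0 < n)%N) (kap0 : 0 < kap).

Let n0R : 0 < n%:R :> R. Proof. by rewrite ltr0n. Qed.
Let mv : measurable_fun setT v. Proof. by case: v2. Qed.
Let v0 z : (0 <= v z)%E. Proof. by case: v2. Qed.
Let mzZ : measurable_fun setT (@zZ R dZ). Proof. exact: measurable_snd. Qed.
Let C20 : 0 <= C ^+ 2. Proof. exact: sqr_ge0. Qed.

Let bz (bx : TB) (z : dZ.-tuple R) : \bar R := ((df bx z ^+ 2)%:E * v z)%E.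
Let Bp (k : nat) (om : Omega) : \bar R := (\sum_(j < k) bz (Aux om) (zZ (D j om)))%E.
Let K : \bar R := (kap * n%:R)%:E.
(** The decision depends on the new observation through its [Z]-component alone, so the retained
    weight [H] can be taken out of the conditional expectation of [r] given [Z]. Here [r] stands for
    either residual and [v] for its conditional variance. *)
Let keep k om z := (Bp k om + bz (Aux om) z <= K)%E.
Let H k om z := if keep k om z then df (Aux om) z * w (A om) z else 0.
Let h k om p := H k om (zZ p) * r p.

Let bz0 bx z : (0 <= bz bx z)%E.
Proof. by rewrite mule_ge0// lee_fin sqr_ge0. Qed.

Let Bp0 k om : (0 <= Bp k om)%E.
Proof. by apply: sume_ge0 => j _. Qed.

Let K0 : (0 <= K)%E.
Proof. by rewrite lee_fin mulr_ge0 ?ltW. Qed.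

Let mbz : measurable_fun setT (fun x : TB * dZ.-tuple R => bz x.1 x.2).
Proof.
apply: emeasurable_funM; last exact: (measurableT_comp mv).
by apply/measurable_EFinP; exact: measurable_funX.
Qed.

Let mBp k : measurable_fun setT (Bp k : past D A Aux k -> \bar R).
Proof.
apply: emeasurable_sum => j.
apply: (measurableT_comp mbz (_ : measurable_fun setT
  (fun om : past D A Aux k => (Aux om, zZ (D j om))))).
apply: measurable_fun_pair; first exact: measurable_past_Aux.
exact: (measurableT_comp mzZ (measurable_past_D D A Aux k j (ltn_ord j))).
Qed.

Let mAuxZ k : measurable_fun setT (fun x : past D A Aux k * dZ.-tuple R => (Aux x.1, x.2)).
Proof.
by apply: measurable_fun_pair => //; exact: (measurableT_comp (measurable_past_Aux D A Aux k)).
Qed.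

Let mAZ k : measurable_fun setT (fun x : past D A Aux k * dZ.-tuple R => (A x.1, x.2)).
Proof.
by apply: measurable_fun_pair => //; exact: (measurableT_comp (measurable_past_A D A Aux k)).
Qed.

Let mkeep k : measurable_fun setT (fun x : past D A Aux k * dZ.-tuple R => keep k x.1 x.2).
Proof.
apply: measurable_fun_lee => //; apply: emeasurable_funD.
  exact: (measurableT_comp (mBp k) measurable_fst).
exact: (measurableT_comp mbz (mAuxZ k)).
Qed.

Let mH k : measurable_fun setT (fun x : past D A Aux k * dZ.-tuple R => H k x.1 x.2).
Proof.
apply: measurable_fun_ifT => //; apply: measurable_funM.
  exact: (measurableT_comp mdf (mAuxZ k)).
exact: (measurableT_comp mw (mAZ k)).
Qed.

Let mh k : measurable_fun setT (fun x : past D A Aux k * pt R dZ => h k x.1 x.2).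
Proof.
apply: measurable_funM; last exact: (measurableT_comp mr).
apply: (measurableT_comp (mH k) (_ : measurable_fun setT
  (fun x : past D A Aux k * pt R dZ => (x.1, zZ x.2)))).
by apply: measurable_fun_pair => //; exact: (measurableT_comp mzZ).
Qed.

Let bk k om p : \bar R := if keep k om (zZ p) then bz (Aux om) (zZ p) else 0%E.

Let bk0 k om p : (0 <= bk k om p)%E.
Proof. by rewrite /bk; case: ifP. Qed.

Let bk_le k om p : (bk k om p <= K)%E.
Proof. by rewrite /bk; case: ifP => // h1; apply: le_trans h1; rewrite leeDr. Qed.

Let mkeepP k : measurable_fun setT (fun x : past D A Aux k * pt R dZ => keep k x.1 (zZ x.2)).
Proof.
apply: (measurableT_comp (mkeep k) (_ : measurable_fun setT
  (fun x : past D A Aux k * pt R dZ => (x.1, zZ x.2)))).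
by apply: measurable_fun_pair => //; exact: (measurableT_comp mzZ).
Qed.

Let mbk k : measurable_fun setT (fun x : past D A Aux k * pt R dZ => bk k x.1 x.2).
Proof.
apply: measurable_fun_ifT => //.
apply: (measurableT_comp mbz (_ : measurable_fun setT
  (fun x : past D A Aux k * pt R dZ => (Aux x.1, zZ x.2)))).
apply: measurable_fun_pair; last exact: (measurableT_comp mzZ).
exact: (measurableT_comp (measurable_past_Aux D A Aux k)).
Qed.

(** The weight is a function of [Z] once the past is frozen, so [r ^+ 2] may be replaced by its
    conditional version [v]; then [|w| <= C]. *)
Let int_h2 k om : (\int[P]_p (h k om p ^+ 2)%:E <= (C ^+ 2)%:E * \int[P]_p bk k om p)%E.
Proof.
have mHo : measurable_fun setT (fun z => H k om z ^+ 2).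
  by apply: measurable_funX; exact: (measurable_fun_pair2 (om : past D A Aux k) (mH k)).
have mbo : measurable_fun setT (bk k om).
  exact: (measurable_fun_pair2 (om : past D A Aux k) (mbk k)).
apply: (@le_trans _ _ (\int[P]_p ((H k om (zZ p) ^+ 2)%:E * v (zZ p)))%E).
  under eq_integral do rewrite /h exprMn.
  have [_ _ ve] := v2.
  apply: (le_integral_factor P (@zZ R dZ) mzZ (fun p => r p ^+ 2) (v \o zZ)
    (fun z => H k om z ^+ 2)) => //.
  - exact: measurable_funX.
  - exact: (measurableT_comp mv).
  - by move=> p; rewrite sqr_ge0.
  - by move=> p; exact: v0.
  - by move=> z; rewrite sqr_ge0.
rewrite -ge0_integralZl//; apply: ge0_le_integral => //.
- by move=> p _; rewrite mule_ge0// lee_fin sqr_ge0.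
- apply: emeasurable_funM; last exact: (measurableT_comp mv).
  by apply/measurable_EFinP; exact: (measurableT_comp mHo).
- exact: measurable_funeM.
- move=> p _; rewrite /bk /H; case: ifP => _; last by rewrite expr0n mul0e mule0.
  rewrite exprMn mulrC EFinM /bz muleA lee_wpmul2r// ?v0//.
  rewrite -!EFinM lee_fin ler_wpM2r ?sqr_ge0//.
  by rewrite -(real_normK (num_real (w _ _))) lerXn2r ?nnegrE// (le_trans _ (wC (A om) (zZ p))).
Qed.

Let int_bk k om : (\int[P]_p bk k om p <= K)%E.
Proof.
have mbo : measurable_fun setT (bk k om).
  exact: (measurable_fun_pair2 (om : past D A Aux k) (mbk k)).
apply: (@le_trans _ _ (\int[P]_p cst K p)%E).
  by apply: ge0_le_integral => // p _; exact: bk_le.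
by rewrite integral_cst// [X in (_ * X)%E]probability_setT mule1.
Qed.

(** Finite because of the cut-off: a retained summand is at most [K]. This also gives the
    integrability that the mean-zero property below requires. *)
Let h2oo k om : (\int[P]_p (h k om p ^+ 2)%:E < +oo)%E.
Proof.
apply: (le_lt_trans (int_h2 k om)).
apply: (@le_lt_trans _ _ ((C ^+ 2)%:E * K)%E); first by rewrite lee_wpmul2l.
by rewrite -EFinM ltry.
Qed.

Let h0 k om : (\int[P]_p (h k om p)%:E = 0)%E.
Proof.
have mHo : measurable_fun setT (H k om).
  exact: (measurable_fun_pair2 (om : past D A Aux k) (mH k)).
apply: (integral_mul_mean0 P (@zZ R dZ) mzZ r (H k om)) => //.
apply: integrable_of_sqr1; last exact: h2oo.
exact: (measurable_fun_pair2 (om : past D A Aux k) (mh k)).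
Qed.

Let Hk k om := h k om (D k om).
Let mHk k : measurable_fun setT (Hk k).
Proof. exact: (measurable_increment D A Aux Q P model h mh k). Qed.

Let sum_h2 : (\sum_(k < n) \int[Q]_om (Hk k om ^+ 2)%:E <= (C ^+ 2 * (kap * n%:R))%:E)%E.
Proof.
have h2bk k : (\int[Q]_om (Hk k om ^+ 2)%:E <= (C ^+ 2)%:E * \int[Q]_om bk k om (D k om))%E.
  rewrite /Hk (past_freezing D A Aux Q P model k (fun x => (h k x.1 x.2 ^+ 2)%:E)); last 2 first.
  - by apply/measurable_EFinP; exact: measurable_funX.
  - by move=> x; rewrite lee_fin sqr_ge0.
  rewrite (past_freezing D A Aux Q P model k (fun x => bk k x.1 x.2))//.
  have mi : measurable_fun setT (fun om : Omega => \int[P]_p bk k om p)%E.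
    refine (past_measurable_fun D A Aux Q P model k (fun om : Omega => \int[P]_p bk k om p)%E _).
    exact: (measurable_fun_fubini_tonelli_F (m2 := P)
      (fun x : past D A Aux k * pt R dZ => bk k x.1 x.2)).
  have mi2 : measurable_fun setT (fun om : Omega => \int[P]_p (h k om p ^+ 2)%:E)%E.
    refine (past_measurable_fun D A Aux Q P model k (fun om : Omega => \int[P]_p (h k om p ^+ 2)%:E)%E _).
    apply: (measurable_fun_fubini_tonelli_F (m2 := P)
      (fun x : past D A Aux k * pt R dZ => (h k x.1 x.2 ^+ 2)%:E)).
      by apply/measurable_EFinP; exact: measurable_funX.
    by move=> x; rewrite lee_fin sqr_ge0.
  rewrite -ge0_integralZl//; last by move=> om _; exact: integral_ge0.
  apply: ge0_le_integral => //.
  - by move=> om _; apply: integral_ge0 => p _; rewrite lee_fin sqr_ge0.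
  - exact: measurable_funeM.
  - by move=> om _; exact: int_h2.
have mbkk k : measurable_fun setT (fun om => bk k om (D k om)).
  refine (past_measurable_fun D A Aux Q P model k.+1 (fun om => bk k om (D k om)) _).
  apply: (measurableT_comp (mbk k) (_ : measurable_fun setT
    (fun om : past D A Aux k.+1 => ((om : past D A Aux k), D k om)))).
  apply: measurable_fun_pair; last exact: measurable_past_D.
  exact: (measurable_past_mono D A Aux k k.+1 (leqnSn k)).
apply: (@le_trans _ _ (\sum_(k < n) (C ^+ 2)%:E * \int[Q]_om bk k om (D k om))%E).
  by apply: lee_sum => k _; exact: h2bk.
rewrite -ge0_sume_distrr; last by move=> i _; exact: integral_ge0.
rewrite [leRHS]EFinM lee_wpmul2l//.
rewrite -(ge0_integral_sum Q measurableT (fun i : 'I_n => mbkk i))//.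
apply: (@le_trans _ _ (\int[Q]_om cst K om)%E); last first.
  by rewrite integral_cst// [X in (_ * X)%E]probability_setT mule1.
apply: ge0_le_integral => //.
- by move=> om _; apply: sume_ge0.
- by apply: emeasurable_sum => k; exact: mbkk.
- move=> om _; have := sum_truncated_le (fun j => bz (Aux om) (zZ (D j om))) K n (fun=> bz0 _ _) K0.
  apply: le_trans; apply: lee_sum => k _.
  by rewrite /bk /keep /Bp big_ord_recr.
Qed.

Let term k om := df (Aux om) (zZ (D k om)) * w (A om) (zZ (D k om)) * r (D k om).
Let Berr om : \bar R := ((n%:R^-1)%:E * Bp n om)%E.

Let Berr_le om : ~ (kap%:E < Berr om)%E -> (Bp n om <= K)%E.
Proof.
move=> /negP; rewrite -leNgt /Berr lee_pdivrMl// => h1.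
by rewrite /K mulrC EFinM.
Qed.

(** When the total is at most [K], so is every partial sum of these nonnegative terms, and nothing
    is cut off. *)
Let Hk_term om k : (Bp n om <= K)%E -> (k < n)%N -> Hk k om = term k om.
Proof.
move=> hB kn; rewrite /Hk /h /H ifT//.
have e : (Bp k om + bz (Aux om) (zZ (D k om)) = Bp k.+1 om)%E by rewrite /Bp big_ord_recr.
rewrite /keep e; apply: le_trans hB; rewrite /Bp.
rewrite (big_ord_widen n (fun j => bz (Aux om) (zZ (D j om))) kn).
by rewrite big_mkcond/=; apply: lee_sum => i _; case: ifP.
Qed.

Let mterm k : measurable_fun setT (term k).
Proof.
have [mD mA mAux _ _] := model.
have mZ : measurable_fun setT (fun om => zZ (D k om)) by exact: (measurableT_comp mzZ).
apply: measurable_funM; last exact: (measurableT_comp mr).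
apply: measurable_funM.
  exact: (measurableT_comp mdf (measurable_fun_pair mAux mZ)).
exact: (measurableT_comp mw (measurable_fun_pair mA mZ)).
Qed.

Let mBerr : measurable [set om | (kap%:E < Berr om)%E].
Proof.
rewrite -[X in measurable X]setTI; apply: emeasurable_fun_o_infty => //.
apply: measurable_funeM.
exact: (past_measurable_fun D A Aux Q P model n (Bp n) (mBp n)).
Qed.

Let sum_h2n : ((n%:R^-1)%:E * \sum_(k < n) \int[Q]_om (Hk k om ^+ 2)%:E <= (C ^+ 2 * kap)%:E)%E.
Proof. by rewrite lee_pdivrMl// -EFinM mulrC -mulrA. Qed.

(** Off the event [kap < Berr] the sum equals its truncation, a martingale whose second moment after
    division by [n] is at most [C ^+ 2 * kap]. The smallness comes from [kap], not from [n]. *)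
Lemma cross_linear (x : R) : 0 < x ->
  (Q [set om | (x <= `|(Num.sqrt n%:R)^-1 * \sum_(k < n) term k om|)%R] <=
   Q [set om | kap%:E < Berr om] + (C ^+ 2 * kap / x ^+ 2)%:E)%E.
Proof.
move=> x0.
pose M om := ((Num.sqrt n%:R)^-1 * \sum_(k < n) Hk k om) ^+ 2.
have mM : measurable_fun setT (EFin \o M).
  apply/measurable_EFinP; apply: measurable_funX; apply: measurable_funM => //.
  by apply: measurable_sum => i; exact: mHk.
have mT : measurable_fun setT (fun om => `|(Num.sqrt n%:R)^-1 * \sum_(k < n) term k om|).
  apply: measurableT_comp => //; apply: measurable_funM => //.
  by apply: measurable_sum => i; exact: mterm.
have mE1 : measurable [set om | (x <= `|(Num.sqrt n%:R)^-1 * \sum_(k < n) term k om|)%R].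
  by rewrite -[X in measurable X]setTI; exact: measurable_fun_le.
have mE2 : measurable [set om | ((x ^+ 2)%:E <= (M om)%:E)%E].
  by rewrite -[X in measurable X]setTI; exact: emeasurable_fun_c_infty.
have M0 om : (0 <= (EFin \o M) om)%E by rewrite lee_fin sqr_ge0.
apply: (le_trans (measure_subU2 Q _ _ _ mE1 mBerr mE2 _)).
  move=> om /= h1; have [|h2] := pselect (kap%:E < Berr om)%E; first by left.
  right; rewrite lee_fin /M (eq_bigr (fun k : 'I_n => term k om)); last first.
    by move=> k _; apply: Hk_term => //; exact: Berr_le.
  by rewrite -(real_normK (num_real (_^-1 * _))) lerXn2r ?nnegrE ?(ltW x0).
rewrite leeD2l//; apply: (markov_le Q _ (x ^+ 2) _ mM M0); first by rewrite exprn_gt0.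
rewrite (eq_integral (fun om => (n%:R^-1)%:E * ((\sum_(k < n) Hk k om) ^+ 2)%:E)%E); last first.
  by move=> om _; rewrite /= /M exprMn exprVn sqr_sqrtr// EFinM.
rewrite ge0_integralZl//; last 2 first.
- apply/measurable_EFinP; apply: measurable_funX.
  by apply: measurable_sum => i; exact: mHk.
- by move=> om _; rewrite lee_fin sqr_ge0.
by rewrite (second_moment_sum D A Aux Q P model h mh h2oo h0).
Qed.

(** The same cut-off with Markov's inequality for the average of squares, which bounds the effect of
    the cross terms on the empirical variance. *)
Lemma cross_square (x : R) : 0 < x ->
  (Q [set om | (x <= n%:R^-1 * \sum_(k < n) term k om ^+ 2)%R] <=
   Q [set om | kap%:E < Berr om] + (C ^+ 2 * kap / x)%:E)%E.
Proof.
move=> x0.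
pose M om := n%:R^-1 * \sum_(k < n) Hk k om ^+ 2.
have mM : measurable_fun setT (EFin \o M).
  apply/measurable_EFinP; apply: measurable_funM => //.
  by apply: measurable_sum => i; apply: measurable_funX; exact: mHk.
have mT : measurable_fun setT (fun om => n%:R^-1 * \sum_(k < n) term k om ^+ 2).
  apply: measurable_funM => //.
  by apply: measurable_sum => i; apply: measurable_funX; exact: mterm.
have mE1 : measurable [set om | (x <= n%:R^-1 * \sum_(k < n) term k om ^+ 2)%R].
  by rewrite -[X in measurable X]setTI; exact: measurable_fun_le.
have mE2 : measurable [set om | (x%:E <= (M om)%:E)%E].
  by rewrite -[X in measurable X]setTI; exact: emeasurable_fun_c_infty.
have M0 om : (0 <= (EFin \o M) om)%E.
  by rewrite lee_fin mulr_ge0 ?invr_ge0// sumr_ge0// => i _; rewrite sqr_ge0.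
apply: (le_trans (measure_subU2 Q _ _ _ mE1 mBerr mE2 _)).
  move=> om /= h1; have [|h2] := pselect (kap%:E < Berr om)%E; first by left.
  right; rewrite lee_fin /M (eq_bigr (fun k : 'I_n => term k om ^+ 2))//.
  by move=> k _; rewrite Hk_term//; exact: Berr_le.
rewrite leeD2l//; apply: (markov_le Q _ x _ mM M0) => //.
rewrite (eq_integral (fun om => (n%:R^-1)%:E * \sum_(k < n) (Hk k om ^+ 2)%:E)%E); last first.
  by move=> om _; rewrite /= /M EFinM sumEFin.
have mHk2 (k : 'I_n) : measurable_fun setT (fun om => (Hk k om ^+ 2)%:E).
  by apply/measurable_EFinP; apply: measurable_funX; exact: mHk.
have Hk20 (k : 'I_n) om : (0 <= (Hk k om ^+ 2)%:E)%E by rewrite lee_fin sqr_ge0.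
rewrite ge0_integralZl//; last 2 first.
- exact: emeasurable_sum.
- by move=> om _; exact: sume_ge0.
by rewrite (ge0_integral_sum Q measurableT mHk2).
Qed.

End cross.

(** * Laws of large numbers *)

Section lln.
Context {dO dA dB : measure_display} {Omega : measurableType dO}
  {TA : measurableType dA} {TB : measurableType dB} {R : realType} {dZ : nat}.
Variables (D : nat -> Omega -> pt R dZ) (A : Omega -> TA) (Aux : Omega -> TB).
Variables (Q : probability Omega R) (P : probability (pt R dZ) R).
Hypothesis model : sampling_model Q P D A Aux.

Lemma second_moment_avg (h : TA -> pt R dZ -> R) (B : R) (n : nat) (x : R) :
  measurable_fun setT (fun x : TA * pt R dZ => h x.1 x.2) ->
  (forall a, (\int[P]_p (h a p)%:E = 0)%E) ->
  (forall a, (\int[P]_p (h a p ^+ 2)%:E <= B%:E)%E) ->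
  (0 < n)%N -> 0 < x ->
  (Q [set om | (x <= `|n%:R^-1 * \sum_(k < n) h (A om) (D k om)|)%R]
   <= (B / (n%:R * x ^+ 2))%:E)%E.
Proof.
move=> mh h0 hB n0 x0.
have n0R : 0 < n%:R :> R by rewrite ltr0n.
have mhp k : measurable_fun setT (fun x : past D A Aux k * pt R dZ => h (A x.1) x.2).
  apply: (measurableT_comp mh (_ : measurable_fun setT
    (fun x : past D A Aux k * pt R dZ => (A x.1, x.2)))).
  by apply: measurable_fun_pair => //; exact: (measurableT_comp (measurable_past_A D A Aux k)).
have mhk k : measurable_fun setT (fun om => h (A om) (D k om)).
  exact: (measurable_increment D A Aux Q P model (fun k om p => h (A om) p) mhp k).
have h2oo a : (\int[P]_p (h a p ^+ 2)%:E < +oo)%E by apply: le_lt_trans (hB a) _; rewrite ltry.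
pose M om := (n%:R^-1 * \sum_(k < n) h (A om) (D k om)) ^+ 2.
have mM : measurable_fun setT (EFin \o M).
  apply/measurable_EFinP; apply: measurable_funX; apply: measurable_funM => //.
  by apply: measurable_sum => i; exact: mhk.
have M0 om : (0 <= (EFin \o M) om)%E by rewrite lee_fin sqr_ge0.
have -> : [set om | (x <= `|n%:R^-1 * \sum_(k < n) h (A om) (D k om)|)%R] =
    [set om | ((x ^+ 2)%:E <= (M om)%:E)%E].
  apply/seteqP; split => om /=; rewrite lee_fin /M -(real_normK (num_real (_^-1 * _)));
  by rewrite ler_pXn2r ?nnegrE ?(ltW x0).
have -> : B / (n%:R * x ^+ 2) = (B / n%:R) / x ^+ 2 by rewrite invfM mulrA.
apply: (markov_le Q _ (x ^+ 2) _ mM M0); first by rewrite exprn_gt0.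
rewrite (eq_integral (fun om => ((n%:R^-1) ^+ 2)%:E * ((\sum_(k < n) h (A om) (D k om)) ^+ 2)%:E)%E); last first.
  by move=> om _; rewrite /= /M exprMn EFinM.
rewrite ge0_integralZl ?lee_fin ?sqr_ge0//; last 2 first.
- apply/measurable_EFinP; apply: measurable_funX.
  by apply: measurable_sum => i; exact: mhk.
- by move=> om _; rewrite lee_fin sqr_ge0.
rewrite (second_moment_sum D A Aux Q P model (fun k om p => h (A om) p) mhp (fun _ om => h2oo _) (fun _ om => h0 _)).
apply: (@le_trans _ _ (((n%:R^-1) ^+ 2)%:E * \sum_(k < n) B%:E)%E); last first.
  rewrite sumEFin big_const_ord iter_addr_0 -EFinM lee_fin -[B *+ n]mulr_natr.
  rewrite le_eqVlt; apply/orP; left; apply/eqP; field; exact: lt0r_neq0.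
rewrite lee_wpmul2l ?lee_fin ?sqr_ge0//; apply: lee_sum => k _.
rewrite (past_freezing D A Aux Q P model k (fun x => (h (A x.1) x.2 ^+ 2)%:E)); last 2 first.
- by apply/measurable_EFinP; apply: measurable_funX; exact: mhp.
- by move=> y; rewrite lee_fin sqr_ge0.
apply: (@le_trans _ _ (\int[Q]_om cst B%:E om)%E); last first.
  by rewrite integral_cst// [X in (_ * X)%E]probability_setT mule1.
apply: ge0_le_integral => //.
- by move=> om _; apply: integral_ge0 => p _; rewrite lee_fin sqr_ge0.
- refine (past_measurable_fun D A Aux Q P model k (fun om : Omega => \int[P]_p (h (A om) p ^+ 2)%:E)%E _).
  apply: (measurable_fun_fubini_tonelli_F (m2 := P)
    (fun x : past D A Aux k * pt R dZ => (h (A x.1) x.2 ^+ 2)%:E)).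
    by apply/measurable_EFinP; apply: measurable_funX; exact: mhp.
  by move=> y; rewrite lee_fin sqr_ge0.
- by move=> om _ /=; exact: hB.
Qed.

Lemma first_moment_avg (h : TA -> pt R dZ -> R) (B : R) (n : nat) (x : R) :
  measurable_fun setT (fun x : TA * pt R dZ => h x.1 x.2) ->
  (forall a p, 0 <= h a p) ->
  (forall a, (\int[P]_p (h a p)%:E <= B%:E)%E) ->
  (0 < n)%N -> 0 < x ->
  (Q [set om | (x <= n%:R^-1 * \sum_(k < n) h (A om) (D k om))%R] <= (B / x)%:E)%E.
Proof.
move=> mh h0 hB n0 x0.
have n0R : 0 < n%:R :> R by rewrite ltr0n.
have mhp k : measurable_fun setT (fun x : past D A Aux k * pt R dZ => h (A x.1) x.2).
  apply: (measurableT_comp mh (_ : measurable_fun setT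
    (fun x : past D A Aux k * pt R dZ => (A x.1, x.2)))).
  by apply: measurable_fun_pair => //; exact: (measurableT_comp (measurable_past_A D A Aux k)).
have mhk k : measurable_fun setT (fun om => h (A om) (D k om)).
  exact: (measurable_increment D A Aux Q P model (fun k om p => h (A om) p) mhp k).
pose M om := n%:R^-1 * \sum_(k < n) h (A om) (D k om).
have mM : measurable_fun setT (EFin \o M).
  apply/measurable_EFinP; apply: measurable_funM => //.
  by apply: measurable_sum => i; exact: mhk.
have M0 om : (0 <= (EFin \o M) om)%E.
  by rewrite lee_fin mulr_ge0 ?invr_ge0// sumr_ge0.
apply: (markov_le Q _ x _ mM M0) => //.
rewrite (eq_integral (fun om => (n%:R^-1)%:E * \sum_(k < n) (h (A om) (D k om))%:E)%E); last first.
  by move=> om _; rewrite /= /M EFinM sumEFin.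
have mhkE (k : 'I_n) : measurable_fun setT (fun om => (h (A om) (D k om))%:E).
  by apply/measurable_EFinP; exact: mhk.
have hE0 (k : 'I_n) om : (0 <= (h (A om) (D k om))%:E)%E by rewrite lee_fin.
rewrite ge0_integralZl//; last 2 first.
- exact: emeasurable_sum.
- by move=> om _; exact: sume_ge0.
rewrite (ge0_integral_sum Q measurableT mhkE)//.
apply: (@le_trans _ _ ((n%:R^-1)%:E * \sum_(k < n) B%:E)%E); last first.
  rewrite sumEFin big_const_ord iter_addr_0 -EFinM lee_fin -[B *+ n]mulr_natr.
  rewrite le_eqVlt; apply/orP; left; apply/eqP; field; exact: lt0r_neq0.
rewrite lee_wpmul2l ?lee_fin ?invr_ge0//; apply: lee_sum => k _.
rewrite (past_freezing D A Aux Q P model k (fun x => (h (A x.1) x.2)%:E)); last 2 first.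
- by apply/measurable_EFinP; exact: mhp.
- by move=> y; rewrite lee_fin.
apply: (@le_trans _ _ (\int[Q]_om cst B%:E om)%E); last first.
  by rewrite integral_cst// [X in (_ * X)%E]probability_setT mule1.
apply: ge0_le_integral => //.
- by move=> om _; apply: integral_ge0 => p _; rewrite lee_fin.
- refine (past_measurable_fun D A Aux Q P model k (fun om : Omega => \int[P]_p (h (A om) p)%:E)%E _).
  apply: (measurable_fun_fubini_tonelli_F (m2 := P)
    (fun x : past D A Aux k * pt R dZ => (h (A x.1) x.2)%:E)).
    by apply/measurable_EFinP; exact: mhp.
  by move=> y; rewrite lee_fin.
- by move=> om _ /=; exact: hB.
Qed.

Variables (G : set TA) (Y : TA -> pt R dZ -> R).
Hypothesis mG : measurable G.
Hypothesis mY : measurable_fun setT (fun x : TA * pt R dZ => Y x.1 x.2).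
Hypothesis Y1 : forall a, G a -> (\int[P]_p (Y a p)%:E = 0)%E.
Hypothesis Y2 : forall a, G a -> (\int[P]_p (Y a p ^+ 2)%:E = 1)%E.

Let mGx : measurable_fun setT (fun x : TA * pt R dZ => \1_G x.1 : R).
Proof. by apply: (measurableT_comp _ measurable_fst); exact: measurable_indic. Qed.

Lemma lln_linear (n : nat) (x : R) : (0 < n)%N -> 0 < x ->
  (Q (A @^-1` G `&` [set om | (x <= `|n%:R^-1 * \sum_(k < n) Y (A om) (D k om)|)%R])
   <= (1 / (n%:R * x ^+ 2))%:E)%E.
Proof.
move=> n0 x0.
(* The indicator makes the moment conditions valid for every [a], as [second_moment_avg] demands,
   and changes nothing when [A] lies in [G]. *)
pose h a p := \1_G a * Y a p.
have mh : measurable_fun setT (fun x : TA * pt R dZ => h x.1 x.2) by exact: measurable_funM.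
have [mD mA _ _ _] := model.
have mhk k : measurable_fun setT (fun om => h (A om) (D k om)).
  exact: (measurableT_comp mh (measurable_fun_pair mA (mD k))).
have mYk k : measurable_fun setT (fun om => Y (A om) (D k om)).
  exact: (measurableT_comp mY (measurable_fun_pair mA (mD k))).
have mAG : measurable (A @^-1` G) by rewrite -[X in measurable X]setTI; exact: mA.
apply: le_trans (second_moment_avg h 1 n x mh _ _ n0 x0).
- apply: le_measure; rewrite ?inE.
  + apply: measurableI => //; rewrite -[X in measurable X]setTI; apply: measurable_fun_le => //.
    apply: measurableT_comp => //; apply: measurable_funM => //.
    by apply: measurable_sum => i; exact: mYk.
  + rewrite -[X in measurable X]setTI; apply: measurable_fun_le => //.
    apply: measurableT_comp => //; apply: measurable_funM => //.
    by apply: measurable_sum => i; exact: mhk.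
  + move=> om [Ga /=]; rewrite (eq_bigr (fun k : 'I_n => h (A om) (D k om)))// => k _.
    by rewrite /h indicE mem_set// mul1r.
- move=> a; rewrite /h indicE; have [aG|_] := boolP (a \in G).
    by under eq_integral do rewrite mul1r; rewrite Y1//; rewrite inE in aG.
  by under eq_integral do rewrite mul0r; rewrite integral0.
- move=> a; rewrite /h indicE; have [aG|_] := boolP (a \in G).
    by under eq_integral do rewrite mul1r; rewrite Y2//; rewrite inE in aG.
  by under eq_integral do rewrite mul0r expr0n; rewrite integral0 lee_fin.
Qed.

(** The deviation is split in thirds: the head, cut at level [L] and centred, is bounded by [L ^+ 2]
    and obeys Chebyshev's inequality; the tail has mean at most [b] and obeys Markov's; the mean [m]
    of the head differs from 1 by at most [b <= x / 3]. *)
Lemma lln_square (n : nat) (x L b : R) : (0 < n)%N -> 0 < x -> 0 <= L -> 0 <= b <= x / 3 ->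
  (forall a, G a ->
    (\int[P]_p (if L < `|Y a p| then Y a p ^+ 2 else 0)%:E <= b%:E)%E) ->
  (Q (A @^-1` G `&` [set om | (x <= `|n%:R^-1 * \sum_(k < n) Y (A om) (D k om) ^+ 2 - 1|)%R])
   <= (L ^+ 4 / (n%:R * (x / 3) ^+ 2) + b / (x / 3))%:E)%E.
Proof.
move=> n0 x0 L0 /andP[b0 bx] Yb.
have n0R : 0 < n%:R :> R by rewrite ltr0n.
pose tl a p := if L < `|Y a p| then Y a p ^+ 2 else 0.
pose hd a p := if L < `|Y a p| then 0 else Y a p ^+ 2.
have mY2 : measurable_fun setT (fun x : TA * pt R dZ => Y x.1 x.2 ^+ 2) by exact: measurable_funX.
have mLY : measurable_fun setT (fun x : TA * pt R dZ => L < `|Y x.1 x.2|).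
  by apply: measurable_fun_ltr => //; exact: measurableT_comp.
have mtl : measurable_fun setT (fun x : TA * pt R dZ => tl x.1 x.2).
  exact: measurable_fun_ifT.
have mhd : measurable_fun setT (fun x : TA * pt R dZ => hd x.1 x.2).
  exact: measurable_fun_ifT.
have tl0 a p : 0 <= tl a p by rewrite /tl; case: ifP; rewrite ?sqr_ge0.
have hd0 a p : 0 <= hd a p by rewrite /hd; case: ifP; rewrite ?sqr_ge0.
have hdL a p : hd a p <= L ^+ 2.
  rewrite /hd; case: ltP => h; rewrite ?sqr_ge0//.
  by rewrite -(real_normK (num_real _)) lerXn2r ?nnegrE.
pose m a := fine (\int[P]_p (hd a p)%:E).
have hdi a : (\int[P]_p (hd a p)%:E <= (L ^+ 2)%:E)%E.
  apply: (@le_trans _ _ (\int[P]_p cst (L ^+ 2)%:E p)%E); last first.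
    by rewrite integral_cst// [X in (_ * X)%E]probability_setT mule1.
  apply: ge0_le_integral => //.
  - by move=> p _; rewrite lee_fin.
  - by apply/measurable_EFinP; exact: (measurable_fun_pair2 a mhd).
  - by move=> p _; rewrite lee_fin.
have hdi0 a : (0 <= \int[P]_p (hd a p)%:E)%E by apply: integral_ge0 => p _; rewrite lee_fin.
have mE a : (\int[P]_p (hd a p)%:E = (m a)%:E)%E.
  rewrite /m fineK// ge0_fin_numE//; exact: le_lt_trans (hdi a) (ltry _).
have m0 a : 0 <= m a by rewrite -lee_fin -mE.
have mL a : m a <= L ^+ 2 by rewrite -lee_fin -mE.
have mm : measurable_fun setT m.
  apply/measurable_EFinP; apply: (eq_measurable_fun (fun a => \int[P]_p (hd a p)%:E)%E).
    by move=> a _; rewrite mE.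
  apply: (measurable_fun_fubini_tonelli_F (m2 := P) (fun x : TA * pt R dZ => (hd x.1 x.2)%:E)).
    exact/measurable_EFinP.
  by move=> y; rewrite lee_fin.
have m1 a : G a -> 1 - b <= m a <= 1.
  move=> Ga; have := Y2 a Ga.
  rewrite (eq_integral (fun p => (hd a p)%:E + (tl a p)%:E)%E); last first.
    by move=> p _; rewrite -EFinD /hd /tl; case: ifP; rewrite ?add0r ?addr0.
  rewrite ge0_integralD//; last 4 first.
  - by move=> p _; rewrite lee_fin.
  - by apply/measurable_EFinP; exact: (measurable_fun_pair2 a mhd).
  - by move=> p _; rewrite lee_fin.
  - by apply/measurable_EFinP; exact: (measurable_fun_pair2 a mtl).
  have := Yb a Ga; have : (0 <= \int[P]_p (tl a p)%:E)%E.
    by apply: integral_ge0 => p _; rewrite lee_fin.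
  rewrite -/(tl a) mE; case: (\int[P]_p (tl a p)%:E)%E => [u| |]//.
  by rewrite !lee_fin => u0 ub [] e; apply/andP; split; lra.
pose h a p := \1_G a * (hd a p - m a).
pose g a p := \1_G a * tl a p.
have mh : measurable_fun setT (fun x : TA * pt R dZ => h x.1 x.2).
  apply: measurable_funM => //; apply: measurable_funB => //.
  exact: (measurableT_comp mm measurable_fst).
have mg : measurable_fun setT (fun x : TA * pt R dZ => g x.1 x.2) by exact: measurable_funM.
have [mD mA _ _ _] := model.
have mk (f : TA -> pt R dZ -> R) k : measurable_fun setT (fun x : TA * pt R dZ => f x.1 x.2) ->
    measurable_fun setT (fun om => f (A om) (D k om)).
  move=> mf; exact: (measurableT_comp mf (measurable_fun_pair mA (mD k))).
have mAG : measurable (A @^-1` G) by rewrite -[X in measurable X]setTI; exact: mA.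
have ihd a : P.-integrable setT (EFin \o hd a).
  apply/integrableP; split; first by apply/measurable_EFinP; exact: (measurable_fun_pair2 a mhd).
  under eq_integral do rewrite /= ger0_norm//.
  by rewrite mE ltry.
have h1 a : (\int[P]_p (h a p)%:E = 0)%E.
  rewrite /h indicE; have [_|_] := boolP (a \in G); last first.
    by under eq_integral do rewrite mul0r; rewrite integral0.
  under eq_integral do rewrite mul1r EFinB.
  rewrite integralB_EFin//; last exact: finite_measure_integrable_cst.
  by rewrite mE integral_cst// [X in (_ * X)%E]probability_setT mule1 subee.
have h2 a : (\int[P]_p (h a p ^+ 2)%:E <= (L ^+ 4)%:E)%E.
  apply: (@le_trans _ _ (\int[P]_p cst (L ^+ 4)%:E p)%E); last first.
    by rewrite integral_cst// [X in (_ * X)%E]probability_setT mule1.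
  apply: ge0_le_integral => //.
  - by move=> p _; rewrite lee_fin sqr_ge0.
  - by apply/measurable_EFinP; apply: measurable_funX; exact: (measurable_fun_pair2 a mh).
  - move=> p _; rewrite lee_fin /h indicE; case: (a \in G) => /=; last first.
      by rewrite mul0r expr0n exprn_ge0.
    rewrite mul1r (_ : L ^+ 4 = (L ^+ 2) ^+ 2); last by rewrite -exprM.
    have := hd0 a p; have := hdL a p; have := m0 a; have := mL a => *.
    by rewrite -(real_normK (num_real (_ - _))) lerXn2r ?nnegrE ?sqr_ge0// ler_norml; lra.
have g1 a : (\int[P]_p (g a p)%:E <= b%:E)%E.
  rewrite /g indicE; have [aG|_] := boolP (a \in G).
    by under eq_integral do rewrite mul1r; apply: Yb; rewrite inE in aG.
  by under eq_integral do rewrite mul0r; rewrite integral0 lee_fin.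
have x3 : 0 < x / 3 by rewrite divr_gt0.
have B1 := second_moment_avg h _ n (x / 3) mh h1 h2 n0 x3.
have g0 a p : 0 <= g a p by rewrite mulr_ge0.
have B2 := first_moment_avg g b n (x / 3) mg g0 g1 n0 x3.
rewrite EFinD; apply: le_trans (leeD B1 B2); apply: measure_subU2.
- apply: measurableI => //; rewrite -[X in measurable X]setTI; apply: measurable_fun_le => //.
  apply: measurableT_comp => //; apply: measurable_funB => //; apply: measurable_funM => //.
  by apply: measurable_sum => i; exact: (mk (fun a p => Y a p ^+ 2)).
- rewrite -[X in measurable X]setTI; apply: measurable_fun_le => //.
  apply: measurableT_comp => //; apply: measurable_funM => //.
  by apply: measurable_sum => i; exact: mk.
- rewrite -[X in measurable X]setTI; apply: measurable_fun_le => //.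
  by apply: measurable_funM => //; apply: measurable_sum => i; exact: mk.
move=> om [Ga /=] hx.
have [t1|t1] := leP (x / 3) (n%:R^-1 * \sum_(k < n) g (A om) (D k om)); first by right.
left; have /andP[mb m1'] := m1 _ Ga.
have e : n%:R^-1 * \sum_(k < n) Y (A om) (D k om) ^+ 2 =
   n%:R^-1 * \sum_(k < n) h (A om) (D k om) + n%:R^-1 * \sum_(k < n) g (A om) (D k om) + m (A om).
  have nm : m (A om) = n%:R^-1 * \sum_(k < n) m (A om).
    by rewrite sumr_const card_ord -[m _ *+ n]mulr_natl mulrA mulVf ?mul1r// lt0r_neq0.
  rewrite [X in _ + X]nm -!mulrDr -!big_split/=; congr (_ * _); apply: eq_bigr => k _.
  rewrite /h /g indicE mem_set// !mul1r /hd /tl; case: ifP => _; ring.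
have t0 : 0 <= n%:R^-1 * \sum_(k < n) g (A om) (D k om).
  by rewrite mulr_ge0 ?invr_ge0// sumr_ge0.
move: hx; rewrite e; move: (n%:R^-1 * _) t0 t1 (n%:R^-1 * _) => u u0 u1 z.
by rewrite !ler_normr => /orP[] hz; apply/orP; [left|right]; lra.
Qed.

End lln.

(** * Standardization *)

Section tails.
Context {d : measure_display} {T : measurableType d} {R : realType}.
Variables (P : probability T R) (e : T -> R) (eta M : R).
Hypothesis me : measurable_fun setT e.
Hypothesis eta0 : 0 < eta.
Hypothesis eM : (\int[P]_p (`|e p| `^ (2 + eta))%:E <= M%:E)%E.

Let mea : measurable_fun setT (fun p => `|e p|). Proof. exact: measurableT_comp. Qed.

Let mpow : measurable_fun setT (fun p => (`|e p| `^ (2 + eta))%:E).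
Proof. by apply/measurable_EFinP; apply: (measurableT_comp (f := fun x : R => x `^ (2 + eta)) (measurable_powR (2 + eta)) mea). Qed.

Let powR2 (x : R) : 0 < x -> x `^ (2 + eta) = x ^+ 2 * x `^ eta.
Proof.
move=> x0; rewrite powRD; last by apply/implyP => _; rewrite (gt_eqF x0).
by rewrite powR_mulrn// ltW.
Qed.

Lemma moment_tail (L : R) : 0 < L ->
  (\int[P]_p (if (L < `|e p|)%R then e p ^+ 2 else 0)%:E <= (M / L `^ eta)%:E)%E.
Proof.
move=> L0; have Le : 0 < L `^ eta by exact: powR_gt0.
apply: (@le_trans _ _ (\int[P]_p ((L `^ eta)^-1%:E * (`|e p| `^ (2 + eta))%:E))%E); last first.
  rewrite ge0_integralZl// ?lee_fin ?invr_ge0 ?(ltW Le)//.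
    by rewrite mulrC EFinM lee_wpmul2l// lee_fin invr_ge0 ltW.
apply: ge0_le_integral => //.
- by move=> p _; case: ifP; rewrite ?lee_fin ?sqr_ge0.
- apply/measurable_EFinP/measurable_fun_ifT => //; last exact: measurable_funX.
  exact: measurable_fun_ltr.
- exact: measurable_funeM.
- move=> p _; case: ifPn => h; last by rewrite -EFinM lee_fin mulr_ge0 ?invr_ge0 ?powR_ge0.
  rewrite -EFinM lee_fin ler_pdivlMl// powR2; last exact: lt_trans h.
  rewrite mulrC (real_normK (num_real (e p))) ler_wpM2l ?sqr_ge0//.
  by rewrite ge0_ler_powR ?nnegrE ?(ltW eta0) ?(ltW L0) ?normr_ge0 ?(ltW h).
Qed.

Lemma moment_sqr : (\int[P]_p (e p ^+ 2)%:E <= (1 + M)%:E)%E.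
Proof.
apply: (@le_trans _ _ (\int[P]_p (cst 1 p + (`|e p| `^ (2 + eta))%:E))%E); last first.
  rewrite ge0_integralD//.
  by rewrite integral_cst// [X in (_ * X)%E]probability_setT mule1 EFinD leeD2l.
apply: ge0_le_integral => //.
- by move=> p _; rewrite lee_fin sqr_ge0.
- by apply/measurable_EFinP; exact: measurable_funX.
- exact: emeasurable_funD.
- move=> p _; rewrite /= -EFinD lee_fin -(real_normK (num_real (e p))).
  have [h|h] := leP `|e p| 1.
    by rewrite (@le_trans _ _ 1) ?expr_le1// lerDl powR_ge0.
  have h0 : 0 < `|e p| by exact: lt_trans h.
  rewrite powR2// (@le_trans _ _ (`|e p| ^+ 2 * `|e p| `^ eta)) ?lerDr//.
  rewrite ler_peMr ?sqr_ge0//.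
  have := @ge0_ler_powR R eta (ltW eta0) 1 `|e p|; rewrite powR1; apply; rewrite ?nnegrE ?(ltW h)//.
Qed.

End tails.

(** On nonpositive arguments both the square root and the inverse of 0 take the default value 0, so
    the function is an exponential of a logarithm on one half-line and 0 on the other. *)
Lemma measurable_inv_sqrt {R : realType} :
  measurable_fun setT (fun x : R => (Num.sqrt x)^-1).
Proof.
rewrite (_ : (fun x => _) = (fun x => if 0 < x then expR (- (ln x / 2)) else 0)); last first.
  apply/funext => x; case: ltP => x0; first by rewrite expRN_half_ln.
  by rewrite ler0_sqrtr// invr0.
apply: measurable_fun_ifT => //; first exact: measurable_fun_ltr.
by apply: measurableT_comp => //; apply: measurable_funN; apply: measurable_funM.
Qed.

(** Gives measurability of [rho_bar] and [sigma2_bar] in [a] without deciding for which [a] the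
    integral is finite: each signed part is a Tonelli integral, and [fine] is measurable. *)
Lemma measurable_fun_integral {d d'} {T1 : measurableType d} {T2 : measurableType d'}
    {R : realType} (P : probability T2 R) (F : T1 -> T2 -> R) :
  measurable_fun setT (fun x : T1 * T2 => F x.1 x.2) ->
  measurable_fun setT (fun a => fine (\int[P]_p (F a p)%:E)).
Proof.
move=> mF; apply: measurableT_comp => //.
rewrite (_ : (fun a => _) = (fun a => \int[P]_p (Num.max (F a p) 0)%:E - \int[P]_p (Num.max (- F a p) 0)%:E)%E); last first.
  apply/funext => a; rewrite integralE; congr (_ - _)%E; apply: eq_integral => p _.
    by rewrite funeposE EFin_max.
  by rewrite funenegE EFin_max.
apply: emeasurable_funB.
  apply: (measurable_fun_fubini_tonelli_F (m2 := P) (fun x => (Num.max (F x.1 x.2) 0)%:E)).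
    by apply/measurable_EFinP; exact: measurable_maxr.
  by move=> x; rewrite lee_fin le_max lexx orbT.
apply: (measurable_fun_fubini_tonelli_F (m2 := P) (fun x => (Num.max (- F x.1 x.2) 0)%:E)).
  by apply/measurable_EFinP; apply: measurable_maxr => //; exact: measurable_funN.
by move=> x; rewrite lee_fin le_max lexx orbT.
Qed.

Lemma cexp_residual {R : realType} {dZ : nat} (P : probability (pt R dZ) R)
    (h : pt R dZ -> R) (f : dZ.-tuple R -> R) :
  measurable_fun setT h -> cexp_version P h f ->
  [/\ measurable_fun setT (fun p => h p - f (zZ p)),
      P.-integrable setT (EFin \o (fun p => h p - f (zZ p))) &
      forall B : set (dZ.-tuple R), measurable B ->
        (\int[P]_(p in zZ @^-1` B) (h p - f (zZ p))%:E = 0)%E].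
Proof.
move=> mh [mf ih iff e].
have mzZ : measurable_fun setT (@zZ R dZ) := measurable_snd.
split.
- by apply: measurable_funB => //; exact: (measurableT_comp mf).
- exact: (integrableB measurableT ih iff).
- move=> B mB.
  have mD : measurable (@zZ R dZ @^-1` B) by rewrite -[X in measurable X]setTI; exact: mzZ.
  have ihB := integrableS measurableT mD (@subsetT _ _) ih.
  have ifB := integrableS measurableT mD (@subsetT _ _) iff.
  under eq_integral do rewrite EFinB.
  rewrite integralB_EFin// e// subee//; exact: integrable_fin_num.
Qed.

Section standardize.
Context {dA : measure_display} {TA : measurableType dA} {R : realType} {dZ : nat}.
Variables (P : probability (pt R dZ) R) (f g : dZ.-tuple R -> R).
Variables (w : TA -> dZ.-tuple R -> R) (C eta M c : R).
Hypothesis fX : cexp_version P xX f.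
Hypothesis gY : cexp_version P yY g.
Hypothesis mw : measurable_fun setT (fun x : TA * dZ.-tuple R => w x.1 x.2).
Hypothesis wC : forall a z, `|w a z| <= C.
Hypotheses (eta0 : 0 < eta) (c0 : 0 < c) (C0 : 0 < C).
Hypothesis eM : (\int[P]_p (`|epsP f p * xiP g p| `^ (2 + eta))%:E <= M%:E)%E.

Let ex p := epsP f p * xiP g p.
Let rho := rho_bar P f g w.
Let sg2 := sigma2_bar P f g w.
Let Y a p := (ex p * w a (zZ p) - rho a) / Num.sqrt (sg2 a).
Let G := [set a | c <= sg2 a].
Let B := C * (2 + M) / Num.sqrt c.

Let mzZ : measurable_fun setT (@zZ R dZ). Proof. exact: measurable_snd. Qed.

Let mex : measurable_fun setT ex.
Proof.
have mX : measurable_fun setT (@xX R dZ) by exact: (measurableT_comp measurable_fst measurable_fst).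
have mYY : measurable_fun setT (@yY R dZ) by exact: (measurableT_comp measurable_snd measurable_fst).
have [m1 _ _] := cexp_residual P xX f mX fX.
have [m2 _ _] := cexp_residual P yY g mYY gY.
exact: measurable_funM.
Qed.

Let mexw : measurable_fun setT (fun x : TA * pt R dZ => ex x.2 * w x.1 (zZ x.2)).
Proof.
apply: measurable_funM; first exact: (measurableT_comp mex).
apply: (measurableT_comp mw (_ : measurable_fun setT (fun x : TA * pt R dZ => (x.1, zZ x.2)))).
by apply: measurable_fun_pair => //; exact: (measurableT_comp mzZ).
Qed.

Lemma measurable_rho_bar : measurable_fun setT rho.
Proof. exact: (measurable_fun_integral P (fun a p => ex p * w a (zZ p)) mexw). Qed.

Lemma measurable_sigma2_bar : measurable_fun setT sg2.
Proof.
apply: (measurable_fun_integral P (fun a p => (ex p * w a (zZ p) - rho a) ^+ 2)).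
apply: measurable_funX; apply: measurable_funB => //.
exact: (measurableT_comp measurable_rho_bar measurable_fst).
Qed.

Lemma measurable_good : measurable G.
Proof.
by rewrite -[X in measurable X]setTI; apply: measurable_fun_le => //; exact: measurable_sigma2_bar.
Qed.

Lemma measurable_standardized : measurable_fun setT (fun x : TA * pt R dZ => Y x.1 x.2).
Proof.
apply: measurable_funM.
  apply: measurable_funB => //; exact: (measurableT_comp measurable_rho_bar measurable_fst).
exact: (measurableT_comp measurable_inv_sqrt (measurableT_comp measurable_sigma2_bar measurable_fst)).
Qed.

Let M0 : 0 <= M.
Proof. by rewrite -lee_fin; apply: le_trans eM; apply: integral_ge0 => p _; rewrite lee_fin powR_ge0. Qed.

Let ex2oo : (\int[P]_p (ex p ^+ 2)%:E < +oo)%E.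
Proof. by apply: le_lt_trans (moment_sqr P ex eta M mex eta0 eM) _; rewrite ltry. Qed.

Let mexwa a : measurable_fun setT (fun p => ex p * w a (zZ p)).
Proof. exact: (measurable_fun_pair2 a mexw). Qed.

Let exw2 a : (\int[P]_p ((ex p * w a (zZ p)) ^+ 2)%:E < +oo)%E.
Proof.
apply: (@le_lt_trans _ _ (\int[P]_p ((C ^+ 2)%:E * (ex p ^+ 2)%:E))%E).
  apply: ge0_le_integral => //.
  - by move=> p _; rewrite lee_fin sqr_ge0.
  - by apply/measurable_EFinP; exact: measurable_funX.
  - by apply: measurable_funeM; apply/measurable_EFinP; exact: measurable_funX.
  - move=> p _; rewrite -EFinM lee_fin exprMn mulrC ler_wpM2r ?sqr_ge0//.
    by rewrite -(real_normK (num_real (w _ _))) lerXn2r ?nnegrE// ltW.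
rewrite ge0_integralZl ?lee_fin ?sqr_ge0//.
- have : (0 <= \int[P]_p (ex p ^+ 2)%:E)%E by apply: integral_ge0 => p _; rewrite lee_fin sqr_ge0.
  by move: ex2oo; case: (\int[P]_p (ex p ^+ 2)%:E)%E => [r| |]// _ _; rewrite -EFinM ltry.
- by apply/measurable_EFinP; exact: measurable_funX.
- by move=> p _; rewrite lee_fin sqr_ge0.
Qed.

Let iexw a : P.-integrable setT (EFin \o (fun p => ex p * w a (zZ p))).
Proof. exact: integrable_of_sqr1. Qed.

Let rhoE a : (\int[P]_p (ex p * w a (zZ p))%:E = (rho a)%:E)%E.
Proof. by rewrite /rho /rho_bar /Rintegral fineK//; exact: (integrable_fin_num measurableT (iexw a)). Qed.

Let icen a : P.-integrable setT (EFin \o (fun p => ex p * w a (zZ p) - rho a)).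
Proof.
have ic : P.-integrable setT (EFin \o cst (rho a)) by exact: finite_measure_integrable_cst.
exact: (integrableB measurableT (iexw a) ic).
Qed.

Let cen0 a : (\int[P]_p (ex p * w a (zZ p) - rho a)%:E = 0)%E.
Proof.
under eq_integral do rewrite EFinB.
rewrite integralB_EFin//; last exact: finite_measure_integrable_cst.
by rewrite rhoE integral_cst// [X in (_ * X)%E]probability_setT mule1 subee.
Qed.

Let mcen a : measurable_fun setT (fun p => ex p * w a (zZ p) - rho a).
Proof. exact: measurable_funB. Qed.

(** [sigma2_bar] is the [fine] part of an integral, and an infinite integral would give the default
    value 0; the bound [c <= sg2 a] with [c > 0] excludes this. *)
Let sg2E a : G a -> (\int[P]_p ((ex p * w a (zZ p) - rho a) ^+ 2)%:E = (sg2 a)%:E)%E.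
Proof.
move=> Ga; move: Ga; rewrite /G /= /sg2 /sigma2_bar /Rintegral.
have : (0 <= \int[P]_p ((ex p * w a (zZ p) - rho a) ^+ 2)%:E)%E.
  by apply: integral_ge0 => p _; rewrite lee_fin sqr_ge0.
rewrite -/rho; case: (\int[P]_p ((ex p * w a (zZ p) - rho a) ^+ 2)%:E)%E => [r| |]//= _.
by move=> h; have := lt_le_trans c0 h; rewrite ltxx.
Qed.

Lemma standardized_mean a : G a -> (\int[P]_p (Y a p)%:E = 0)%E.
Proof.
move=> Ga.
rewrite (eq_integral (fun p => (Num.sqrt (sg2 a))^-1%:E * (ex p * w a (zZ p) - rho a)%:E)%E).
  by rewrite (integralZl measurableT (icen a)) cen0 mule0.
by move=> p _; rewrite -EFinM mulrC.
Qed.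

Lemma standardized_var a : G a -> (\int[P]_p (Y a p ^+ 2)%:E = 1)%E.
Proof.
move=> Ga; have s0 : 0 < sg2 a by exact: lt_le_trans Ga.
rewrite (eq_integral (fun p => (sg2 a)^-1%:E * ((ex p * w a (zZ p) - rho a) ^+ 2)%:E)%E); last first.
  by move=> p _; rewrite -EFinM /Y exprMn exprVn (sqr_sqrtr (ltW s0)); congr EFin; exact: mulrC.
rewrite ge0_integralZl ?lee_fin ?invr_ge0 ?(ltW s0)//.
- by rewrite sg2E// -EFinM mulVf// gt_eqF.
- by apply/measurable_EFinP; apply: measurable_funX; exact: mcen.
- by move=> p _; rewrite lee_fin sqr_ge0.
Qed.

(** From [|ex p| <= 1 + ex p ^+ 2] and the second moment bound [1 + M]; this is the origin of the
    factor [2 + M] in [B]. *)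
Let rho_le a : `|rho a| <= C * (2 + M).
Proof.
rewrite -lee_fin -(abse_EFin) -rhoE.
apply: (le_trans (le_abse_integral P measurableT _)); first exact/measurable_EFinP.
apply: (@le_trans _ _ (\int[P]_p (C%:E * (cst 1 p + (ex p ^+ 2)%:E)))%E).
  apply: ge0_le_integral => //.
  - by do 2 apply: measurableT_comp => //; exact: mexwa.
  - apply: measurable_funeM; apply: emeasurable_funD => //.
    by apply/measurable_EFinP; exact: measurable_funX.
  - move=> p _; rewrite /= -EFinD -EFinM lee_fin normrM mulrC.
    apply: ler_pM => //; rewrite -(real_normK (num_real (ex p))).
    by have := sqr_ge0 (`|ex p| - 1); have := normr_ge0 (ex p); nra.
have mex2 : measurable_fun setT (fun p => (ex p ^+ 2)%:E).
  by apply/measurable_EFinP; exact: measurable_funX.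
have ex20 p : (0 <= (ex p ^+ 2)%:E)%E by rewrite lee_fin sqr_ge0.
rewrite ge0_integralZl ?lee_fin ?(ltW C0)//; last 2 first.
- exact: emeasurable_funD.
- by move=> p _; rewrite adde_ge0.
rewrite EFinM lee_wpmul2l ?lee_fin ?(ltW C0)// ge0_integralD//.
rewrite integral_cst// [X in (_ * X)%E]probability_setT mule1.
apply: (le_trans (leeD2l _ (moment_sqr P ex eta M mex eta0 eM))).
by rewrite -EFinD lee_fin; lra.
Qed.

Let B0 : 0 < B.
Proof.
have m2 : 0 < 2 + M by apply: ltr_pwDl.
by rewrite /B divr_gt0 ?sqrtr_gt0// mulr_gt0.
Qed.

Let Y_le a p : G a -> `|Y a p| <= B * (1 + `|ex p|).
Proof.
move=> Ga; have s0 : 0 < sg2 a by exact: lt_le_trans Ga.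
have sc : 0 < Num.sqrt c by rewrite sqrtr_gt0.
have ss : 0 < Num.sqrt (sg2 a) by rewrite sqrtr_gt0.
have scs : Num.sqrt c <= Num.sqrt (sg2 a) by rewrite ler_wsqrtr.
have -> : B * (1 + `|ex p|) = C * (2 + M) * (1 + `|ex p|) / Num.sqrt c.
  by rewrite /B mulrAC.
rewrite /Y normrM normfV (ger0_norm (ltW ss)).
have iss : (Num.sqrt (sg2 a))^-1 <= (Num.sqrt c)^-1 by rewrite lef_pV2.
have iss0 : 0 <= (Num.sqrt (sg2 a))^-1 by rewrite invr_ge0 ltW.
apply: ler_pM iss => //.
apply: (le_trans (ler_normB _ _)); rewrite normrM.
have hr := rho_le a; have hx := ler_wpM2l (normr_ge0 (ex p)) (wC a (zZ p)).
have hp : 0 <= C * `|ex p| * (1 + M).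
  by apply: mulr_ge0; [apply: mulr_ge0 => //; exact: ltW | have := M0; lra].
lra.
Qed.

(** Since [|Y|] is at most [B * (1 + |ex|)], exceeding [B * (1 + L)] forces [|ex| > L >= 1], and
    then [Y ^+ 2 <= 4 * B ^+ 2 * ex ^+ 2]. The bound is uniform in [a] and sees [P] only through
    [M]. *)
Lemma standardized_tail a (L : R) : G a -> 1 <= L ->
  (\int[P]_p (if (B * (1 + L) < `|Y a p|)%R then Y a p ^+ 2 else 0)%:E
   <= (4 * B ^+ 2 * (M / L `^ eta))%:E)%E.
Proof.
move=> Ga L1; have L0 : 0 < L by lra.
have mYa : measurable_fun setT (Y a) by exact: (measurable_fun_pair2 a measurable_standardized).
have mtl : measurable_fun setT (fun p => (if L < `|ex p| then ex p ^+ 2 else 0)%:E).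
  apply/measurable_EFinP/measurable_fun_ifT => //; last exact: measurable_funX.
  by apply: measurable_fun_ltr => //; exact: measurableT_comp.
have tl0 p : (0 <= (if (L < `|ex p|)%R then ex p ^+ 2 else 0)%:E)%E.
  by case: ifP; rewrite lee_fin ?sqr_ge0.
have B40 : 0 <= 4 * B ^+ 2 by rewrite mulr_ge0// sqr_ge0.
rewrite EFinM; apply: (@le_trans _ _ (\int[P]_p ((4 * B ^+ 2)%:E *
    (if (L < `|ex p|)%R then ex p ^+ 2 else 0)%:E))%E); last first.
  by rewrite ge0_integralZl ?lee_fin// lee_wpmul2l ?lee_fin//; exact: moment_tail.
apply: ge0_le_integral => //.
- by move=> p _; case: ifP; rewrite lee_fin ?sqr_ge0.
- apply/measurable_EFinP/measurable_fun_ifT => //; last exact: measurable_funX.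
  by apply: measurable_fun_ltr => //; exact: measurableT_comp.
- exact: measurable_funeM.
- move=> p _; case: ifPn => h; last by rewrite mule_ge0// lee_fin.
  have := lt_le_trans h (Y_le a p Ga); rewrite ltr_pM2l// ltrD2l => he.
  rewrite he -EFinM lee_fin -(real_normK (num_real (Y a p))) -(real_normK (num_real (ex p))).
  apply: (@le_trans _ _ ((B * (1 + `|ex p|)) ^+ 2)).
    have hY := Y_le a p Ga; have hB := le_trans (normr_ge0 _) hY.
    by rewrite lerXn2r ?nnegrE.
  have x1 : 1 < `|ex p| by exact: le_lt_trans he.
  have hh : (1 + `|ex p|) ^+ 2 <= 4 * `|ex p| ^+ 2 by nra.
  by rewrite exprMn; have := ler_wpM2l (sqr_ge0 B) hh; lra.
Qed.

End standardize.

(** * Studentization *)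

Section sums.
Context {R : realType}.
Implicit Types (n : nat) (a b y q : nat -> R).

Lemma cauchy_schwarz_sum n a b :
  (\sum_(i < n) a i * b i) ^+ 2 <= (\sum_(i < n) a i ^+ 2) * (\sum_(i < n) b i ^+ 2).
Proof.
elim: n => [|n IH]; first by rewrite !big_ord0 expr0n mulr0.
rewrite !big_ord_recr/=.
have X0 : 0 <= \sum_(i < n) a i ^+ 2 by apply: sumr_ge0 => i _; rewrite sqr_ge0.
have Y0 : 0 <= \sum_(i < n) b i ^+ 2 by apply: sumr_ge0 => i _; rewrite sqr_ge0.
move: (\sum_(i < n) a i * b i) (\sum_(i < n) a i ^+ 2) (\sum_(i < n) b i ^+ 2) X0 Y0 IH.
move=> S X Y X0 Y0 IH; move: (a n) (b n) => u v.
(* The arithmetic-geometric mean inequality for [X * v ^+ 2] and [Y * u ^+ 2], squared, with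
   [S ^+ 2 <= X * Y] from the induction. *)
have h : 2 * S * u * v <= X * v ^+ 2 + Y * u ^+ 2.
  have h0 : 0 <= X * v ^+ 2 + Y * u ^+ 2 by rewrite addr_ge0// mulr_ge0// sqr_ge0.
  have [n0|n0] := leP (2 * S * u * v) 0; first exact: le_trans h0.
  rewrite -(@ler_pXn2r _ 2)// ?nnegrE ?(ltW n0)//.
  have := sqr_ge0 (X * v ^+ 2 - Y * u ^+ 2).
  have := ler_wpM2r (mulr_ge0 (sqr_ge0 u) (sqr_ge0 v)) IH.
  by rewrite !expr2; lra.
by rewrite !expr2 in h IH *; lra.
Qed.

(** Location and scale equivariance: [rho] drops out of [tau_D] and is removed from the numerator,
    and [s] cancels. A vanishing denominator is covered, since both sides are then 0 by the
    convention for division. *)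
Lemma T_stat_centered n (s rho : R) y q : (0 < n)%N -> 0 < s ->
  let Rs i := s * (y i + q i) + rho in
  T_stat n Rs - Num.sqrt n%:R * rho / tau_D n Rs =
  ((Num.sqrt n%:R)^-1 * \sum_(i < n) y i + (Num.sqrt n%:R)^-1 * \sum_(i < n) q i) /
  Num.sqrt (n%:R^-1 * \sum_(i < n) (y i + q i) ^+ 2 - (n%:R^-1 * \sum_(i < n) (y i + q i)) ^+ 2).
Proof.
move=> n0 s0 Rs.
have n0R : 0 < n%:R :> R by rewrite ltr0n.
have ns : 0 < Num.sqrt n%:R :> R by rewrite sqrtr_gt0.
have nn : n%:R = Num.sqrt n%:R ^+ 2 :> R by rewrite sqr_sqrtr// ltW.
set Dn := _ - (_ * \sum_(i < n) (y i + q i)) ^+ 2.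
have e1 : \sum_(i < n) Rs i = s * \sum_(i < n) (y i + q i) + n%:R * rho.
  by rewrite big_split/= -mulr_sumr sumr_const card_ord mulr_natl.
have e2 : \sum_(i < n) Rs i ^+ 2 = s ^+ 2 * \sum_(i < n) (y i + q i) ^+ 2
    + 2 * s * rho * \sum_(i < n) (y i + q i) + n%:R * rho ^+ 2.
  transitivity (\sum_(i < n) (s ^+ 2 * (y i + q i) ^+ 2 + 2 * s * rho * (y i + q i) + rho ^+ 2)).
    by apply: eq_bigr => i _; rewrite /Rs; ring.
  rewrite big_split/= sumr_const card_ord -[rho ^+ 2 *+ n]mulr_natl; congr (_ + _).
  by rewrite [LHS]big_split/= -!mulr_sumr.
have tD : tau_D n Rs = s * Num.sqrt Dn.
  rewrite /tau_D e1 e2 (_ : _ - _ = s ^+ 2 * Dn).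
    by rewrite sqrtrM ?sqr_ge0// sqrtr_sqr gtr0_norm.
  by rewrite /Dn; field; rewrite gt_eqF.
rewrite /T_stat /tau_N tD -mulrBl e1 -mulrDr -big_split/=.
have -> : (Num.sqrt n%:R)^-1 * (s * \sum_(i < n) (y i + q i) + n%:R * rho) - Num.sqrt n%:R * rho
   = s * ((Num.sqrt n%:R)^-1 * \sum_(i < n) (y i + q i)).
  by rewrite {2}nn; field; rewrite gt_eqF.
by rewrite -mulf_div divff ?mul1r// gt_eqF.
Qed.

(** The constant is 1 + 4 + 4: the deviation of the squares of [y], twice the cross average
    [(1 + th) * th <= 2 * th] obtained by Cauchy-Schwarz, and the squared mean, at most
    [4 * th ^+ 2]. *)
Lemma empirical_variance_close n (th : R) y q : (0 < n)%N -> 0 < th <= 1 ->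
  `|n%:R^-1 * \sum_(i < n) y i ^+ 2 - 1| <= th ->
  `|n%:R^-1 * \sum_(i < n) y i| <= th ->
  n%:R^-1 * \sum_(i < n) q i ^+ 2 <= th ^+ 2 ->
  `|n%:R^-1 * \sum_(i < n) (y i + q i) ^+ 2
    - (n%:R^-1 * \sum_(i < n) (y i + q i)) ^+ 2 - 1| <= 9 * th.
Proof.
move=> n0 /andP[th0 th1].
have n0R : 0 < n%:R :> R by rewrite ltr0n.
have cs := cauchy_schwarz_sum n y q.
have cq : (\sum_(i < n) q i) ^+ 2 <= (\sum_(i < n) q i ^+ 2) * n%:R.
  have := cauchy_schwarz_sum n q (fun=> 1).
  rewrite (eq_bigr (fun i : 'I_n => q i)); last by move=> i _; rewrite mulr1.
  rewrite [X in _ * X](eq_bigr (fun=> 1)); last by move=> i _; rewrite expr1n.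
  by rewrite sumr_const card_ord.
have e2 : \sum_(i < n) (y i + q i) ^+ 2 =
    \sum_(i < n) y i ^+ 2 + 2 * (\sum_(i < n) y i * q i) + \sum_(i < n) q i ^+ 2.
  by rewrite mulr_sumr -!big_split/=; apply: eq_bigr => i _; ring.
rewrite e2 big_split/=.
have a20 : 0 <= \sum_(i < n) y i ^+ 2 by apply: sumr_ge0 => i _; rewrite sqr_ge0.
have b20 : 0 <= \sum_(i < n) q i ^+ 2 by apply: sumr_ge0 => i _; rewrite sqr_ge0.
move: (\sum_(i < n) y i ^+ 2) (\sum_(i < n) q i ^+ 2) (\sum_(i < n) y i * q i) a20 b20 cs cq.
move: (\sum_(i < n) y i) (\sum_(i < n) q i) => m mq a2 b2 c a20 b20 cs cq h1 h2 h3.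
pose ni : R := n%:R^-1.
have ni0 : 0 < ni by rewrite invr_gt0.
rewrite -/ni in h1 h2 h3 *.
have c1 : (ni * c) ^+ 2 <= (ni * a2) * (ni * b2).
  rewrite (_ : ni * a2 * (ni * b2) = ni ^+ 2 * (a2 * b2)); last by ring.
  by rewrite exprMn ler_wpM2l ?sqr_ge0.
have q1 : (ni * mq) ^+ 2 <= ni * b2.
  rewrite (_ : (ni * mq) ^+ 2 = ni * (ni * mq ^+ 2)); last by ring.
  by rewrite ler_wpM2l ?(ltW ni0)// /ni ler_pdivrMl// mulrC.
have A0 : 0 <= ni * a2 by rewrite mulr_ge0// ltW.
have B0 : 0 <= ni * b2 by rewrite mulr_ge0// ltW.
rewrite !mulrDr (mulrCA ni 2).
move: (ni * a2) (ni * b2) (ni * c) (ni * m) (ni * mq) A0 B0 c1 q1 h1 h2 h3 => {cs cq a20 b20}.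
move=> {}a2 {}b2 {}c {}m {}mq A0 B0 c1 q1 h1 h2 h3.
have hc : `|c| <= (1 + th) * th.
  rewrite -(@ler_pXn2r _ 2)// ?nnegrE; last by nra.
  rewrite (real_normK (num_real c)); apply: (le_trans c1).
  move: h1; rewrite ler_norml => /andP[_ h1]; nra.
have hm : m ^+ 2 <= th ^+ 2.
  by rewrite -(real_normK (num_real m)) lerXn2r ?nnegrE// ltW.
have hmq : (m + mq) ^+ 2 <= 4 * th ^+ 2 by have := sqr_ge0 (m - mq); nra.
have := sqr_ge0 (m + mq).
move: h1 hc hmq; rewrite !ler_norml; move: ((m + mq) ^+ 2) => z.
move=> /andP[h11 h12] /andP[hc1 hc2] hz z0; apply/andP; split; nra.
Qed.

End sums.

Lemma ln1D_abs_le {R : realType} (u : R) : `|u| <= 2^-1 -> `|ln (1 + u)| <= 2 * `|u|.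
Proof.
rewrite ler_norml => /andP[u1 u2]; have p : 0 < 1 + u by lra.
have l1 : ln (1 + u) <= u by apply: le_ln1Dx; lra.
have l2 : ln (1 + u)^-1 <= (1 + u)^-1 - 1.
  rewrite (_ : (1 + u)^-1 = 1 + ((1 + u)^-1 - 1)); last by ring.
  rewrite [X in _ <= X - 1]addrC addrK; apply: le_ln1Dx.
  by have := invr_gt0 (1 + u); rewrite p; lra.
rewrite lnV ?posrE// in l2.
have e : (1 + u)^-1 * (1 + u) = 1 by rewrite mulVf// gt_eqF.
have i0 : 0 < (1 + u)^-1 by rewrite invr_gt0.
have i2 : (1 + u)^-1 <= 2 by nra.
move: (1 + u)^-1 e i0 i2 l2 => i e i0 i2 l2.
have e' : i - 1 = - (i * u) by lra.
have [u0|u0] := leP 0 u.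
  by rewrite (ger0_norm u0) ler_norml; apply/andP; split; nra.
by rewrite (ltr0_norm u0) ler_norml; apply/andP; split; nra.
Qed.

(** The part of the displacement proportional to [|t|] is a dilation [t * (1 + u)], for which
    [gcdf_scale1] is uniform in [t]. It costs 8 * 2 * 9 = 144, the 2 coming from the bound on
    [ln (1 + u)]; the remaining shift by at most [th] costs 1. *)
Lemma gcdf_perturb {R : realType} (t th x : R) : 0 <= th -> 9 * th <= 2^-1 ->
  `|x - t| <= 9 * th * `|t| + th -> `|gcdf x - gcdf t| <= 145 * th.
Proof.
move=> th0 th9 hx.
have key (u : R) : `|u| <= 9 * th -> `|gcdf (t * (1 + u)) - gcdf t| <= 144 * th.
  move=> hu; have hu2 := le_trans hu th9.
  have p : 0 < 1 + u by move: hu2; rewrite ler_norml; lra.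
  have := gcdf_scale1 t (- ln (1 + u)); rewrite opprK lnK ?posrE// normrN => h.
  by have := ln1D_abs_le u hu2; lra.
have s0 : 0 <= 9 * th * `|t| by rewrite mulr_ge0// mulr_ge0.
(* The point [a] is [x] projected onto the interval around [t] that the dilation can reach. *)
have [a [ha hxa]] : exists a, `|a - t| <= 9 * th * `|t| /\ `|x - a| <= th.
  have [h|h] := leP `|x - t| (9 * th * `|t|); first by exists x; rewrite subrr normr0.
  have [xt|xt] := leP t x.
    exists (t + 9 * th * `|t|); rewrite addrC addKr ger0_norm//; split => //.
    by have xt' : 0 <= x - t; [rewrite subr_ge0|move: h hx; rewrite (ger0_norm xt') ler_norml; lra].
  exists (t - 9 * th * `|t|); rewrite addrC addKr normrN ger0_norm//; split => //.
  by have xt' : x - t < 0; [rewrite subr_lt0|move: h hx; rewrite (ltr0_norm xt') ler_norml; lra].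
have g1 := gcdf_shift a (x - a); rewrite (addrC a) subrK in g1.
have g2 : `|gcdf a - gcdf t| <= 144 * th.
  have [t0|t0] := eqVneq t 0.
    move: ha; rewrite t0 normr0 mulr0 subr0 normr_le0 => /eqP ->.
    by rewrite subrr normr0 mulr_ge0.
  have -> : a = t * (1 + (a - t) / t) by field.
  by apply: key; rewrite normrM normfV ler_pdivrMr// normr_gt0.
by move: (le_trans g1 hxa) g2; rewrite !ler_norml; lra.
Qed.

(** The event is [W <= t * sqrt V - E], and [|sqrt V - 1| <= |V - 1|] because [sqrt V + 1] is at
    least 1. *)
Lemma studentized_sandwich {R : realType} (W E V t th : R) :
  0 <= th -> 9 * th <= 2^-1 -> `|V - 1| <= 9 * th -> `|E| <= th ->
  ((W + E) / Num.sqrt V <= t -> W <= t + (9 * th * `|t| + th)) /\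
  (W <= t - (9 * th * `|t| + th) -> (W + E) / Num.sqrt V <= t).
Proof.
move=> th0 th9 hV hE.
have V0 : 0 < V by move: hV; rewrite ler_norml; lra.
have d0 : 0 < Num.sqrt V by rewrite sqrtr_gt0.
have dV : Num.sqrt V ^+ 2 = V by rewrite sqr_sqrtr// ltW.
have hd : `|Num.sqrt V - 1| <= 9 * th.
  move: dV d0; move: (Num.sqrt V) => d dV d0; move: hV; rewrite -dV !ler_norml => /andP[h1 h2].
  have kd : 0 <= th * d by rewrite mulr_ge0// ltW.
  have d1 : 0 < d + 1 by lra.
  apply/andP; split; rewrite leNgt; apply/negP => h.
    by have := ltr_pM2r d1 (d - 1) (- (9 * th)); rewrite h => h3; nra.
  by have := ltr_pM2r d1 (9 * th) (d - 1); rewrite h => h3; nra.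
have htd : `|t * (Num.sqrt V - 1)| <= 9 * th * `|t| by rewrite normrM mulrC ler_wpM2r.
rewrite ler_pdivrMr//; move: htd hE; rewrite !ler_norml mulrBr mulr1 => /andP[a1 a2] /andP[b1 b2].
by split => h; lra.
Qed.

(** * Explicit error bound for one law and one sample size *)

Section one_law.
Context {dO dA dB : measure_display} {Omega : measurableType dO}
  {TA : measurableType dA} {TB : measurableType dB} {R : realType} {dZ : nat}.
Variables (D : nat -> Omega -> pt R dZ) (A : Omega -> TA) (Aux : Omega -> TB).
Variables (Q : probability Omega R) (P : probability (pt R dZ) R).
Hypothesis model : sampling_model Q P D A Aux.
Variables (f g : dZ.-tuple R -> R) (u v : dZ.-tuple R -> \bar R).
Hypothesis fX : cexp_version P xX f.
Hypothesis gY : cexp_version P yY g.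
Hypothesis uE : cexp_version_nneg P (fun p => ((epsP f p) ^+ 2)%:E) u.
Hypothesis vE : cexp_version_nneg P (fun p => ((xiP g p) ^+ 2)%:E) v.
Variables (w : TA -> dZ.-tuple R -> R) (fh gh : TB -> dZ.-tuple R -> R).
Hypothesis mw : measurable_fun setT (fun x : TA * dZ.-tuple R => w x.1 x.2).
Hypothesis mfh : measurable_fun setT (fun x : TB * dZ.-tuple R => fh x.1 x.2).
Hypothesis mgh : measurable_fun setT (fun x : TB * dZ.-tuple R => gh x.1 x.2).
Variables (C eta M c th kap : R) (n : nat).
Hypotheses (C0 : 0 < C) (eta0 : 0 < eta) (c0 : 0 < c) (th0 : 0 < th)
  (th9 : 9 * th <= 2^-1) (kap0 : 0 < kap) (n0 : (0 < n)%N).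
Hypothesis wC : forall a z, `|w a z| <= C.
Hypothesis eM : (\int[P]_p (`|epsP f p * xiP g p| `^ (2 + eta))%:E <= M%:E)%E.

Let rho := rho_bar P f g w.
Let sg2 := sigma2_bar P f g w.
Let Y a p := (epsP f p * xiP g p * w a (zZ p) - rho a) / Num.sqrt (sg2 a).
Let G := [set a | c <= sg2 a].
Let zs om i := zZ (D i om).
Let Rs om i := R_res (fh (Aux om)) (gh (Aux om)) (w (A om)) (D i om).
Let S om := T_stat n (Rs om) - Num.sqrt n%:R * rho (A om) / tau_D n (Rs om).
(** The size allowed to each of the three error terms before division by the standard deviation,
    which is at least [sqrt c] on [G]: together they contribute at most [th], also in mean square
    since [(a + b + d) ^ 2 <= 3 * (a ^ 2 + b ^ 2 + d ^ 2)]. *)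
Let x := Num.sqrt c * th / 3.

(** With [x_i - fh = epsP f + (f - fh)] and the same for [y_i], the product expands into the term
    kept in [Y] and the three terms [t1], [t2], [t3]. *)
Let t1 om i := (f (zs om i) - fh (Aux om) (zs om i)) * w (A om) (zs om i) * xiP g (D i om).
Let t2 om i := (g (zs om i) - gh (Aux om) (zs om i)) * w (A om) (zs om i) * epsP f (D i om).
Let t3 om i := (f (zs om i) - fh (Aux om) (zs om i)) *
  ((g (zs om i) - gh (Aux om) (zs om i)) * w (A om) (zs om i)).
Let sn := (Num.sqrt n%:R)^-1 : R.
Let ni := n%:R^-1 : R.
Let AA om := A_err n f (fh (Aux om)) (zs om) * A_err n g (gh (Aux om)) (zs om) / ni.
Let y om i := Y (A om) (D i om).
Let q om i := (t1 om i + t2 om i + t3 om i) / Num.sqrt (sg2 (A om)).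
Let W om := \sum_(i < n) sn * y om i.

Let n0R : 0 < n%:R :> R. Proof. by rewrite ltr0n. Qed.
Let ni0 : 0 < ni. Proof. by rewrite /ni invr_gt0. Qed.
Let sn0 : 0 < sn. Proof. by rewrite /sn invr_gt0 sqrtr_gt0. Qed.
Let snn : sn ^+ 2 = ni. Proof. by rewrite /sn exprVn sqr_sqrtr// ltW. Qed.
Let sc0 : 0 < Num.sqrt c. Proof. by rewrite sqrtr_gt0. Qed.
Let x0 : 0 < x. Proof. by rewrite /x divr_gt0// mulr_gt0. Qed.

Let Rs_decomp om i : G (A om) ->
  Rs om i = Num.sqrt (sg2 (A om)) * (y om i + q om i) + rho (A om).
Proof.
move=> Ga; have s0 : 0 < Num.sqrt (sg2 (A om)) by rewrite sqrtr_gt0; exact: lt_le_trans Ga.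
rewrite /Rs /R_res /y /Y /q /t1 /t2 /t3 /zs /epsP /xiP; field.
by rewrite gt_eqF.
Qed.

Let S_decomp om : G (A om) -> S om = (W om + sn * \sum_(i < n) q om i) /
  Num.sqrt (ni * \sum_(i < n) (y om i + q om i) ^+ 2 - (ni * \sum_(i < n) (y om i + q om i)) ^+ 2).
Proof.
move=> Ga; have s0 : 0 < Num.sqrt (sg2 (A om)) by rewrite sqrtr_gt0; exact: lt_le_trans Ga.
rewrite /W -mulr_sumr -(T_stat_centered n (Num.sqrt (sg2 (A om))) (rho (A om)) (y om) (q om) n0 s0) /S.
suff -> : Rs om = fun i => Num.sqrt (sg2 (A om)) * (y om i + q om i) + rho (A om) by [].
by apply/funext => i; exact: Rs_decomp.
Qed.

(** [AA] is [n * A_f * A_g], and [C ^+ 2 * AA] controls both quantities: the linear sum by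
    Cauchy-Schwarz, the squares because each [bw i ^+ 2] is at most the whole sum [Sw]. *)
Let t3_bounds om : `|AA om| <= x ^+ 2 / C ^+ 2 ->
  `|sn * \sum_(i < n) t3 om i| <= x /\ ni * \sum_(i < n) t3 om i ^+ 2 <= x ^+ 2.
Proof.
pose a i := f (zs om i) - fh (Aux om) (zs om i).
pose b i := g (zs om i) - gh (Aux om) (zs om i).
pose bw i := b i * w (A om) (zs om i).
pose Sa := \sum_(i < n) a i ^+ 2; pose Sb := \sum_(i < n) b i ^+ 2.
pose Sw := \sum_(i < n) bw i ^+ 2.
have Sa0 : 0 <= Sa by apply: sumr_ge0 => i _; rewrite sqr_ge0.
have Sb0 : 0 <= Sb by apply: sumr_ge0 => i _; rewrite sqr_ge0.
have C2 : 0 < C ^+ 2 by rewrite exprn_gt0.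
have AAE : AA om = ni * (Sa * Sb).
  rewrite /AA /A_err -/Sa -/Sb /ni; field; exact: lt0r_neq0.
rewrite AAE ger0_norm; last by rewrite !mulr_ge0 ?(ltW ni0).
rewrite ler_pdivlMr// => h.
have Swb : Sw <= C ^+ 2 * Sb.
  rewrite /Sb mulr_sumr; apply: ler_sum => i _; rewrite /bw exprMn mulrC ler_wpM2r ?sqr_ge0//.
  by rewrite -(real_normK (num_real (w _ _))) lerXn2r ?nnegrE ?(ltW C0).
have key : ni * (Sa * Sw) <= x ^+ 2.
  apply: le_trans h; rewrite -!mulrA ler_wpM2l ?(ltW ni0)// ler_wpM2l//.
  by rewrite mulrC.
split.
  rewrite -(@ler_pXn2r _ 2)// ?nnegrE ?(ltW x0)// (real_normK (num_real _)).
  rewrite exprMn snn; apply: le_trans key; rewrite ler_wpM2l ?(ltW ni0)//.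
  exact: (cauchy_schwarz_sum n a bw).
apply: le_trans key; rewrite ler_wpM2l ?(ltW ni0)//.
rewrite /Sa mulr_suml; apply: ler_sum => i _; rewrite /t3 -/(a i) exprMn ler_wpM2l ?sqr_ge0//.
rewrite /Sw (bigD1 i)//= -/(bw i) lerDl; apply: sumr_ge0 => j _; exact: sqr_ge0.
Qed.

Let avg_q om : G (A om) -> ni * \sum_(i < n) t1 om i ^+ 2 <= x ^+ 2 ->
  ni * \sum_(i < n) t2 om i ^+ 2 <= x ^+ 2 -> ni * \sum_(i < n) t3 om i ^+ 2 <= x ^+ 2 ->
  ni * \sum_(i < n) q om i ^+ 2 <= th ^+ 2.
Proof.
move=> Ga h1 h2 h3; have s0 : 0 < sg2 (A om) by exact: lt_le_trans Ga.
have qb i : q om i ^+ 2 <= c^-1 * (3 * (t1 om i ^+ 2 + t2 om i ^+ 2 + t3 om i ^+ 2)).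
  rewrite /q exprMn exprVn (sqr_sqrtr (ltW s0)) mulrC.
  have ic : (sg2 (A om))^-1 <= c^-1 by rewrite lef_pV2.
  have is0 : 0 <= (sg2 (A om))^-1 by rewrite invr_ge0 ltW.
  apply: ler_pM => //; first exact: sqr_ge0.
  move: (t1 om i) (t2 om i) (t3 om i) => a b d.
  have := sqr_ge0 (a - b); have := sqr_ge0 (a - d); have := sqr_ge0 (b - d).
  by rewrite !expr2; lra.
apply: (@le_trans _ _ (ni * \sum_(i < n) (c^-1 * (3 * (t1 om i ^+ 2 + t2 om i ^+ 2 + t3 om i ^+ 2))))).
  by rewrite ler_wpM2l ?(ltW ni0)//; apply: ler_sum => i _; exact: qb.
rewrite -mulr_sumr -mulr_sumr !big_split/=.
have cx : c^-1 * (9 * x ^+ 2) = th ^+ 2.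
  rewrite /x expr_div_n exprMn sqr_sqrtr ?(ltW c0)//; field; exact: lt0r_neq0.
rewrite -cx mulrCA ler_wpM2l ?invr_ge0 ?(ltW c0)//.
by rewrite mulrCA !mulrDr; lra.
Qed.

Let avg_E om : G (A om) -> `|sn * \sum_(i < n) t1 om i| <= x ->
  `|sn * \sum_(i < n) t2 om i| <= x -> `|sn * \sum_(i < n) t3 om i| <= x ->
  `|sn * \sum_(i < n) q om i| <= th.
Proof.
move=> Ga h1 h2 h3.
have ss : 0 < Num.sqrt (sg2 (A om)) by rewrite sqrtr_gt0; exact: lt_le_trans Ga.
rewrite /q -mulr_suml !big_split/= mulrA normrM normfV (gtr0_norm ss) ler_pdivrMr//.
apply: (@le_trans _ _ (th * Num.sqrt c)); last by rewrite ler_wpM2l ?(ltW th0)// ler_wsqrtr.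
have -> : th * Num.sqrt c = x + x + x by rewrite /x; field.
rewrite !mulrDr; apply: (le_trans (ler_normD _ _)); apply: lerD => //.
by apply: (le_trans (ler_normD _ _)); exact: lerD.
Qed.

Let E1 := A @^-1` G `&` [set om | (th <= `|ni * \sum_(k < n) y om k ^+ 2 - 1|)%R].
Let E2 := A @^-1` G `&` [set om | (th <= `|ni * \sum_(k < n) y om k|)%R].
Let F1 := [set om | (x <= `|sn * \sum_(k < n) t1 om k|)%R].
Let F2 := [set om | (x <= `|sn * \sum_(k < n) t2 om k|)%R].
Let F3 := [set om | (x ^+ 2 <= ni * \sum_(k < n) t1 om k ^+ 2)%R].
Let F4 := [set om | (x ^+ 2 <= ni * \sum_(k < n) t2 om k ^+ 2)%R].
Let F5 := [set om | (x ^+ 2 / C ^+ 2 < `|AA om|)%R].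
(** [E1], [E2] concern the law of large numbers for [Y]; [F1], [F2] the contribution of the cross
    terms to the numerator, [F3], [F4] their contribution to the empirical variance; [F5] the
    product term, which serves both. *)
Let bad := ~` (A @^-1` G) `|` (E1 `|` (E2 `|` (F1 `|` (F2 `|` (F3 `|` (F4 `|` F5)))))).

Let sandwich om (t : R) : ~ bad om ->
  G (A om) /\
  ((S om <= t)%R -> (W om <= t + (9 * th * `|t| + th))%R) /\
  ((W om <= t - (9 * th * `|t| + th))%R -> (S om <= t)%R).
Proof.
move=> nb.
have Ga : G (A om) by apply: contrapT => h; apply: nb; left.
have h1 : `|ni * \sum_(k < n) y om k ^+ 2 - 1| <= th.
  by rewrite leNgt; apply/negP => /ltW h; apply: nb; right; left.
have h2 : `|ni * \sum_(k < n) y om k| <= th.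
  by rewrite leNgt; apply/negP => /ltW h; apply: nb; do 2 right; left.
have f1 : `|sn * \sum_(k < n) t1 om k| <= x.
  by rewrite leNgt; apply/negP => /ltW h; apply: nb; do 3 right; left.
have f2 : `|sn * \sum_(k < n) t2 om k| <= x.
  by rewrite leNgt; apply/negP => /ltW h; apply: nb; do 4 right; left.
have f3 : ni * \sum_(k < n) t1 om k ^+ 2 <= x ^+ 2.
  by rewrite leNgt; apply/negP => /ltW h; apply: nb; do 5 right; left.
have f4 : ni * \sum_(k < n) t2 om k ^+ 2 <= x ^+ 2.
  by rewrite leNgt; apply/negP => /ltW h; apply: nb; do 6 right; left.
have [f5 f6] : `|sn * \sum_(i < n) t3 om i| <= x /\ ni * \sum_(i < n) t3 om i ^+ 2 <= x ^+ 2.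
  by apply: t3_bounds; rewrite leNgt; apply/negP => h; apply: nb; do 7 right.
have hq := avg_q om Ga f3 f4 f6.
have hE := avg_E om Ga f1 f2 f5.
have th1 : 0 < th <= 1 by rewrite th0; have := th9; lra.
have hV := empirical_variance_close n th (y om) (q om) n0 th1 h1 h2 hq.
rewrite S_decomp//; split => //.
exact: (studentized_sandwich (W om) _ _ t th (ltW th0) th9 hV hE).
Qed.

Let mD i : measurable_fun setT (D i). Proof. by case: model. Qed.
Let mA : measurable_fun setT A. Proof. by case: model. Qed.
Let mAux : measurable_fun setT Aux. Proof. by case: model. Qed.
Let mzZ : measurable_fun setT (@zZ R dZ). Proof. exact: measurable_snd. Qed.
Let mzs i : measurable_fun setT (fun om => zs om i).
Proof. exact: (measurableT_comp mzZ (mD i)). Qed.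
Let mX : measurable_fun setT (@xX R dZ).
Proof. exact: (measurableT_comp measurable_fst measurable_fst). Qed.
Let mYY : measurable_fun setT (@yY R dZ).
Proof. exact: (measurableT_comp measurable_snd measurable_fst). Qed.
Let mf : measurable_fun setT f. Proof. by case: fX. Qed.
Let mg : measurable_fun setT g. Proof. by case: gY. Qed.
Let mwz i : measurable_fun setT (fun om => w (A om) (zs om i)).
Proof. exact: (measurableT_comp mw (measurable_fun_pair mA (mzs i))). Qed.
Let mdf : measurable_fun setT (fun x : TB * dZ.-tuple R => f x.2 - fh x.1 x.2).
Proof. by apply: measurable_funB => //; exact: (measurableT_comp mf). Qed.
Let mdg : measurable_fun setT (fun x : TB * dZ.-tuple R => g x.2 - gh x.1 x.2).
Proof. by apply: measurable_funB => //; exact: (measurableT_comp mg). Qed.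
Let mdfz i : measurable_fun setT (fun om => f (zs om i) - fh (Aux om) (zs om i)).
Proof. exact: (measurableT_comp mdf (measurable_fun_pair mAux (mzs i))). Qed.
Let mdgz i : measurable_fun setT (fun om => g (zs om i) - gh (Aux om) (zs om i)).
Proof. exact: (measurableT_comp mdg (measurable_fun_pair mAux (mzs i))). Qed.
Let meps : measurable_fun setT (epsP f). Proof. by have [] := cexp_residual P xX f mX fX. Qed.
Let mxi : measurable_fun setT (xiP g). Proof. by have [] := cexp_residual P yY g mYY gY. Qed.
Let mt1 i : measurable_fun setT (fun om => t1 om i).
Proof.
by apply: measurable_funM; [exact: measurable_funM|exact: (measurableT_comp mxi (mD i))].
Qed.
Let mt2 i : measurable_fun setT (fun om => t2 om i).
Proof.
by apply: measurable_funM; [exact: measurable_funM|exact: (measurableT_comp meps (mD i))].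
Qed.
Let mYj : measurable_fun setT (fun x : TA * pt R dZ => Y x.1 x.2).
Proof. exact: (measurable_standardized P f g w fX gY mw). Qed.
Let my i : measurable_fun setT (fun om => y om i).
Proof. exact: (measurableT_comp mYj (measurable_fun_pair mA (mD i))). Qed.
Let mrho : measurable_fun setT rho.
Proof. exact: (measurable_rho_bar P f g w fX gY mw). Qed.
Let mG : measurable G.
Proof. exact: (measurable_good P f g w c fX gY mw). Qed.
Let mAG : measurable (A @^-1` G).
Proof. by rewrite -[X in measurable X]setTI; exact: mA. Qed.

Let mle (h1 h2 : Omega -> R) : measurable_fun setT h1 -> measurable_fun setT h2 ->
  measurable [set om | (h1 om <= h2 om)%R].
Proof. by move=> *; rewrite -[X in measurable X]setTI; exact: measurable_fun_le. Qed.

Let mRs i : measurable_fun setT (fun om => Rs om i).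
Proof.
rewrite /Rs /R_res; apply: measurable_funM; last exact: mwz.
apply: measurable_funM; apply: measurable_funB.
- exact: (measurableT_comp mX (mD i)).
- exact: (measurableT_comp mfh (measurable_fun_pair mAux (mzs i))).
- exact: (measurableT_comp mYY (mD i)).
- exact: (measurableT_comp mgh (measurable_fun_pair mAux (mzs i))).
Qed.

Let mS : measurable_fun setT S.
Proof.
have mV : measurable_fun setT (fun om => (tau_D n (Rs om))^-1).
  apply: (measurableT_comp measurable_inv_sqrt); apply: measurable_funB.
    apply: measurable_funM => //; apply: measurable_sum => i.
    by apply: measurable_funX; exact: mRs.
  apply: measurable_funX; apply: measurable_funM => //; apply: measurable_sum => i.
  exact: mRs.
apply: measurable_funB; apply: measurable_funM => //.
  by apply: measurable_funM => //; apply: measurable_sum => i; exact: mRs.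
by apply: measurable_funM => //; exact: (measurableT_comp mrho).
Qed.

Let mW : measurable_fun setT W.
Proof. by apply: measurable_sum => i; apply: measurable_funM. Qed.

Let mE1 : measurable E1.
Proof.
apply: measurableI => //; apply: mle => //; apply: measurableT_comp => //.
apply: measurable_funB => //; apply: measurable_funM => //.
by apply: measurable_sum => i; exact: measurable_funX.
Qed.

Let mE2 : measurable E2.
Proof.
apply: measurableI => //; apply: mle => //; apply: measurableT_comp => //.
by apply: measurable_funM => //; exact: measurable_sum.
Qed.

Let mF1 : measurable F1.
Proof.
apply: mle => //; apply: measurableT_comp => //.
by apply: measurable_funM => //; exact: measurable_sum.
Qed.

Let mF2 : measurable F2.
Proof.
apply: mle => //; apply: measurableT_comp => //.
by apply: measurable_funM => //; exact: measurable_sum.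
Qed.

Let mF3 : measurable F3.
Proof.
apply: mle => //; apply: measurable_funM => //.
by apply: measurable_sum => i; exact: measurable_funX.
Qed.

Let mF4 : measurable F4.
Proof.
apply: mle => //; apply: measurable_funM => //.
by apply: measurable_sum => i; exact: measurable_funX.
Qed.

Let mAA : measurable_fun setT AA.
Proof.
apply: measurable_funM => //; apply: measurable_funM; apply: measurable_funM => //;
by apply: measurable_sum => i; exact: measurable_funX.
Qed.

Let mF5 : measurable F5.
Proof.
rewrite (_ : F5 = ~` [set om | (`|AA om| <= x ^+ 2 / C ^+ 2)%R]); last first.
  by apply/seteqP; split => om /=; rewrite /F5/= ltNge => /negP.
by apply: measurableC; apply: mle => //; exact: measurableT_comp.
Qed.

Let mUle (E F : set Omega) (a b : R) : measurable E -> measurable F ->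
  (Q E <= a%:E)%E -> (Q F <= b%:E)%E -> (Q (E `|` F) <= (a + b)%:E)%E.
Proof.
move=> mE mF ha hb; rewrite EFinD; apply: (@le_trans _ _ (Q E + Q F)%E); last exact: leeD.
exact: measureU2.
Qed.

Variables (bG b5 bf bg L1 s k K e : R).
Hypothesis hG : (Q (~` (A @^-1` G)) <= bG%:E)%E.
Hypothesis h5 : (Q F5 <= b5%:E)%E.
Hypothesis hf : (Q [set om | kap%:E < `|B_err n f (fh (Aux om)) v (zs om)|] <= bf%:E)%E.
Hypothesis hg : (Q [set om | kap%:E < `|B_err n g (gh (Aux om)) u (zs om)|] <= bg%:E)%E.

Let B := C * (2 + M) / Num.sqrt c.
Let L := B * (1 + L1).
Let b := 4 * B ^+ 2 * (M / L1 `^ eta).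
Hypotheses (L11 : 1 <= L1) (bth : b <= th / 3) (s0 : 0 < s) (k0 : 0 <= k).
Hypothesis Lk : L <= k * Num.sqrt (s * n%:R).
Hypotheses (K0 : 0 < K) (e0 : 0 <= e) (Kl : gcdf (- K) <= e) (Ku : 1 - e <= gcdf K).

Let Y1 a : G a -> (\int[P]_p (Y a p)%:E = 0)%E.
Proof. exact: (standardized_mean P f g w C eta M c fX gY mw wC eta0 C0 eM). Qed.

Let Y2 a : G a -> (\int[P]_p (Y a p ^+ 2)%:E = 1)%E.
Proof. exact: (standardized_var P f g w c fX gY mw c0). Qed.

Let Ytail a : G a -> (\int[P]_p (if (L < `|Y a p|)%R then Y a p ^+ 2 else 0)%:E <= b%:E)%E.
Proof.
by move=> Ga; exact: (standardized_tail P f g w C eta M c fX gY mw wC eta0 c0 C0 eM a L1 Ga L11).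
Qed.

(** One tail bound serves twice: at level [L] for the law of large numbers and, as
    [L <= k * sqrt (s * n)] for large [n], at the Lindeberg threshold. *)
Let Ytail' a : G a ->
  (\int[P]_p (if (k * Num.sqrt (s * n%:R) < `|Y a p|)%R then Y a p ^+ 2 else 0)%:E <= b%:E)%E.
Proof.
move=> Ga; apply: le_trans (Ytail a Ga).
have mYa : measurable_fun setT (Y a) by exact: (measurable_fun_pair2 a mYj).
have mtl l : measurable_fun setT (fun p => (if l < `|Y a p| then Y a p ^+ 2 else 0)%:E).
  apply/measurable_EFinP/measurable_fun_ifT => //; last exact: measurable_funX.
  by apply: measurable_fun_ltr => //; exact: measurableT_comp.
apply: ge0_le_integral => //.
- by move=> p _; case: ifP; rewrite lee_fin ?sqr_ge0.
- move=> p _; case: ifPn => h; first by rewrite (le_lt_trans Lk h).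
  by case: ifP; rewrite lee_fin ?sqr_ge0.
Qed.

Let M0 : 0 <= M.
Proof. by rewrite -lee_fin; apply: le_trans eM; apply: integral_ge0 => p _; rewrite lee_fin powR_ge0. Qed.

Let b0 : 0 <= b.
Proof. by apply: mulr_ge0; [apply: mulr_ge0 => //; exact: sqr_ge0 | apply: divr_ge0 => //; exact: powR_ge0]. Qed.

Let L0 : 0 <= L.
Proof.
rewrite /L /B mulr_ge0//; last by have := L11; lra.
by rewrite divr_ge0 ?sqrtr_ge0// mulr_ge0 ?(ltW C0)// addr_ge0.
Qed.

Let hf' : (Q [set om | kap%:E < B_err n f (fh (Aux om)) v (zs om)] <= bf%:E)%E.
Proof.
have [_ v0 _] := vE.
rewrite (_ : [set om | _] = [set om | (kap%:E < `|B_err n f (fh (Aux om)) v (zs om)|)%E])//.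
apply/seteqP; split => om /=; rewrite gee0_abs// /B_err mule_ge0 ?lee_fin ?invr_ge0//;
by apply: sume_ge0 => i _; rewrite mule_ge0// lee_fin sqr_ge0.
Qed.

Let hg' : (Q [set om | kap%:E < B_err n g (gh (Aux om)) u (zs om)] <= bg%:E)%E.
Proof.
have [_ u0 _] := uE.
rewrite (_ : [set om | _] = [set om | (kap%:E < `|B_err n g (gh (Aux om)) u (zs om)|)%E])//.
apply/seteqP; split => om /=; rewrite gee0_abs// /B_err mule_ge0 ?lee_fin ?invr_ge0//;
by apply: sume_ge0 => i _; rewrite mule_ge0// lee_fin sqr_ge0.
Qed.

Let cr := C ^+ 2 * kap / x ^+ 2.

Let hF1 : (Q F1 <= (bf + cr)%:E)%E.
Proof.
have [mr ir r0] := cexp_residual P yY g mYY gY.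
have := cross_linear D A Aux Q P model (xiP g) v mr ir r0 vE
  (fun b z => f z - fh b z) w C mdf mw wC n kap n0 kap0 x x0.
by move=> h; apply: (le_trans h); rewrite EFinD leeD2r//; exact: hf'.
Qed.

Let hF3 : (Q F3 <= (bf + cr)%:E)%E.
Proof.
have [mr ir r0] := cexp_residual P yY g mYY gY.
have x20 : 0 < x ^+ 2 by rewrite exprn_gt0.
have := cross_square D A Aux Q P model (xiP g) v mr vE
  (fun b z => f z - fh b z) w C mdf mw wC n kap n0 kap0 (x ^+ 2) x20.
by move=> h; apply: (le_trans h); rewrite EFinD leeD2r//; exact: hf'.
Qed.

Let hF2 : (Q F2 <= (bg + cr)%:E)%E.
Proof.
have [mr ir r0] := cexp_residual P xX f mX fX.
have := cross_linear D A Aux Q P model (epsP f) u mr ir r0 uE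
  (fun b z => g z - gh b z) w C mdg mw wC n kap n0 kap0 x x0.
by move=> h; apply: (le_trans h); rewrite EFinD leeD2r//; exact: hg'.
Qed.

Let hF4 : (Q F4 <= (bg + cr)%:E)%E.
Proof.
have [mr ir r0] := cexp_residual P xX f mX fX.
have x20 : 0 < x ^+ 2 by rewrite exprn_gt0.
have := cross_square D A Aux Q P model (epsP f) u mr uE
  (fun b z => g z - gh b z) w C mdg mw wC n kap n0 kap0 (x ^+ 2) x20.
by move=> h; apply: (le_trans h); rewrite EFinD leeD2r//; exact: hg'.
Qed.

Let l1 := L ^+ 4 / (n%:R * (th / 3) ^+ 2) + b / (th / 3).
Let l2 := 1 / (n%:R * th ^+ 2).

Let hE1 : (Q E1 <= l1%:E)%E.
Proof.
have b0th : 0 <= b <= th / 3 by rewrite b0.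
exact: (lln_square D A Aux Q P model G Y mG mYj Y2 n th L b n0 th0 L0 b0th Ytail).
Qed.

Let hE2 : (Q E2 <= l2%:E)%E.
Proof. exact: (lln_linear D A Aux Q P model G Y mG mYj Y1 Y2 n th n0 th0). Qed.

Let badb := bG + (l1 + (l2 + ((bf + cr) + ((bg + cr) + ((bf + cr) + ((bg + cr) + b5)))))).

Let mbad : measurable bad.
Proof. by rewrite /bad; do ![apply: measurableU => //]; exact: measurableC. Qed.

Let hbad : (Q bad <= badb%:E)%E.
Proof.
rewrite /bad /badb; apply: mUle => //; first exact: measurableC.
  by do ![apply: measurableU => //].
apply: mUle => //; first by do ![apply: measurableU => //].
apply: mUle => //; first by do ![apply: measurableU => //].
apply: mUle => //; first by do ![apply: measurableU => //].
apply: mUle => //; first by do ![apply: measurableU => //].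
apply: mUle => //; first by do ![apply: measurableU => //].
exact: mUle.
Qed.

Let bnd := K * Num.sqrt s + 4 * s + 12 * (k + b) / s + 8 / (n%:R * s ^+ 2) + e.

(** Off [bad] the event for [S] lies between those for [W] at [t - dl] and [t + dl]. Although [dl]
    grows with [|t|], [gcdf_perturb] brings both thresholds back to [t] at cost [145 * th]. The term
    [bG] appears again besides [badb] because [clt_cdf_lb] loses the complement of [G]. *)
Lemma studentized_cdf_bound (t : R) :
  (`|Q [set om | (S om <= t)%R] - Phi t| <= (145 * th + bnd + badb + bG)%:E)%E.
Proof.
pose dl := 9 * th * `|t| + th.
have dl0 : 0 <= dl by rewrite /dl addr_ge0 ?mulr_ge0 ?(ltW th0).
have mSt : measurable [set om | (S om <= t)%R] by exact: mle.
have mWt r : measurable [set om | (W om <= r)%R] by exact: mle.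
have bG0 : 0 <= bG by rewrite -lee_fin; apply: le_trans hG; exact: measure_ge0.
have ub : (Q [set om | (S om <= t)%R] <= (gcdf (t + dl) + bnd + badb)%:E)%E.
  apply: (@le_trans _ _ (Q (A @^-1` G `&` [set om | (W om <= t + dl)%R]) + Q bad)%E).
    apply: measure_subU2 => //; first exact: measurableI.
    move=> om /= hS; have [|nb] := pselect (bad om); first by right.
    by left; have [Ga [h _]] := sandwich om t nb; split => //; exact: h.
  rewrite EFinD; apply: leeD => //.
  exact: (clt_cdf_ub D A Aux Q P model G Y mG mYj Y1 Y2 n s k b K e n0 s0 k0 b0 Ytail' K0 e0 Ku (t + dl)).
have lb : ((gcdf (t - dl))%:E <= Q [set om | (S om <= t)%R] + (badb + bG + bnd)%:E)%E.
  have h := clt_cdf_lb D A Aux Q P model G Y mG mYj Y1 Y2 n s k b K e n0 s0 k0 b0 Ytail' K0 e0 Kl (t - dl).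
  apply: (le_trans h); rewrite [(badb + bG + bnd)%:E]EFinD addeA leeD2r//.
  rewrite EFinD addeA; apply: leeD => //.
  apply: (@le_trans _ _ (Q [set om | (S om <= t)%R] + Q bad)%E); last by rewrite leeD2l.
  apply: measure_subU2 => //; first exact: measurableI.
  move=> om [Ga /= hW]; have [|nb] := pselect (bad om); first by right.
  by left; have [_ [_ h']] := sandwich om t nb; exact: h'.
have p1 := gcdf_perturb t th (t + dl) (ltW th0) th9.
have p2 := gcdf_perturb t th (t - dl) (ltW th0) th9.
have q1 : `|t + dl - t| <= 9 * th * `|t| + th by rewrite addrC addKr ger0_norm.
have q2 : `|t - dl - t| <= 9 * th * `|t| + th by rewrite addrC addKr normrN ger0_norm.
have {}p1 := p1 q1; have {}p2 := p2 q2.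
have : Q [set om | (S om <= t)%R] \is a fin_num by exact: fin_num_measure.
move: ub lb; case: (Q [set om | (S om <= t)%R]) => [z| |]// ub lb _.
rewrite PhiE -EFinN -EFinD lee_fin.
move: ub lb p1 p2; rewrite !lee_fin !ler_norml => ub lb /andP[a1 a2] /andP[b1 b2].
by apply/andP; split; lra.
Qed.

End one_law.

(** * Uniformity over the family *)

Lemma exists_moment_level {R : realType} (eta B M beta : R) :
  0 < eta -> 0 <= M -> 0 < beta ->
  exists2 L, 1 <= L & 4 * B ^+ 2 * (M / L `^ eta) <= beta.
Proof.
move=> eta0 M0 beta0; pose y := 4 * B ^+ 2 * M / beta.
have y0 : 0 <= y.
  by apply: divr_ge0 (ltW beta0); do 2 apply: mulr_ge0 => //; exact: sqr_ge0.
have y1 : 0 < 1 + y by lra.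
(* Solves [L ^ eta = 1 + y]; the added 1 ensures [1 <= L]. *)
exists ((1 + y) `^ eta^-1).
  have := @ge0_ler_powR R eta^-1; rewrite invr_ge0 (ltW eta0) => /(_ isT 1 (1 + y)).
  by rewrite powR1; apply; rewrite ?nnegrE; lra.
rewrite -powRrM mulVf ?gt_eqF// powRr1 ?(ltW y1)//.
have yE : beta * y = 4 * B ^+ 2 * M by rewrite /y mulrC divfK ?gt_eqF.
by rewrite mulrA ler_pdivrMr// mulrDr mulr1 yE lerDr ltW.
Qed.

Section family.
Context {dO dA dB : measure_display} {Omega : measurableType dO}
  {TA : measurableType dA} {TB : measurableType dB} {R : realType} {dZ : nat}.
Variables (Q : probability (pt R dZ) R -> probability Omega R)
  (D : nat -> Omega -> pt R dZ) (A : Omega -> TA) (Aux : Omega -> TB)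
  (w : nat -> TA -> dZ.-tuple R -> R) (fh gh : nat -> TB -> dZ.-tuple R -> R).
Hypothesis mw : forall n, measurable_fun setT (fun az : TA * dZ.-tuple R => w n az.1 az.2).
Hypothesis mfh : forall n, measurable_fun setT (fun bz : TB * dZ.-tuple R => fh n bz.1 bz.2).
Hypothesis mgh : forall n, measurable_fun setT (fun bz : TB * dZ.-tuple R => gh n bz.1 bz.2).
Variable C : R.
Hypotheses (C0 : 0 < C) (wC : forall n a z, `|w n a z| <= C).

Let Rs n om i := R_res (fh n (Aux om)) (gh n (Aux om)) (w n (A om)) (D i om).
Let zs om i := zZ (D i om).
Let S P f g n om := T_stat n (Rs n om)
      - Num.sqrt n%:R * rho_bar P f g (w n) (A om) / tau_D n (Rs n om).

Variables (Pfam : set (probability (pt R dZ) R))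
  (f g : probability (pt R dZ) R -> dZ.-tuple R -> R)
  (u v : probability (pt R dZ) R -> dZ.-tuple R -> \bar R).
Hypothesis model : forall P, Pfam P -> sampling_model (Q P) P D A Aux.
Hypothesis fX : forall P, Pfam P -> cexp_version P xX (f P).
Hypothesis gY : forall P, Pfam P -> cexp_version P yY (g P).
Hypothesis uE : forall P, Pfam P ->
  cexp_version_nneg P (fun p => ((epsP (f P) p) ^+ 2)%:E) (u P).
Hypothesis vE : forall P, Pfam P ->
  cexp_version_nneg P (fun p => ((xiP (g P) p) ^+ 2)%:E) (v P).
Hypothesis AAo : little_oP Pfam Q
  (fun P n om => A_err n (f P) (fh n (Aux om)) (zs om) * A_err n (g P) (gh n (Aux om)) (zs om))
  (fun n => n%:R^-1).
Hypothesis Bfo : little_oP1_ext Pfam Q (fun P n om => B_err n (f P) (fh n (Aux om)) (v P) (zs om)).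
Hypothesis Bgo : little_oP1_ext Pfam Q (fun P n om => B_err n (g P) (gh n (Aux om)) (u P) (zs om)).
Variables (eta M : R).
Hypotheses (eta0 : 0 < eta) (M0 : 0 <= M).
Hypothesis eM : forall P, Pfam P ->
  (\int[P]_p (`|epsP (f P) p * xiP (g P) p| `^ (2 + eta))%:E <= M%:E)%E.
Hypothesis sigma_low : forall e : R, 0 < e -> exists2 c : R, 0 < c & forall n P, Pfam P ->
  (Q P (~` (A @^-1` [set a | (c <= sigma2_bar P (f P) (g P) (w n) a)%R])) <= e%:E)%E.

(** The order of choices matters: [th] and [c] fix [x] and [kap]; then [K] and the smoothing [s];
    then [k] and the tail level [L1], which must be small relative to [s]; last the sample size. *)
Lemma uniform_studentized_clt (e : R) : 0 < e -> exists N : nat, forall n, (N <= n)%N ->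
  forall P, Pfam P -> forall t : R,
  (`| Q P [set om | (S P (f P) (g P) n om <= t)%R] - Phi t | <= e%:E)%E.
Proof.
move=> e0.
(* The contributions below add up to [20 * e']; 40 leaves slack. *)
pose e' := e / 40; have e'0 : 0 < e' by rewrite divr_gt0.
pose th := Num.min (18^-1) (e' / 145 : R).
have th0 : 0 < th by rewrite lt_min invr_gt0 ltr0n divr_gt0.
have th18 : th <= 18^-1 by rewrite ge_min lexx.
have th9 : 9 * th <= 2^-1 by lra.
have the : th <= e' / 145 by rewrite ge_min lexx orbT.
have [c c0 hc] := sigma_low _ e'0.
pose x := Num.sqrt c * th / 3.
have x0 : 0 < x by rewrite /x divr_gt0// mulr_gt0// sqrtr_gt0.
have C2 : 0 < C ^+ 2 by rewrite exprn_gt0.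
have x2 : 0 < x ^+ 2 by rewrite exprn_gt0.
pose kap := e' * x ^+ 2 / C ^+ 2.
have kap0 : 0 < kap by rewrite /kap divr_gt0// mulr_gt0.
have crE : C ^+ 2 * kap / x ^+ 2 = e'.
  by rewrite /kap; field; rewrite !gt_eqF.
have [K K0 [Kl Ku]] := gcdf_tails e' e'0.
(* [r] is the square root of the smoothing parameter; with [r <= 1] the requirement
   [K * sqrt s + 4 * s <= e'] follows from [(K + 4) * r <= e']. *)
pose r := Num.min 1 (e' / (K + 4)).
have K4 : 0 < K + 4 by lra.
have r0 : 0 < r by rewrite lt_min ltr01 divr_gt0.
have r1 : r <= 1 by rewrite ge_min lexx.
have rK : (K + 4) * r <= e'.
  by rewrite mulrC -ler_pdivlMr// ge_min lexx orbT.
pose s := r ^+ 2; have s0 : 0 < s by rewrite exprn_gt0.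
have sr : Num.sqrt s = r by rewrite sqrtr_sqr gtr0_norm.
have hKs : K * Num.sqrt s + 4 * s <= e'.
  have rr : r ^+ 2 <= r by rewrite expr2 ler_piMr// ltW.
  by rewrite sr /s; apply: le_trans rK; lra.
pose k := e' * s / 12; have k0 : 0 < k by rewrite divr_gt0// mulr_gt0.
(* Three demands on the tail mass [b]: the Lindeberg error [12 * b / s], the condition [b <= th / 3]
   of [lln_square], and the Markov term [b / (th / 3)]. *)
pose beta := Num.min (e' * s / 12) (Num.min (th / 3) (e' * (th / 3))).
have th3 : 0 < th / 3 by rewrite divr_gt0.
have beta0 : 0 < beta by rewrite !lt_min k0 th3 mulr_gt0.
pose B := C * (2 + M) / Num.sqrt c.
have [L1 L11 hL1] := exists_moment_level eta B M beta eta0 M0 beta0.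
pose b := 4 * B ^+ 2 * (M / L1 `^ eta).
have b1 : b <= e' * s / 12 by apply: (le_trans hL1); rewrite ge_min lexx.
have b2 : b <= th / 3 by apply: (le_trans hL1); rewrite !ge_min lexx !orbT.
have b3 : b / (th / 3) <= e'.
  by rewrite ler_pdivrMr//; apply: (le_trans hL1); rewrite !ge_min lexx !orbT.
pose L := B * (1 + L1).
(* [A1] to [A4] are the sample sizes required by the Lindeberg threshold, the quadratic replacement
   error and the two laws of large numbers. All are nonnegative, so exceeding their sum suffices. *)
pose A1 := (L / k) ^+ 2 / s.
pose A2 := 8 / s ^+ 2 / e'.
pose A3 := L ^+ 4 / (th / 3) ^+ 2 / e'.
pose A4 := 1 / th ^+ 2 / e'.
have A10 : 0 <= A1 by rewrite divr_ge0 ?sqr_ge0 ?(ltW s0).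
have A20 : 0 <= A2 by rewrite divr_ge0 ?(ltW e'0)// divr_ge0 ?sqr_ge0.
have A30 : 0 <= A3.
  by rewrite divr_ge0 ?(ltW e'0)// divr_ge0 ?sqr_ge0// (_ : L ^+ 4 = (L ^+ 2) ^+ 2) ?sqr_ge0 -?exprM.
have A40 : 0 <= A4 by rewrite divr_ge0 ?(ltW e'0)// divr_ge0 ?sqr_ge0.
have xC : 0 < x ^+ 2 / C ^+ 2 by rewrite divr_gt0.
have [N1 hN1] := AAo _ xC _ e'0.
have [N2 hN2] := Bfo _ kap0 _ e'0.
have [N3 hN3] := Bgo _ kap0 _ e'0.
pose N0 := Num.bound (A1 + A2 + A3 + A4).
exists (maxn 1 (maxn N0 (maxn N1 (maxn N2 N3)))) => n.
rewrite !geq_max => /and5P[n0 nN0 nN1 nN2 nN3] P PP t.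
have n0R : 0 < n%:R :> R by rewrite ltr0n.
have nA : A1 + A2 + A3 + A4 <= n%:R.
  apply: (@le_trans _ _ N0%:R); last by rewrite ler_nat.
  by apply: ltW; apply: archi_boundP; rewrite !addr_ge0.
have Lk : L <= k * Num.sqrt (s * n%:R).
  rewrite (mulrC k) -ler_pdivrMr//; apply: (le_trans (ler_norm _)).
  rewrite -sqrtr_sqr ler_wsqrtr// (mulrC s) -ler_pdivrMr//.
  by rewrite -/A1; lra.
have shift (a d : R) : a / d / e' <= n%:R -> a / (n%:R * d) <= e'.
  rewrite ler_pdivrMr// => h; rewrite invfM mulrA mulrAC ler_pdivrMr//.
  by rewrite (mulrC e').
have h2 : 8 / (n%:R * s ^+ 2) <= e' by apply: shift; rewrite -/A2; lra.
have h3 : L ^+ 4 / (n%:R * (th / 3) ^+ 2) <= e' by apply: shift; rewrite -/A3; lra.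
have h4 : 1 / (n%:R * th ^+ 2) <= e' by apply: shift; rewrite -/A4; lra.
have Q1 := hN1 n nN1 P PP.
have Q2 := hN2 n nN2 P PP.
have Q3 := hN3 n nN3 P PP.
have QG := hc n P PP.
have bound := studentized_cdf_bound D A Aux (Q P) P (model P PP) (f P) (g P) (u P) (v P)
  (fX P PP) (gY P PP) (uE P PP) (vE P PP) (w n) (fh n) (gh n) (mw n) (mfh n) (mgh n)
  C eta M c th kap n C0 eta0 c0 th0 th9 kap0 n0 (wC n) (eM P PP)
  e' e' e' e' L1 s k K e' QG Q1 Q2 Q3 L11 b2 s0 (ltW k0) Lk K0 (ltW e'0) Kl Ku t.
apply: (le_trans bound); rewrite lee_fin -/x crE -/B -/b -/L.
have hk : 12 * (k + b) / s <= 2 * e'.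
  by rewrite ler_pdivrMr// /k; lra.
have ee : e = 40 * e' by rewrite /e'; field.
lra.
Qed.

End family.

Lemma ae_forall_le {d} {T : measurableType d} {R : realType} (Q : probability T R)
    (E : set T) (Pr : T -> Prop) (e : R) : measurable E -> 0 <= e ->
  {ae Q, forall om, Pr om} -> (forall om, Pr om -> ~ E om) -> (Q E <= e%:E)%E.
Proof.
move=> mE e0 [N [mN QN sN]] PE.
apply: (@le_trans _ _ (Q N)); last by rewrite QN lee_fin.
apply: le_measure; rewrite ?inE// => om Eom; apply: sN => /= h.
exact: (PE om h).
Qed.

(** The events that some [sg n] falls below [1 / (m + 1)] decrease in [m] to a null event.
    Continuity from above makes one of them have probability at most [e], which turns a random lower
    bound into a deterministic one. *)
Lemma ae_uniform_low {d} {T : measurableType d} {R : realType} (Q : probability T R)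
    (sg : nat -> T -> R) (e : R) :
  (forall n, measurable_fun setT (sg n)) ->
  {ae Q, forall om, exists c : R, 0 < c /\ forall n, c <= sg n om} -> 0 < e ->
  exists2 c : R, 0 < c & forall n, (Q (~` [set om | (c <= sg n om)%R]) <= e%:E)%E.
Proof.
move=> msg ae e0.
pose E m := \bigcup_n ~` [set om | (m.+1%:R^-1 <= sg n om)%R].
have mlow c n : measurable (~` [set om | (c <= sg n om)%R]).
  by apply: measurableC; rewrite -[X in measurable X]setTI; exact: measurable_fun_le.
have mE m : measurable (E m) by apply: bigcup_measurable => n _; exact: mlow.
have mI : measurable (\bigcap_m E m) by apply: bigcap_measurable.
have I0 : Q (\bigcap_m E m) = 0%E.
  apply/eqP; rewrite eq_le measure_ge0 andbT.
  apply: (ae_forall_le Q _ _ 0 mI (lexx _) ae) => om [c [c0 hc]] hI.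
  have [m _ hm] := hI (Num.bound c^-1) I.
  apply: hm => /=; apply: le_trans (hc m).
  rewrite invf_ple ?posrE//.
  apply: ltW; apply: (lt_trans (archi_boundP _)); first by rewrite invr_ge0 ltW.
  by rewrite ltr_nat.
have Efin : (Q (E 0%N) < +oo)%E by rewrite (le_lt_trans (probability_le1 _ _)) ?ltry.
have Edec : {homo E : n m / (n <= m)%N >-> (m <= n)%O}.
  move=> a b ab; apply/subsetPset => om [n _ /= hn]; exists n => //= h; apply: hn.
  by apply: le_trans h; rewrite lef_pV2 ?posrE ?ltr0n// ler_nat.
have cv : Q (E m) @[m --> \oo] --> 0%E.
  by rewrite -I0; exact: nonincreasing_cvg_mu.
have /fine_cvgP[_ /cvgrPdist_le /(_ _ e0)[m _ /(_ m (leqnn m))]] := cv.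
rewrite /= sub0r normrN ger0_norm ?fine_ge0// => hm.
exists m.+1%:R^-1; first by rewrite invr_gt0 ltr0n.
move=> n; apply: (@le_trans _ _ (Q (E m))).
  by apply: le_measure; rewrite ?inE// => om h; exists n.
by rewrite -(fineK (fin_num_measure Q _ (mE m))) lee_fin.
Qed.

(** Both parts are instances of [uniform_studentized_clt]; they differ in how the lower bound on the
    variance is obtained, by [ae_uniform_low] in the first and with a single [c] in the second. *)
Theorem theorem4 (R : realType) (dZ : nat) (dO dA dB : measure_display)
  (Omega : measurableType dO) (TA : measurableType dA) (TB : measurableType dB)
  (Q : probability (pt R dZ) R -> probability Omega R)
  (D : nat -> Omega -> pt R dZ) (A : Omega -> TA) (Aux : Omega -> TB)
  (w : nat -> TA -> dZ.-tuple R -> R) (fh gh : nat -> TB -> dZ.-tuple R -> R) :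
  (forall n, measurable_fun setT (fun az : TA * dZ.-tuple R => w n az.1 az.2)) ->
  (forall n, measurable_fun setT (fun bz : TB * dZ.-tuple R => fh n bz.1 bz.2)) ->
  (forall n, measurable_fun setT (fun bz : TB * dZ.-tuple R => gh n bz.1 bz.2)) ->
  (exists C : R, 0 < C /\ forall n a z, `|w n a z| <= C) ->
  let Rs n om i := R_res (fh n (Aux om)) (gh n (Aux om)) (w n (A om)) (D i om) in
  let zs om i := zZ (D i om) in
  let S P f g n om := T_stat n (Rs n om)
      - Num.sqrt n%:R * rho_bar P f g (w n) (A om) / tau_D n (Rs n om) in
  (* Part 1 *)
  (forall (P : probability (pt R dZ) R) (f g : dZ.-tuple R -> R)
          (u v : dZ.-tuple R -> \bar R),
    in_E0 P ->
    sampling_model (Q P) P D A Aux ->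
    cexp_version P xX f -> cexp_version P yY g ->
    cexp_version_nneg P (fun p => ((epsP f p) ^+ 2)%:E) u ->
    cexp_version_nneg P (fun p => ((xiP g p) ^+ 2)%:E) v ->
    little_oP [set P] Q
      (fun _ n om => A_err n f (fh n (Aux om)) (zs om) * A_err n g (gh n (Aux om)) (zs om))
      (fun n => n%:R^-1) ->
    little_oP1_ext [set P] Q (fun _ n om => B_err n f (fh n (Aux om)) v (zs om)) ->
    little_oP1_ext [set P] Q (fun _ n om => B_err n g (gh n (Aux om)) u (zs om)) ->
    (exists eta : R, 0 < eta /\
       (\int[P]_p ((`|epsP f p * xiP g p| `^ (2 + eta))%:E) < +oo)%E) ->
    {ae Q P, forall om, exists c : R, 0 < c /\
       forall n, c <= sigma2_bar P f g (w n) (A om)} ->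
    forall e : R, 0 < e -> exists N : nat, forall n, (N <= n)%N -> forall t : R,
      (`| Q P [set om | (S P f g n om <= t)%R] - Phi t | <= e%:E)%E)
  /\
  (* Part 2 *)
  (forall (Pfam : set (probability (pt R dZ) R))
          (f g : probability (pt R dZ) R -> dZ.-tuple R -> R)
          (u v : probability (pt R dZ) R -> dZ.-tuple R -> \bar R),
    Pfam `<=` in_E0 ->
    (forall P, Pfam P -> sampling_model (Q P) P D A Aux) ->
    (forall P, Pfam P -> cexp_version P xX (f P)) ->
    (forall P, Pfam P -> cexp_version P yY (g P)) ->
    (forall P, Pfam P -> cexp_version_nneg P (fun p => ((epsP (f P) p) ^+ 2)%:E) (u P)) ->
    (forall P, Pfam P -> cexp_version_nneg P (fun p => ((xiP (g P) p) ^+ 2)%:E) (v P)) ->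
    little_oP Pfam Q
      (fun P n om => A_err n (f P) (fh n (Aux om)) (zs om)
                     * A_err n (g P) (gh n (Aux om)) (zs om))
      (fun n => n%:R^-1) ->
    little_oP1_ext Pfam Q (fun P n om => B_err n (f P) (fh n (Aux om)) (v P) (zs om)) ->
    little_oP1_ext Pfam Q (fun P n om => B_err n (g P) (gh n (Aux om)) (u P) (zs om)) ->
    (exists eta : R, 0 < eta /\
       (ereal_sup [set \int[P]_p ((`|epsP (f P) p * xiP (g P) p| `^ (2 + eta))%:E)
                  | P in Pfam] < +oo)%E) ->
    (exists c : R, 0 < c /\ forall P, Pfam P ->
       {ae Q P, forall om, forall n, c <= sigma2_bar P (f P) (g P) (w n) (A om)}) ->
    forall e : R, 0 < e -> exists N : nat, forall n, (N <= n)%N ->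
      forall P, Pfam P -> forall t : R,
      (`| Q P [set om | (S P (f P) (g P) n om <= t)%R] - Phi t | <= e%:E)%E).
Proof.
move=> mw mfh mgh [C [C0 wC]] Rs zs S; split.
- move=> P f g u v _ model fX gY uE vE AAo Bfo Bgo [eta [eta0 eM]] ae e e0.
  have I0 : (0 <= \int[P]_p (`|epsP f p * xiP g p| `^ (2 + eta))%:E)%E.
    by apply: integral_ge0 => p _; rewrite lee_fin powR_ge0.
  pose M := fine (\int[P]_p (`|epsP f p * xiP g p| `^ (2 + eta))%:E).
  have M0 : 0 <= M by exact: fine_ge0.
  have eM' : (\int[P]_p (`|epsP f p * xiP g p| `^ (2 + eta))%:E <= M%:E)%E.
    by rewrite /M fineK// ge0_fin_numE.
  have mA : measurable_fun setT A by case: model.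
  have low (e1 : R) : 0 < e1 -> exists2 c : R, 0 < c & forall n P', [set P] P' ->
      (Q P' (~` (A @^-1` [set a | (c <= sigma2_bar P' f g (w n) a)%R])) <= e1%:E)%E.
    move=> e10.
    have [n|c c0 hc] := ae_uniform_low (Q P) (fun n om => sigma2_bar P f g (w n) (A om)) e1 _ ae e10.
      exact: (measurableT_comp (measurable_sigma2_bar P f g (w n) fX gY (mw n)) mA).
    by exists c => // n P' ->; exact: hc.
  (* Turns a fact about [P] into one about all members of the singleton family. *)
  have pw (X : probability (pt R dZ) R -> Prop) : X P -> forall P', [set P] P' -> X P'.
    by move=> XP P' ->.
  have [N hN] := uniform_studentized_clt Q D A Aux w fh gh mw mfh mgh C C0 wC [set P]
    (fun=> f) (fun=> g) (fun=> u) (fun=> v)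
    (pw (fun P' => sampling_model (Q P') P' D A Aux) model)
    (pw (fun P' => cexp_version P' xX f) fX) (pw (fun P' => cexp_version P' yY g) gY)
    (pw (fun P' => cexp_version_nneg P' (fun p => ((epsP f p) ^+ 2)%:E) u) uE)
    (pw (fun P' => cexp_version_nneg P' (fun p => ((xiP g p) ^+ 2)%:E) v) vE)
    AAo Bfo Bgo eta M eta0 M0
    (pw (fun P' => (\int[P']_p (`|epsP f p * xiP g p| `^ (2 + eta))%:E <= M%:E)%E) eM')
    low e e0.
  by exists N => n nN t; exact: hN.
- move=> Pfam f g u v _ model fX gY uE vE AAo Bfo Bgo [eta [eta0 eM]] [c [c0 ae]] e e0.
  set sp := ereal_sup _ in eM.
  (* For an empty family the supremum is [-oo], whence the case with [M = 0]; taking the maximum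
     with 0 gives the nonnegative [M] required later. *)
  have [M M0 spM] : exists2 M : R, 0 <= M & (sp <= M%:E)%E.
    case: sp eM => [r| |]// _; last by exists 0; rewrite ?leNye.
    by exists (Num.max r 0); rewrite ?le_max ?lexx ?orbT// lee_fin le_max lexx.
  have eM' P : Pfam P -> (\int[P]_p (`|epsP (f P) p * xiP (g P) p| `^ (2 + eta))%:E <= M%:E)%E.
    by move=> PP; apply: le_trans spM; apply: ereal_sup_ubound; exists P.
  have low (e1 : R) : 0 < e1 -> exists2 c : R, 0 < c & forall n P, Pfam P ->
      (Q P (~` (A @^-1` [set a | (c <= sigma2_bar P (f P) (g P) (w n) a)%R])) <= e1%:E)%E.
    move=> e10; exists c => // n P PP.
    have mA : measurable_fun setT A by case: (model P PP).
    have mG := measurable_good P (f P) (g P) (w n) c (fX P PP) (gY P PP) (mw n).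
    apply: (ae_forall_le (Q P) _ _ e1 _ (ltW e10) (ae P PP)).
      by apply: measurableC; rewrite -[X in measurable X]setTI; exact: mA.
    by move=> om h; apply; exact: h.
  exact: (uniform_studentized_clt Q D A Aux w fh gh mw mfh mgh C C0 wC Pfam f g u v
    model fX gY uE vE AAo Bfo Bgo eta M eta0 M0 eM' low e e0).
Qed.
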